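(* Let $\mathbb{X},\mathbb{Y}$ be lcscH spaces, $k\ge1$ and $f_t:\mathbb{X}^k\to\mathbb{Y}$, $t\ge1$, symmetric measurable maps. Let $\mu_t$ be either a Poisson process $\eta_t$ on $\mathbb{X}$ with intensity measure $\mathbb{K}_t:=t\mathbb{K}$ ($\mathbb{K}$ a fixed $\sigma$-finite measure), or a binomial process $\beta_t$ of $\lceil t\rceil$ i.i.d. points with distribution a fixed probability measure $\mathbb{K}_1$, with $\mathbb{K}_t:=\lceil t\rceil\mathbb{K}_1$. For a measurable $B\subset\mathbb{Y}$ let $$S_t(B):=\frac1{k!}\sum_{(x_1,\dots,x_k)\in\mu^k_{t,\neq}}\mathbf{1}(f_t(x_1,\dots,x_k)\in B).$$ Let $Z$ be Poisson distributed with mean $\lambda\in[0,\infty)$ and suppose $\mathbb{E}S_t(B)^2<\infty$. In the Poisson case ($\mu_t=\eta_t$, $t\ge1$), $$\mathbf{d}_{\mathbf{W}}(S_t(B),Z)\le|\mathbb{E}S_t(B)-\lambda|+2\big(\mathbb{E}S_t(B)^2-\mathbb{E}S_t(B)-(\mathbb{E}S_t(B))^2\big)\le|\mathbb{E}S_t(B)-\lambda|+\frac{2^{k+1}}{k!}r_t(B).$$ In the binomial case ($\mu_t=\beta_t$, $t\ge1$), $$\mathbf{d}_{\mathbf{W}}(S_t(B),Z)\le|\mathbb{E}S_t(B)-\lambda|+2\Big(\mathbb{E}S_t(B)^2-\mathbb{E}S_t(B)-\frac{(\lceil t\rceil-k)_k}{(\lceil t\rceil)_k}(\mathbb{E}S_t(B))^2\Big)+\frac{6^kk!}{t}(\mathbb{E}S_t(B))^2$$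 $$\le|\mathbb{E}S_t(B)-\lambda|+\frac{2^{k+1}}{k!}r_t(B)+\frac{6^kk!}{t}(\mathbb{E}S_t(B))^2.$$
   Context: $\mu^k_{t,\neq}$: $k$-tuples of distinct points of $\mu_t$. $(n)_k=n(n-1)\cdots(n-k+1)$, with $(n-k)_k/(n)_k:=0$ if $n<k$. $\mathbf{d}_{\mathbf{W}}(Y_1,Y_2):=\sup_h|\mathbb{E}h(Y_1)-\mathbb{E}h(Y_2)|$ over all $h:\mathbb{R}\to\mathbb{R}$ with Lipschitz constant at most one. For $k\ge2$, $$r_t(B):=\max_{1\le\ell\le k-1}\int_{\mathbb{X}^\ell}\Big(\int_{\mathbb{X}^{k-\ell}}\mathbf{1}(f_t(x_1,\dots,x_k)\in B)\,\mathbb{K}_t^{k-\ell}(d(x_{\ell+1},\dots,x_k))\Big)^2\mathbb{K}_t^\ell(d(x_1,\dots,x_\ell)),$$ and $r_t(B):=0$ if $k=1$. lcscH: locally compact Hausdorff with countable base. *)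

(* Defs.v *)
From HB Require Import structures.
From mathcomp Require Import all_boot all_order all_algebra fingroup perm.
From mathcomp Require Import all_classical all_reals all_analysis.
From mathcomp Require Import measurable_realfun lebesgue_integral poisson_distribution.
Set Implicit Arguments. Unset Strict Implicit. Unset Printing Implicit Defensive.
Import Order.TTheory GRing.Theory Num.Theory.
Import numFieldNormedType.Exports.
Local Open Scope classical_set_scope.
Local Open Scope ring_scope.

Definition lcscH (X : ptopologicalType) : Prop :=
  [/\ hausdorff_space X, locally_compact [set: X] & @second_countable X].

Definition borelT (X : ptopologicalType) := g_sigma_algebraType (@open X).

Definition prod_measurable d (X : measurableType d) (k : nat)
  : set (set ('I_k -> X)) :=
  <<s [set C | exists (i : 'I_k) (A : set X),
           measurable A /\ C = (fun x => x i) @^-1` A] >>.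

Definition measurable_prod_fun d d' (X : measurableType d)
  (Y : measurableType d') (k : nat) (f : ('I_k -> X) -> Y) : Prop :=
  forall B : set Y, measurable B -> @prod_measurable _ X k (f @^-1` B).

Definition symmetric_fun (X Y : Type) (k : nat) (f : ('I_k -> X) -> Y) : Prop :=
  forall (s : {perm 'I_k}) (x : 'I_k -> X), f (fun i => x (s i)) = f x.

Section iterated.
Context d (X : measurableType d) (R : realType).
Local Open Scope ereal_scope.

Definition nox : 'I_0 -> X := fun i => point.

Definition consf (n : nat) (x : X) (y : 'I_n -> X) : 'I_n.+1 -> X :=
  fun i => match unlift ord0 i with Some j => y j | None => x end.

Fixpoint iint (K : {measure set X -> \bar R}) (n : nat)
  : (('I_n -> X) -> \bar R) -> \bar R :=
  match n with
  | 0 => fun g => g nox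
  | m.+1 => fun g => \int[K]_x iint K (fun y => g (consf x y))
  end.

Definition catf (k l : nat) (hl : (l <= k)%N) (x : 'I_l -> X)
  (y : 'I_(k - l) -> X) : 'I_k -> X :=
  fun i => match @fintype.split l (k - l) (cast_ord (esym (subnKC hl)) i) with
           | inl j => x j | inr j => y j end.

Definition r_t d' (Y : measurableType d') (k : nat) (f : ('I_k -> X) -> Y)
  (B : set Y) (Kt : {measure set X -> \bar R}) : \bar R :=
  if (k <= 1)%N then 0 else
  \big[Order.max/0]_(l < k | (0 < l)%N)
    iint Kt (fun x : 'I_l -> X =>
      let inner := iint Kt (fun y : 'I_(k - l) -> X =>
                     (\1_B (f (catf (ltnW (ltn_ord l)) x y)) : R)%:E) in
      inner * inner).
End iterated.

Section processes.
Context d (X : measurableType d) (R : realType).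
Context dO (Omega : measurableType dO).
Local Open Scope ereal_scope.

(** A proper point process  mu = sum_{i < kappa} delta_{pt i}, where
    kappa : Omega -> \bar R takes values in {0,1,2,...} \cup {+oo}. *)
Definition counting (kappa : Omega -> \bar R) (pt : nat -> Omega -> X)
  (w : Omega) (A : set X) : \bar R :=
  \esum_(i in [set i : nat | (i%:R)%:E < kappa w]) (\1_A (pt i w) : R)%:E.

Definition poisson_pmf' (r : R) (n : nat) : R :=
  (r ^+ n / (n`!)%:R * expR (- r))%R.

Definition is_poisson_process (P : probability Omega R)
  (kappa : Omega -> \bar R) (pt : nat -> Omega -> X)
  (Kt : {measure set X -> \bar R}) : Prop :=
  [/\ measurable_fun setT kappa,
      (forall w, kappa w = +oo \/ exists n : nat, kappa w = (n%:R)%:E),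
      (forall i, measurable_fun setT (pt i)),
      (forall A : set X, measurable A -> Kt A = +oo ->
          P [set w | counting kappa pt w A = +oo] = 1) &
      (forall (m : nat) (A : 'I_m -> set X) (n : 'I_m -> nat),
          (forall j, measurable (A j)) ->
          (forall j, Kt (A j) < +oo) ->
          (forall j j', j != j' -> A j `&` A j' = set0) ->
          P [set w | forall j, counting kappa pt w (A j) = ((n j)%:R)%:E]
          = \prod_(j < m) (poisson_pmf' (fine (Kt (A j))) (n j))%:E)].

Definition is_binomial_process (P : probability Omega R) (n : nat)
  (pt : nat -> Omega -> X) (K1 : probability X R) : Prop :=
  (forall i, (i < n)%N -> measurable_fun setT (pt i)) /\
  (forall A : nat -> set X, (forall i, measurable (A i)) ->
     P [set w | forall i, (i < n)%N -> A i (pt i w)]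
     = \prod_(i < n) K1 (A i)).

(** S_t(B) = 1/k! sum over k-tuples of distinct points (distinct indices) *)
Definition S_stat d' (Y : measurableType d') (k : nat)
  (f : ('I_k -> X) -> Y) (B : set Y)
  (kappa : Omega -> \bar R) (pt : nat -> Omega -> X) (w : Omega) : \bar R :=
  ((k`!%:R)^-1)%:E *
  \esum_(i in [set i : {ffun 'I_k -> nat} | injective i /\
                 forall j, ((i j)%:R)%:E < kappa w])
     (\1_B (f (fun j => pt (i j) w)) : R)%:E.

Definition lip1 (h : R -> R) : Prop :=
  forall x y : R, (`|h x - h y| <= `|x - y|)%R.

Definition dW_poisson (P : probability Omega R) (S : Omega -> \bar R)
  (lambda : R) : \bar R :=
  ereal_sup [set e | exists h : R -> R, lip1 h /\
     e = `| \int[P]_w (h (fine (S w)))%:E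
            - \int[poisson_prob lambda 0%N]_n (h n%:R)%:E |].
End processes.

Definition ceiln (R : realType) (t : R) : nat := `|Num.ceil t|%N.

(* Main.v *)
(* Stein's method: if g solves lambda g(j+1) - j g(j) = h(j) - E h(Z), with
   |g| <= 1 because h is 1-Lipschitz, it suffices to compare E[T G(T)] with
   E[T] E[G(T+1)] for T = S_t(B) and 0 <= G <= 2 (take G = 1 + g).
   For n = k + m i.i.d. points, E[T G(T)] is C(n,k) times the integral of G(T)
   over the event that the first k points form a hit, while the last m points
   alone produce T' hits. There T >= 1 + T', so that
   |G(T) - G(1 + T')| <= 2 (T - 1 - T'), and T - 1 - T' counts the hits sharing
   between 1 and k - 1 points with the first k. Its integral is
   E T^2 - E T - c (E T)^2 with c = (n-k)_k / (n)_k, and grouping hits by the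
   size of the overlap bounds it by r_t(B). In the binomial case replacing T' by
   T costs a further 2 (1 - c) (E T)^2.
   A Poisson process restricted to a window W of finite mass M is a mixture, with
   weights exp(-M)/n!, of n i.i.d. points; in the factorial-moment sums the
   weights of n = k + m recombine to those of m, so no correction c survives.
   Windows are then increased to the whole space. *)
Require Import Defs.
From HB Require Import structures.
From mathcomp Require Import all_boot all_order all_algebra fingroup perm.
From mathcomp Require Import all_classical all_reals all_analysis.
From mathcomp Require Import measurable_realfun lebesgue_integral poisson_distribution.
From mathcomp Require Import zify ring lra.
Set Implicit Arguments. Unset Strict Implicit. Unset Printing Implicit Defensive.
Import Order.TTheory GRing.Theory Num.Theory.
Import numFieldNormedType.Exports.

(** * Counting injections *)

(** The definition of a Poisson process fixes only the joint law of counts on disjoint sets, while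
    the points carry an arbitrary labelling by [pt]. So the positions of the points in a window can
    be recovered only up to relabelling: summed over all bijections of the labels, their law on
    [window_size n] is a multiple of a product measure. This is enough for permutation-invariant
    events, hence for the number of hits. Making G nonnegative turns every comparison into one
    between integrals of nonnegative functions, where Tonelli and monotone convergence apply freely;
    moments are subtracted only once they are known to be finite. Origin of the constants: hits with
    overlap l carry the weight C(k,l) (k)_l / k!^2 <= C(k,l) / k!, the binomial coefficients sum to
    at most 2^k, and a factor 2 comes from the range of G. In the binomial case 1 - c <= k^2 / n
    with n >= t, and 2 k^2 <= 6^k. *)

Section injections.
Variables (T : finType) (k : nat).
Implicit Types p q : 'I_k -> T.

Lemma inj_same_image p q : injective p -> injective q ->
  p @: [set: 'I_k] = q @: [set: 'I_k] ->
  exists s : {perm 'I_k}, forall i, q i = p (s i).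
Proof.
move=> ip iq pq.
have H i : exists j, q i == p j.
  have : q i \in p @: [set: 'I_k] by rewrite pq; apply: imset_f.
  by case/imsetP => j _ ->; exists j.
pose g i := xchoose (H i).
have gE i : q i = p (g i) by exact/eqP/(xchooseP (H i)).
have ig : injective g by move=> i j gij; apply: iq; rewrite !gE gij.
by exists (perm ig) => i; rewrite permE.
Qed.

(** Each injection is extended to an enumeration of [T] by listing the missed points after its
    codomain; the permutation matches the two lists position by position. It lets a relabelling of
    all points move any tuple of indices to any other. *)
Lemma inj_extend_perm p q : injective p -> injective q ->
  exists s : {perm T}, forall i, s (p i) = q i.
Proof.
move=> ip iq.
pose ext (r : 'I_k -> T) := codom r ++ [seq x <- enum T | x \notin codom r].
have ext_uniq r : injective r -> uniq (ext r).
  move=> ir; rewrite cat_uniq map_inj_uniq ?enum_uniq//= filter_uniq ?enum_uniq//.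
  by rewrite andbT; apply/hasPn => x; rewrite mem_filter => /andP[].
have ext_mem r x : x \in ext r.
  by rewrite mem_cat mem_filter mem_enum inE andbT orbN.
have ext_size r : injective r -> size (ext r) = #|T|.
  move=> ir; rewrite cardE; apply: perm_size; apply: uniq_perm.
  - exact: ext_uniq.
  - exact: enum_uniq.
  - by move=> x; rewrite ext_mem mem_enum.
pose g x := nth x (ext q) (index x (ext p)).
have lt_index x : index x (ext p) < size (ext q).
  by rewrite ext_size// -(ext_size p)// index_mem ext_mem.
have ig : injective g.
  move=> x y /eqP; rewrite /g (set_nth_default x y) ?lt_index//.
  rewrite nth_uniq ?ext_uniq ?lt_index// => /eqP /(congr1 (nth x (ext p))).
  by rewrite !nth_index ?ext_mem.
exists (perm ig) => i; rewrite permE /g.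
have lt_ic (r r' : 'I_k -> T) : index (r i) (codom r) < size (codom r').
  have -> : size (codom r') = size (codom r) by rewrite !size_codom.
  by rewrite index_mem codom_f.
rewrite /ext index_cat codom_f nth_cat lt_ic.
have -> : index (p i) (codom p) = index i (enum 'I_k) by rewrite index_map.
by rewrite (nth_map i) ?index_mem ?mem_enum// nth_index ?mem_enum.
Qed.

Lemma card_inj_same_image q : injective q ->
  #|[set j : {ffun 'I_k -> T} | injectiveb j & j @: [set: 'I_k] == q @: [set: 'I_k]]|
  = k`!.
Proof.
move=> iq.
pose F (s : {perm 'I_k}) : {ffun 'I_k -> T} := [ffun i => q (s i)].
have iF : injective F.
  move=> s s' /ffunP ss'; apply/permP => i; apply: iq.
  by have := ss' i; rewrite !ffunE.
rewrite -[in RHS](card_ord k) -cardsT -(card_perm [set: 'I_k]).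
have -> : #|perm_on [set: 'I_k]| = #|[set: {perm 'I_k}]|.
  by apply: eq_card => s; rewrite !inE; apply/fintype.subsetP => i; rewrite inE.
rewrite -(card_imset _ iF); apply: eq_card => j; rewrite inE.
apply/andP/imsetP => [[/injectiveP ij /eqP jq]|[s _ ->]].
  have [s sE] := inj_same_image iq ij (esym jq).
  by exists s => //; apply/ffunP => i; rewrite ffunE.
split; first by apply/injectiveP => x y; rewrite !ffunE => /iq /perm_inj.
apply/eqP/setP => y; apply/imsetP/imsetP => -[x _ ->].
  by exists (s x) => //; rewrite ffunE.
by exists ((s^-1)%g x) => //; rewrite ffunE permKV.
Qed.

End injections.

(* Coloured falling factorial: pick the values one at a time; a value of
   colour [c] excludes the earlier ones of the same colour. *)
Lemma card_uniq_coloured_tuples (T C : finType) (col : T -> C) n (b : n.-tuple C) :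
  #|[set t : n.-tuple T | uniq t & map col t == b]|
  = \prod_c #|[set x | col x == c]| ^_ (count_mem c b).
Proof.
elim: n b => [|n IHn] b.
  rewrite (tuple0 b) big1 => [|c _]; last by rewrite ffactn0.
  rewrite (eq_card (B := pred1 [tuple of [::]])) ?card1// => t.
  by rewrite !inE (tuple0 t) /= !eqxx.
case/tupleP: b => c0 b.
have -> : \prod_c #|[set x | col x == c]| ^_ (count_mem c [tuple of c0 :: b]) =
  (\prod_c #|[set x | col x == c]| ^_ (count_mem c b)) *
  (#|[set x | col x == c0]| - count_mem c0 b).
  rewrite (bigD1 c0)//= [in RHS](bigD1 c0)//= eqxx add1n ffactnSr -!mulnA.
  congr (_ * _); rewrite mulnC; congr (_ * _); apply: eq_bigr => c.
  by rewrite eq_sym => /negbTE ->; rewrite add0n.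
rewrite -IHn.
pose D := [set t : n.-tuple T | uniq t & map col t == b].
transitivity (\sum_(t in D) #|[set x | col x == c0] :\: [set x in t]|).
  rewrite -sum1_card (partition_big (fun t : n.+1.-tuple T => [tuple of behead t])
    (fun t => t \in D)) /=; last first.
    case/tupleP => x t; rewrite !inE /= => /andP[/andP[_ ut] /eqP[_ tb]].
    by apply/andP; split => //; apply/eqP.
  apply: eq_bigr => t tD; rewrite sum1_card.
  have iF : injective (fun x => [tuple of x :: t]) by move=> x y /(congr1 val)[].
  rewrite -(card_imset _ iF); apply: eq_card => u.
  rewrite unfold_in /= inE; apply/idP/imsetP.
    case/tupleP: u => x u /andP[/andP[/= /andP[xu uu] /eqP[cx cu]] /eqP ut].
    have {}ut : u = t by apply/val_inj; rewrite -ut.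
    by exists x; rewrite ?ut// !inE cx eqxx andbT -ut.
  move=> [x]; rewrite !inE => /andP[xt /eqP cx] ->.
  move: tD; rewrite inE => /andP[ut /eqP tb].
  apply/andP; split; last by apply/eqP/val_inj.
  by rewrite /= xt ut cx tb eqxx.
rewrite (eq_bigr (fun=> #|[set x | col x == c0]| - count_mem c0 b)) ?sum_nat_const//.
move=> t; rewrite inE => /andP[ut /eqP tb].
rewrite cardsD; congr (_ - _).
rewrite -tb count_map -size_filter.
have /card_uniqP <- := filter_uniq (preim col (pred1 c0)) ut.
by apply: eq_card => x; rewrite !inE mem_filter.
Qed.

(** Used twice: with two colours it counts injections by their overlap with the first [k] indices,
    and with the cells of a partition as colours it counts relabellings of the points of a
    window. *)
Lemma card_inj_coloured (T C : finType) (col : T -> C) n (b : 'I_n -> C) :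
  #|[set j : {ffun 'I_n -> T} | injectiveb j & [forall i, col (j i) == b i]]|
  = \prod_c #|[set x | col x == c]| ^_ #|[set i | b i == c]|.
Proof.
have cnt c : count_mem c [tuple b i | i < n] = #|[set i | b i == c]|.
  rewrite count_map -size_filter cardE; congr size.
  rewrite val_ord_tuple [in RHS]/enum_mem -enumT.
  by apply: eq_filter => i /=; rewrite inE.
under eq_bigr do rewrite -cnt.
rewrite -card_uniq_coloured_tuples.
pose F (t : n.-tuple T) : {ffun 'I_n -> T} := [ffun i => tnth t i].
have iF : injective F.
  move=> t t' /ffunP tt'; apply: eq_from_tnth => i.
  by have := tt' i; rewrite !ffunE.
rewrite -(card_imset _ iF); apply: eq_card => j; rewrite !inE.
apply/andP/imsetP.
  move=> [/injectiveP ij /forallP jb]; exists [tuple j i | i < n].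
    rewrite inE map_inj_uniq ?enum_uniq//= -map_comp; apply/eqP.
    by apply: eq_map => i /=; exact/eqP/jb.
  by apply/ffunP => i; rewrite ffunE tnth_mktuple.
move=> [t]; rewrite inE => /andP[ut /eqP tb] ->; split.
  apply/injectiveP => x y; rewrite !ffunE => xy.
  by apply: (tuple_uniqP _ ut).
apply/forallP => i; rewrite ffunE -tnth_map; apply/eqP.
by rewrite -[RHS](tnth_mktuple b); congr tnth; exact/val_inj.
Qed.

(** * Hits in a finite configuration and their overlaps *)

Section configuration_count.
Variables (X : Type) (k : nat) (a : ('I_k -> X) -> bool).

Definition inj_cnt n (x : 'I_n -> X) : nat :=
  \sum_(j : {ffun 'I_k -> 'I_n} | injectiveb j) a (x \o j).

(** The value of S_t(B) on the configuration [x], kept in [nat] so that Stein's functions apply to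
    it directly. The division is exact once [a] is symmetric. *)
Definition set_cnt n (x : 'I_n -> X) : nat := inj_cnt x %/ k`!.

Hypothesis asym : forall (s : {perm 'I_k}) x, a (x \o s) = a x.

Lemma sym_same_image n (x : 'I_n -> X) (p q : 'I_k -> 'I_n) :
  injective p -> injective q -> p @: [set: 'I_k] = q @: [set: 'I_k] ->
  a (x \o p) = a (x \o q).
Proof.
move=> ip iq pq; have [s sE] := inj_same_image ip iq pq.
rewrite -(asym s (x \o p)); congr a.
by apply: functional_extensionality_dep => i /=; rewrite sE.
Qed.

(** Injections are grouped by their image; [a] is constant on each group, and a nonempty group has
    [k!] members. *)
Lemma dvdn_inj_cnt n (x : 'I_n -> X) : k`! %| inj_cnt x.
Proof.
rewrite /inj_cnt (partition_big (fun j : {ffun 'I_k -> 'I_n} => j @: [set: 'I_k])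
  predT) //=; apply: dvdn_sum => I _.
case: (pickP (fun j : {ffun 'I_k -> 'I_n} =>
    injectiveb j && (j @: [set: 'I_k] == I))) => [q|none]; last first.
  by rewrite big_pred0.
move=> /andP[/injectiveP iq /eqP <-].
rewrite (eq_bigr (fun=> nat_of_bool (a (x \o q)))); last first.
  move=> j /andP[/injectiveP ij /eqP jq].
  by rewrite (sym_same_image _ ij iq jq).
rewrite sum_nat_const -[X in X * _]cardsE card_inj_same_image//.
exact: dvdn_mulr.
Qed.

Lemma set_cntE n (x : 'I_n -> X) : inj_cnt x = set_cnt x * k`!.
Proof. by rewrite /set_cnt divnK// dvdn_inj_cnt. Qed.

Lemma inj_cnt_perm n (x : 'I_n -> X) (s : {perm 'I_n}) :
  inj_cnt (x \o s) = inj_cnt x.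
Proof.
pose F t (j : {ffun 'I_k -> 'I_n}) : {ffun 'I_k -> 'I_n} :=
  [ffun i => (t : {perm 'I_n}) (j i)].
have FK t : cancel (F t) (F (t^-1)%g).
  by move=> j; apply/ffunP => i; rewrite !ffunE permK.
have injF t (j : {ffun 'I_k -> 'I_n}) : injectiveb j -> injectiveb (F t j).
  by move=> /injectiveP ij; apply/injectiveP => u v; rewrite !ffunE => /perm_inj/ij.
rewrite /inj_cnt [RHS](reindex_inj (can_inj (FK s))).
apply: eq_big => [j|j ij].
  apply/idP/idP; first exact: injF.
  by move=> /(injF (s^-1)%g); rewrite FK.
by congr (nat_of_bool (a _)); apply: functional_extensionality_dep => i /=; rewrite ffunE.
Qed.

Lemma set_cnt_perm n (x : 'I_n -> X) (s : {perm 'I_n}) :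
  set_cnt (x \o s) = set_cnt x.
Proof. by rewrite /set_cnt inj_cnt_perm. Qed.

Lemma inj_cnt_small n (x : 'I_n -> X) : n < k -> inj_cnt x = 0.
Proof.
move=> nk; rewrite /inj_cnt big_pred0// => j; apply/negP => /injectiveP ij.
by have := leq_card _ ij; rewrite !card_ord leqNgt nk.
Qed.

Lemma inj_cnt_le n (x : 'I_n -> X) : inj_cnt x <= n ^_ k.
Proof.
rewrite -[n in n ^_ k]card_ord -[k in _ ^_ k]card_ord -card_inj_ffuns.
rewrite -sum1_card /inj_cnt; apply: (@leq_trans (\sum_(j : {ffun 'I_k -> 'I_n} | injectiveb j) 1)).
  by apply: leq_sum => j _; exact: leq_b1.
by rewrite leq_eqVlt; apply/orP; left; apply/eqP; apply: eq_bigl => j; rewrite !inE.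
Qed.

Definition overlap m (j : {ffun 'I_k -> 'I_(k + m)}) : nat :=
  #|[set i | j i < k]|.

Lemma overlap_le m (j : {ffun 'I_k -> 'I_(k + m)}) : overlap j <= k.
Proof. by rewrite -[X in _ <= X](card_ord k) max_card. Qed.

Lemma inj_cnt_overlap0 m (x : 'I_(k + m) -> X) :
  \sum_(j : {ffun 'I_k -> 'I_(k + m)} | injectiveb j && (overlap j == 0)) a (x \o j)
  = inj_cnt (x \o @rshift k m).
Proof.
rewrite /inj_cnt.
pose F (j : {ffun 'I_k -> 'I_m}) : {ffun 'I_k -> 'I_(k + m)} := [ffun i => rshift k (j i)].
have iF : injective F.
  move=> j j' /ffunP jj'; apply/ffunP => i.
  by have := jj' i; rewrite !ffunE => /rshift_inj.
transitivity (\sum_(j in F @: [set j : {ffun 'I_k -> 'I_m} | injectiveb j]) (a (x \o j) : nat)).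
  apply: eq_bigl => j; apply/andP/imsetP.
    move=> [/injectiveP ij]; rewrite cards_eq0 => /eqP j0.
    have H i : exists v, j i == rshift k v.
      case: (split_ordP (j i)) => v jv; last by exists v; rewrite jv.
      by have := finset.in_set0 i; rewrite -j0 inE jv /= ltn_ord.
    have gE i : j i = rshift k (xchoose (H i)) by exact/eqP/(xchooseP (H i)).
    exists [ffun i => xchoose (H i)]; last by apply/ffunP => i; rewrite !ffunE.
    by rewrite inE; apply/injectiveP => u v; rewrite !ffunE => uv; apply: ij; rewrite !gE uv.
  move=> [v]; rewrite inE => /injectiveP iv ->; split.
    by apply/injectiveP => i i'; rewrite !ffunE => /rshift_inj/iv.
  by rewrite cards_eq0; apply/eqP/setP => i; rewrite !inE ffunE /= ltnNge leq_addr.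
rewrite big_imset /=; last by move=> ? ? _ _; exact: iF.
apply: eq_big => [j|j _]; first by rewrite inE.
by congr (nat_of_bool (a _)); apply: functional_extensionality_dep => i /=; rewrite ffunE.
Qed.

(** Full overlap forces the image to be the set of the first [k] indices, so these tuples are the
    orderings of a single hit. *)
Lemma inj_cnt_overlapk m (x : 'I_(k + m) -> X) :
  \sum_(j : {ffun 'I_k -> 'I_(k + m)} | injectiveb j && (overlap j == k)) a (x \o j)
  = a (x \o @lshift k m) * k`!.
Proof.
have il := @lshift_inj k m.
have H (j : {ffun 'I_k -> 'I_(k + m)}) : injective j ->
    (overlap j == k) = (j @: [set: 'I_k] == @lshift k m @: [set: 'I_k]).
  move=> ij; rewrite eqEcard !card_imset// leqnn andbT /overlap.
  rewrite -[X in _ == X]card_ord -cardsT; apply/idP/fintype.subsetP.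
    move=> cT u /imsetP[i _ ->].
    have : i \in [set i | j i < k].
      suff -> : [set i | j i < k] = [set: 'I_k] by rewrite inE.
      by apply/eqP; rewrite eqEcard finset.subsetT /= (eqP cT).
    by rewrite inE => ji; apply/imsetP; exists (Ordinal ji) => //; exact/val_inj.
  move=> jl; apply/eqP; apply: eq_card => i; rewrite !inE.
  have /imsetP[v _ ->] : j i \in @lshift k m @: [set: 'I_k] by apply/jl/imset_f.
  by rewrite /= ltn_ord.
rewrite (eq_bigr (fun=> nat_of_bool (a (x \o @lshift k m)))); last first.
  move=> j /andP[/injectiveP ij]; rewrite H// => /eqP jl.
  by rewrite (sym_same_image _ ij il jl).
rewrite sum_nat_const -[X in X * _]cardsE mulnC -(card_inj_same_image il).
congr (_ * _); apply: eq_card => j; rewrite !inE unfold_in /=.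
by case: (boolP (injectiveb j)) => //= /injectiveP ij; rewrite H.
Qed.

(** Tuples are sorted by overlap: [k] gives the reference hit, 0 the hits among the last [m] points,
    and what lies strictly between is the dependence to be estimated. For [k = 0] the first two
    classes would coincide. *)
Lemma inj_cnt_split m (x : 'I_(k + m) -> X) : 0 < k -> a (x \o @lshift k m) ->
  inj_cnt x = k`! + inj_cnt (x \o @rshift k m) +
    \sum_(j : {ffun 'I_k -> 'I_(k + m)} | injectiveb j && (0 < overlap j < k)) a (x \o j).
Proof.
move=> k0 ax.
rewrite {1}/inj_cnt (bigID (fun j : {ffun 'I_k -> 'I_(k + m)} => overlap j == k)) /= inj_cnt_overlapk ax mul1n -addnA.
congr (_ + _); rewrite (bigID (fun j : {ffun 'I_k -> 'I_(k + m)} => overlap j == 0)) /= -inj_cnt_overlap0.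
congr (_ + _); apply: eq_bigl => j; rewrite -andbA; congr (_ && _).
  by case: (overlap j =P 0) => [->|]; rewrite ?andbF// andbT; lia.
by rewrite lt0n ltn_neqAle overlap_le andbT andbC.
Qed.

(** Choose the [l] positions sent to the first [k] indices, inject them there, and inject the other
    [k - l] positions into the last [m] indices: the two-colour case of [card_inj_coloured]. *)
Lemma sum_overlap (V : nmodType) m (F : nat -> V) (P : pred nat) :
  (\sum_(j : {ffun 'I_k -> 'I_(k + m)} | injectiveb j && P (overlap j)) F (overlap j)
   = \sum_(l < k.+1 | P l) F l *+ ('C(k, l) * k ^_ l * m ^_ (k - l)))%R.
Proof.
pose col (v : 'I_(k + m)) : bool := v < k.
have cT : #|[set v | col v == true]| = k.
  rewrite -[RHS]card_ord -cardsT -(card_imset _ (@lshift_inj k m)).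
  apply: eq_card => v; rewrite !inE eqb_id /col.
  case: (split_ordP v) => u -> /=; first by rewrite imset_f.
  apply/esym/negP => /imsetP[w _ /eqP].
  by rewrite eq_rlshift.
have cF : #|[set v | col v == false]| = m.
  apply/eqP; rewrite -(eqn_add2l k) -{1}cT.
  have -> : [set v | col v == false] = ~: [set v | col v == true].
    by apply/setP => v; rewrite !inE eqb_id eqbF_neg.
  by rewrite cardsC card_ord.
rewrite (partition_big (fun j : {ffun 'I_k -> 'I_(k + m)} => [set i | col (j i)])
  (fun L : {set 'I_k} => P #|L|)) /=; last by move=> j /andP[].
rewrite [RHS](eq_bigr (fun l : 'I_k.+1 => \sum_(L : {set 'I_k} | #|L| == l)
    F #|L| *+ (k ^_ #|L| * m ^_ (k - #|L|)))%R); last first.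
  move=> l _; rewrite (eq_bigr (fun=> F l *+ (k ^_ l * m ^_ (k - l))))%R; last first.
    by move=> L /eqP ->.
  rewrite sumr_const -mulrnA; congr (_ *+ _)%R.
  by rewrite -mulnA mulnC -cardsE card_draws card_ord.
rewrite [RHS](exchange_big_dep (fun L : {set 'I_k} => P #|L|)) /=; last first.
  by move=> l L Pl /eqP ->.
apply: eq_bigr => L PL.
have Lk : #|L| < k.+1 by rewrite ltnS -[X in _ <= X](card_ord k) max_card.
rewrite [RHS](big_pred1 (Ordinal Lk)); last first.
  move=> l /=; rewrite -(inj_eq val_inj) /= [RHS]eq_sym.
  by case: eqP => [<-|]; rewrite ?PL ?andbF.
rewrite (eq_bigr (fun=> F #|L|)); last by move=> j /andP[_ /eqP <-].
rewrite sumr_const; congr (_ *+ _)%R.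
have := card_inj_coloured col (fun i => i \in L).
rewrite big_bool /= cT cF.
have -> : #|[set i | (i \in L) == true]| = #|L|.
  by apply: eq_card => i; rewrite !inE eqb_id.
have -> : #|[set i | (i \in L) == false]| = k - #|L|.
  have -> : [set i | (i \in L) == false] = ~: L.
    by apply/setP => i; rewrite !inE eqbF_neg.
  by rewrite cardsCs finset.setCK card_ord.
move=> <-; apply: eq_card => j; rewrite !inE unfold_in /= -andbA; congr (_ && _).
apply/andP/forallP.
  by move=> [_ /eqP jL] i; apply/eqP; rewrite -jL inE.
move=> jL; have {}jL : [set i | col (j i)] = L.
  by apply/setP => i; rewrite inE (eqP (jL i)).
by rewrite /overlap -/(col _) jL.
Qed.

End configuration_count.

Local Open Scope classical_set_scope.
Local Open Scope ring_scope.
Local Open Scope ereal_scope.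

(** * Powers of a finite measure *)

Section power_space.
Context d (X : measurableType d) (R : realType).

Definition cylinders n : set (set ('I_n -> X)) :=
  [set C | exists (i : 'I_n) (A : set X),
     measurable A /\ C = (fun x => x i) @^-1` A].

(** The sigma-algebra is that of [prod_measurable], made into a measurable type so that product
    measures and Tonelli are available on it. *)
Definition power n := g_sigma_algebraType (@cylinders n).

Lemma measurable_coord n (i : 'I_n) :
  measurable_fun setT (fun x : power n => x i).
Proof.
move=> _ A mA; rewrite setTI; apply: sub_sigma_algebra.
by exists i, A.
Qed.

Lemma measurable_fun_power d' (T : measurableType d') n (F : T -> power n) :
  (forall i, measurable_fun setT (fun w => F w i)) -> measurable_fun setT F.
Proof.
move=> mF; apply: (@measurability _ _ _ _ setT F (@cylinders n)) => //.
move=> _ [_ [i [A [mA ->]]] <-].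
by have := mF i measurableT A mA.
Qed.

Definition box n (E : 'I_n -> set X) : set (power n) :=
  [set x | forall i, E i (x i)].

Lemma measurable_box n (E : 'I_n -> set X) :
  (forall i, measurable (E i)) -> measurable (box E).
Proof.
move=> mE; have -> : box E = \bigcap_(i in [set: 'I_n]) (fun x : power n => x i) @^-1` E i.
  by apply/seteqP; split => x /=; [move=> Ex i _|move=> Ex i]; exact: Ex.
apply: fin_bigcap_measurable => // i _.
by rewrite -[X in measurable X]setTI; exact: measurable_coord.
Qed.

(** Boxes are stable under intersection, include the whole space and generate the sigma-algebra.
    Later identities of laws on [power n] are thereby reduced to products over the coordinates. *)
Lemma power_measure_unique n (m1 m2 : {measure set (power n) -> \bar R}) :
  m1 setT < +oo ->
  (forall E, (forall i, measurable (E i)) -> m1 (box E) = m2 (box E)) ->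
  forall A, measurable A -> m1 A = m2 A.
Proof.
move=> m1T m12 A mA.
pose G := [set B : set (power n) | exists2 E, (forall i, measurable (E i)) & B = box E].
have GT : G setT.
  by exists (fun=> setT) => //; apply/seteqP; split.
apply: (measure_unique G (fun=> setT)) => //.
- apply/seteqP; split.
    apply: sub_smallest2r; last first.
      move=> _ [i [B [mB ->]]].
      exists (fun j => if j == i then B else setT) => [j|]; first by case: ifP.
      apply/seteqP; split => x /=; first by move=> Bx j; case: eqP => // ->.
      by move=> /(_ i); rewrite eqxx.
    exact: smallest_sigma_algebra.
  apply: smallest_sub; first exact: sigma_algebra_measurable.
  by move=> _ [E mE ->]; exact: measurable_box.
- move=> _ _ [E mE ->] [F mF ->]; exists (fun i => E i `&` F i).
    by move=> i; exact: measurableI.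
  apply/seteqP; split => x /=; first by move=> [Ex Fx] i; split; [exact: Ex|exact: Fx].
  by move=> EFx; split=> i; case: (EFx i).
- by rewrite bigcup_const.
- by move=> _ [E mE ->]; exact: m12.
Qed.

Lemma measurable_consf n :
  measurable_fun setT (fun p : X * power n => consf p.1 p.2 : power n.+1).
Proof.
apply: measurable_fun_power => i; rewrite /consf.
case: (unlift ord0 i) => [j|]; last exact: measurable_fst.
exact: (measurableT_comp (measurable_coord j) measurable_snd).
Qed.

Lemma measurable_catf k l (hl : (l <= k)%N) :
  measurable_fun setT
    (fun p : power l * power (k - l) => catf hl p.1 p.2 : power k).
Proof.
apply: measurable_fun_power => i; rewrite /catf.
case: fintype.split => j.
  exact: (measurableT_comp (measurable_coord j) measurable_fst).
exact: (measurableT_comp (measurable_coord j) measurable_snd).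
Qed.

Lemma measurable_reindex m n (t : 'I_m -> 'I_n) :
  measurable_fun setT (fun x : power n => x \o t : power m).
Proof. by apply: measurable_fun_power => i; exact: measurable_coord. Qed.

End power_space.

(** Concatenation landing in ['I_(m + n)], free of the cast that [catf] needs to land in ['I_k]. *)
Definition ccat (X : Type) m n (x : 'I_m -> X) (y : 'I_n -> X) : 'I_(m + n) -> X :=
  fun i => match fintype.split i with inl j => x j | inr j => y j end.

Lemma ccat_lshift (X : Type) m n (x : 'I_m -> X) (y : 'I_n -> X) j :
  ccat x y (lshift n j) = x j.
Proof. by rewrite /ccat (unsplitK (inl _ j)). Qed.

Lemma ccat_rshift (X : Type) m n (x : 'I_m -> X) (y : 'I_n -> X) j :
  ccat x y (rshift m j) = y j.
Proof. by rewrite /ccat (unsplitK (inr _ j)). Qed.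

Lemma ccatKl (X : Type) m n (x : 'I_m -> X) (y : 'I_n -> X) :
  ccat x y \o @lshift m n = x.
Proof. by apply/funext => i; exact: ccat_lshift. Qed.

Lemma ccatKr (X : Type) m n (x : 'I_m -> X) (y : 'I_n -> X) :
  ccat x y \o @rshift m n = y.
Proof. by apply/funext => i; exact: ccat_rshift. Qed.

Lemma measurable_ccat d (X : measurableType d) m n :
  measurable_fun setT
    (fun p : power X m * power X n => ccat p.1 p.2 : power X (m + n)).
Proof.
apply: measurable_fun_power => i; rewrite /ccat; case: fintype.split => j.
  exact: (measurableT_comp (measurable_coord j) measurable_fst).
exact: (measurableT_comp (measurable_coord j) measurable_snd).
Qed.

(** * Iterated integrals as integrals against finite product measures *)

Section finite_product.
Context d (X : measurableType d) (R : realType).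

Lemma finite_measureP d' (T : measurableType d') (m : {measure set T -> \bar R}) :
  m setT < +oo ->
  exists m' : {finite_measure set T -> \bar R}, forall A, m' A = m A.
Proof.
move=> mT; exists (mfrestr measurableT mT) => A.
by rewrite /= /mfrestr /mrestr /= setIT.
Qed.

(** Existential, so that the image measure becomes a variable about which only its values and its
    integrals of nonnegative functions are known. *)
Lemma pushforwardP d1 d2 (T1 : measurableType d1) (T2 : measurableType d2)
    (m : {measure set T1 -> \bar R}) (f : T1 -> T2) : measurable_fun setT f ->
  exists m' : {measure set T2 -> \bar R},
    (forall A, m' A = m (f @^-1` A)) /\
    forall u : T2 -> \bar R, measurable_fun setT u -> (forall x, 0 <= u x) ->
      \int[m']_x u x = \int[m]_x u (f x).
Proof.
move=> mf.
exists (measure_function_pushforward__canonical__measure_function_Measure m mf).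
split=> // u mu u0; rewrite ge0_integral_pushforward//.
Qed.

Lemma iintS (K : {measure set X -> \bar R}) n (u : ('I_n.+1 -> X) -> \bar R) :
  iint K u = \int[K]_x iint K (fun y => u (consf x y)).
Proof. by []. Qed.

(** The measure is built along the recursion of [iint]: the product of [K] with the measure for [n],
    pushed forward by [consf]. Tonelli then reproduces one step of the iterated integral. *)
Lemma iint_integral (K : {finite_measure set X -> \bar R}) n :
  exists mu : {finite_measure set (power X n) -> \bar R},
  forall u : power X n -> \bar R, measurable_fun setT u -> (forall x, 0 <= u x) ->
    iint K u = \int[mu]_x u x.
Proof.
elim: n => [|n [mu IH]].
  exists (@dirac _ (power X 0) (@nox _ X) R) => u mu u0.
  by rewrite integral_dirac//= diracE in_setT mul1e; congr u.
have mc := @measurable_consf _ X n.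
have [nu [nuE nui]] := pushforwardP (K \x mu) mc.
have [|nu' nu'E] := @finite_measureP _ _ nu.
  rewrite nuE preimage_setT.
  apply: (@le_lt_trans _ _ (K setT * mu setT)).
    by rewrite -product_measure1E// setXTT.
  by rewrite lte_mul_pinfty// ?fin_num_measure// ltey_eq fin_num_measure.
exists nu' => u mu' u0.
rewrite (eq_measure_integral nu) ?nui//; last by move=> A _ _; exact: nu'E.
rewrite fubini_tonelli1//; last exact: measurableT_comp mc.
apply: eq_integral => x _; rewrite /fubini_F.
apply: (IH (fun y => u (consf x y))) => //.
exact: (measurableT_comp (measurableT_comp mu' mc) (pair1_measurable x)).
Qed.

Definition pmeasure (K : {finite_measure set X -> \bar R}) n :
  {finite_measure set (power X n) -> \bar R} := projT1 (cid (iint_integral K n)).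

Variable K : {finite_measure set X -> \bar R}.
Local Notation "K ^^ n" := (pmeasure K n) (at level 30).

Lemma iintE n (u : power X n -> \bar R) : measurable_fun setT u ->
  (forall x, 0 <= u x) -> iint K u = \int[K ^^ n]_x u x.
Proof. by rewrite /pmeasure; case: cid => /= mu; apply. Qed.

Lemma iint_box n (E : 'I_n -> set X) : (forall i, measurable (E i)) ->
  iint K (fun x => (\1_(box E) x : R)%:E) = \prod_(i < n) K (E i).
Proof.
elim: n E => [E _|n IH E mE].
  rewrite big_ord0 -[LHS]/((\1_(box E) (@nox _ X) : R)%:E) indicE mem_set//.
  by case.
rewrite big_ord_recl -IH// iintS.
transitivity (\int[K]_x ((\1_(E ord0) x : R)%:E *
   iint K (fun y => (\1_(box (fun i => E (lift ord0 i))) y : R)%:E))).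
  apply: eq_integral => x _; rewrite indicE.
  case: (boolP (x \in E ord0)) => xE; rewrite ?mul1e ?mul0e.
    congr (iint K _); apply/funext => y; congr EFin; rewrite !indicE; congr (_%:R).
    congr nat_of_bool; apply/idP/idP => /set_mem Exy; apply/mem_set => i.
      by have := Exy (lift ord0 i); rewrite /consf liftK.
    rewrite /consf; case: unliftP => [j ->|->]; first exact: Exy.
    exact/set_mem.
  have -> : (fun y => (\1_(box E) (consf x y) : R)%:E) = cst 0.
    apply/funext => y; rewrite indicE memNset// => /(_ ord0).
    by rewrite /consf unlift_none => /mem_set; apply/negP.
  rewrite iintE//; first exact: integral0.
have mb : measurable_fun setT
    (fun y : power X n => (\1_(box (fun i => E (lift ord0 i))) y : R)%:E).
  by apply/measurable_EFinP; apply: measurable_indic; exact: measurable_box.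
rewrite ge0_integralZr//.
- by rewrite integral_indic// setIT.
- by apply/measurable_EFinP; exact: measurable_indic.
- by rewrite iintE//; apply: integral_ge0 => x _; rewrite lee_fin.
Qed.

Lemma pmeasure_box n (E : 'I_n -> set X) : (forall i, measurable (E i)) ->
  (K ^^ n) (box E) = \prod_(i < n) K (E i).
Proof.
move=> mE; have mb := measurable_box mE.
rewrite -iint_box// iintE//; first by rewrite integral_indic// setIT.
exact/measurable_EFinP/measurable_indic.
Qed.

Lemma prode_const (I : finType) (P : pred I) (x : \bar R) :
  \prod_(i | P i) x = x ^+ #|P|.
Proof.
by rewrite big_const; elim: #|_| => [|m IH]; rewrite ?expe0// iterS IH expeS.
Qed.

(** Each of the [n - m] unselected coordinates integrates out to a factor [K setT]. For [m = n] this
    is invariance under permutations of the points. *)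
Lemma integral_reindex m n (t : 'I_m -> 'I_n) (u : power X m -> \bar R) :
  injective t -> measurable_fun setT u -> (forall x, 0 <= u x) ->
  \int[K ^^ n]_x u (x \o t) = K setT ^+ (n - m) * \int[K ^^ m]_x u x.
Proof.
move=> it mu u0.
have mt := @measurable_reindex _ X m n t.
have [nu [nuE nui]] := pushforwardP (K ^^ n) mt.
rewrite -(nui u)//.
have [c c0 cE] : exists2 c : {nonneg R}, true & (c%:num)%:E = K setT ^+ (n - m).
  have KT : (0 <= fine (K setT) ^+ (n - m))%R by rewrite exprn_ge0// fine_ge0.
  exists (NngNum KT) => //=; rewrite EFin_expe fineK// fin_num_measure//.
rewrite -cE -ge0_integral_mscale//.
apply: eq_measure_integral => A mA _.
apply: power_measure_unique => //.
  by rewrite nuE preimage_setT -ge0_fin_numE// fin_num_measure.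
move=> E mE; rewrite nuE -[RHS]/((c%:num)%:E * (K ^^ m) (box E)) pmeasure_box// cE.
(* [F] is the box over all [n] coordinates that constrains only those selected by [t]. *)
pose F j := if [pick i | t i == j] is Some i then E i else setT.
have Ft i : F (t i) = E i.
  rewrite /F; case: pickP => [i' /eqP/it ->//|/(_ i)]; by rewrite eqxx.
have mF j : measurable (F j) by rewrite /F; case: pickP.
have -> : (fun x : power X n => x \o t : power X m) @^-1` (box E) = box F.
  apply/seteqP; split => x /= Ex; last by move=> i /=; rewrite -Ft; exact: Ex.
  by move=> j; rewrite /F; case: pickP => // i /eqP <-; exact: Ex.
transitivity (\prod_(j < n) K (F j)); first exact: pmeasure_box.
rewrite (bigID (fun j => j \in codom t)) /= muleC; congr (_ * _).
  rewrite (eq_bigr (fun=> K setT)); last first.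
    move=> j jt; rewrite /F; case: pickP => // i /eqP ti.
    by rewrite -ti codom_f in jt.
  rewrite prode_const; congr (_ ^+ _).
  have := cardC (mem (codom t)); rewrite (card_codom it) !card_ord => nE.
  by rewrite -[n in RHS]nE addKn; apply: eq_card => j; rewrite !inE.
rewrite -big_uniq /=; last by rewrite map_inj_uniq// enum_uniq.
by rewrite big_map big_enum; apply: eq_bigr => i _; rewrite Ft.
Qed.

Lemma integral_ccat m n (u : power X (m + n) -> \bar R) :
  measurable_fun setT u -> (forall x, 0 <= u x) ->
  \int[K ^^ (m + n)]_x u x = \int[K ^^ m]_x \int[K ^^ n]_y u (ccat x y).
Proof.
move=> mu u0.
have mc := @measurable_ccat _ X m n.
have [nu [nuE nui]] := pushforwardP (K ^^ m \x K ^^ n) mc.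
transitivity (\int[nu]_x u x); last first.
  by rewrite nui// fubini_tonelli1//; exact: measurableT_comp mc.
apply: eq_measure_integral => A mA _.
apply: power_measure_unique => //.
  by rewrite -ge0_fin_numE// fin_num_measure.
move=> E mE; rewrite nuE.
have -> : (fun p : power X m * power X n => ccat p.1 p.2 : power X (m + n)) @^-1` box E
    = box (E \o @lshift m n) `*` box (E \o @rshift m n).
  apply/seteqP; split => -[x y] /=.
    move=> Exy; split => i /=.
      by have := Exy (lshift n i); rewrite ccat_lshift.
    by have := Exy (rshift m i); rewrite ccat_rshift.
  move=> [Ex Ey] i; rewrite /ccat; case: split_ordP => j ->; [exact: Ex|exact: Ey].
have mb1 : measurable (box (E \o @lshift m n)) by apply: measurable_box => i; exact: mE.
have mb2 : measurable (box (E \o @rshift m n)) by apply: measurable_box => i; exact: mE.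
transitivity ((K ^^ m) (box (E \o @lshift m n)) * (K ^^ n) (box (E \o @rshift m n))).
  transitivity (\prod_(i < m + n) K (E i)); last first.
    by rewrite big_split_ord; congr (_ * _); apply/esym/pmeasure_box => i; exact: mE.
  exact: pmeasure_box.
by rewrite -product_measure1E.
Qed.

End finite_product.

(** * Stein's method for the Poisson law *)

Section poisson_stein.
Variables (R : realType) (lam : R).
Hypothesis lam0 : (0 < lam)%R.
Let p (n : nat) : R := poisson_pmf lam n.
Let Q : probability nat R := poisson_prob lam 0%N.

Let p_gt0 n : (0 < p n)%R.
Proof.
by rewrite /p /poisson_pmf lam0 !mulr_gt0 ?expR_gt0 ?exprn_gt0.
Qed.

Let p_rec n : (n.+1%:R * p n.+1 = lam * p n)%R.
Proof.
rewrite /p /poisson_pmf lam0 factS natrM exprS.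
have nz : (n`!%:R != 0 :> R)%R by rewrite pnatr_eq0 -lt0n fact_gt0.
have nz1 : (1 + n%:R != 0 :> R)%R by rewrite addrC natr1 pnatr_eq0.
by field; rewrite nz nz1.
Qed.

Let integral_Q (phi : nat -> \bar R) : (forall n, 0 <= phi n) ->
  \int[Q]_n phi n = \sum_(n <oo) (p n)%:E * phi n.
Proof.
move=> phi0.
pose m n := mscale (NngNum (ltW (p_gt0 n))) (@dirac _ nat n R).
have QE A : measurable A -> Q A = mseries m 0%N A.
  move=> _; rewrite /mseries/= /poisson_prob lam0 esum_mkcond -nneseries_esumT; last first.
    by move=> n; case: ifP => // _; rewrite lee_fin ltW.
  apply: eq_eseriesr => n _; rewrite /mscale/= diracE.
  by case: (n \in A); rewrite ?mule1 ?mule0.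
rewrite (eq_measure_integral (mseries m 0%N)); last by move=> A mA _; exact: QE.
rewrite ge0_integral_measure_series//.
apply: eq_eseriesr => n _; rewrite ge0_integral_mscale//.
by rewrite integral_dirac// diracE in_setT mul1e.
Qed.

Let Q_mean : \int[Q]_n (n%:R)%:E = lam%:E.
Proof.
rewrite integral_Q; last by move=> n; rewrite lee_fin.
rewrite nneseries_recl//; last by move=> n _; rewrite -EFinM lee_fin mulr_ge0// ltW.
rewrite mule0 add0e -nneseries_addn; last first.
  by move=> n; rewrite -EFinM lee_fin mulr_ge0// ltW.
transitivity (lam%:E * \sum_(n <oo) (p n)%:E * 1).
  rewrite -nneseriesZl; last by move=> n _; rewrite mule1 lee_fin ltW.
  by apply: eq_eseriesr => n _; rewrite mule1 -!EFinM addn1 -p_rec mulrC.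
rewrite -integral_Q// integral_cst// mul1e.
by rewrite [X in _ * X](probability_setT Q) mule1.
Qed.

(** Finiteness of the Poisson mean makes all functions of at most linear growth integrable,
    1-Lipschitz ones included. *)
Let Q_int (phi : nat -> R) (c C : R) :
  (forall n, `|phi n| <= c + C * n%:R)%R -> (0 <= c)%R -> (0 <= C)%R ->
  Q.-integrable setT (EFin \o phi).
Proof.
move=> phic c0 C0.
apply: (@le_integrable _ _ _ _ _ _ _ (fun n => c%:E + C%:E * n%:R%:E)) => //.
  move=> n _ /=; rewrite lee_fin [leRHS]ger0_norm ?phic//.
  by rewrite addr_ge0// mulr_ge0.
apply/integrableP; split=> //.
under eq_integral.
  move=> n _; rewrite gee0_abs; last by rewrite lee_fin addr_ge0// mulr_ge0.
  over.
rewrite ge0_integralD//; last by move=> n _; rewrite lee_fin mulr_ge0.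
rewrite integral_cst// [X in _ * X + _](probability_setT Q) mule1.
rewrite ge0_integralZl//.
by rewrite Q_mean -EFinM -EFinD ltry.
Qed.

Let F (n : nat) : R := (\sum_(i < n) p i)%R.

Let Q_head (phi : nat -> R) n :
  (\int[Q]_i (if (i < n)%N then phi i else 0) = \sum_(i < n) p i * phi i)%R.
Proof.
elim: n => [|n IH]; first by rewrite big_ord0 /Rintegral integral0.
have bnd (psi : nat -> R) (n' : nat) : exists2 c : R, (0 <= c)%R &
    forall i, (`|if (i < n')%N then psi i else 0| <= c)%R.
  elim: n' => [|n' [c c0 IHc]]; first by exists 0%R => // i; rewrite normr0.
  exists (c + `|psi n'|)%R; first by rewrite addr_ge0.
  move=> i; rewrite ltnS leq_eqVlt; case: (i =P n') => [->|_] /=.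
    by rewrite lerDr.
  by rewrite (le_trans (IHc i))// lerDl.
have int_head (psi : nat -> R) n' :
    Q.-integrable setT (EFin \o (fun i => if (i < n')%N then psi i else 0%R)).
  have [c c0 cE] := bnd psi n'.
  by apply: (@Q_int _ c 0%R) => // i; rewrite mul0r addr0.
have int1 : Q.-integrable setT (EFin \o (fun i => phi n * \1_[set n] i)%R).
  apply: (@Q_int _ `|phi n|%R 0%R) => // i; rewrite mul0r addr0 normrM.
  by rewrite ler_piMr// indicE; case: (_ \in _); rewrite ?normr1 ?normr0.
have int2 : Q.-integrable setT (EFin \o (\1_[set n] : nat -> R)) by exact: integrable_indic.
rewrite (@eq_Rintegral _ _ _ _ _
  (fun i => (if (i < n)%N then phi i else 0) + phi n * \1_[set n] i)%R).
  rewrite RintegralD// IH big_ord_recr/= RintegralZl// mulrC; congr (_ + _ * _)%R.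
  rewrite /Rintegral integral_indic// setIT /Q /= /poisson_prob lam0 esum_set1//.
  by rewrite lee_fin ltW.
move=> i _; rewrite indicE ltnS leq_eqVlt; case: (i =P n) => [->|ni] /=.
  by rewrite ltnn mem_set// mulr1 add0r.
by rewrite memNset// mulr0 addr0.
Qed.

Variable h : R -> R.
Hypothesis hlip : lip1 h.
Let c : R := (\int[Q]_n h n%:R)%R.

Lemma poisson_lip_integrable :
  (poisson_prob lam 0%N).-integrable setT (EFin \o (fun n : nat => h n%:R)).
Proof.
apply: (@Q_int _ `|h 0|%R 1%R) => // n; rewrite mul1r.
have := hlip n%:R 0%R; rewrite subr0 [X in (_ <= X)%R]ger0_norm// => hn.
rewrite -[h n%:R](subrK (h 0%R)) (le_trans (ler_normD _ _))//.
by rewrite addrC lerD2l.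
Qed.

Let int_h := poisson_lip_integrable.

Let int_id : Q.-integrable setT (EFin \o (fun n : nat => n%:R)).
Proof. by apply: (@Q_int _ 0%R 1%R) => // n; rewrite mul1r add0r ger0_norm. Qed.

Let int_cst r : Q.-integrable setT (EFin \o (fun _ : nat => r)).
Proof. by apply: (@Q_int _ `|r|%R 0%R) => // n; rewrite mul0r addr0. Qed.

Let Q_cst r : (\int[Q]_n r = r)%R.
Proof.
rewrite Rintegral_cst// (_ : fine _ = 1%R) ?mulr1//.
by have := probability_setT Q => /= ->.
Qed.

Let mean_id : (\int[Q]_n n%:R = lam)%R.
Proof. by rewrite /Rintegral Q_mean. Qed.

Let F_ge0 n : (0 <= F n)%R.
Proof. by apply: sumr_ge0 => i _; rewrite ltW. Qed.

Let F_le1 n : (F n <= 1)%R.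
Proof.
rewrite -(Q_cst 1%R).
have -> : (F n = \int[Q]_i (if (i < n)%N then 1 else 0))%R.
  by rewrite (Q_head (fun=> 1%R)); apply: eq_bigr => i _; rewrite mulr1.
apply: le_Rintegral => //; last by move=> i _; case: ifP.
by apply: (@Q_int _ 1%R 0%R) => // i; rewrite mul0r addr0; case: ifP; rewrite ?normr1 ?normr0.
Qed.

Let sum_id n : (\sum_(i < n.+1) p i * i%:R = lam * F n)%R.
Proof.
rewrite big_ord_recl mulr0 add0r /F mulr_sumr; apply: eq_bigr => i _.
by rewrite -p_rec mulrC.
Qed.

(* The partial sums of [p * (h - c)] are the covariances of [h] with the
   indicator of [0..n]; among 1-Lipschitz functions [- id] is extremal, and for
   it the sum telescopes. *)
Let partial_sum_bound n : (`|\sum_(i < n.+1) p i * (h i%:R - c)| <= lam * p n)%R.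
Proof.
pose u i := (h i%:R - h n%:R)%R.
have u_le i : (`|u i| <= `|i%:R - n%:R|)%R by exact: hlip.
have int_lin : Q.-integrable setT (EFin \o (fun i : nat => i%:R - n%:R : R)%R).
  apply: (@Q_int _ n%:R 1%R) => // i; rewrite mul1r.
  by rewrite (le_trans (ler_normB _ _))// !ger0_norm// addrC.
have int_u : Q.-integrable setT (EFin \o u).
  apply: (le_integrable _ _ _ int_lin) => // i _ /=.
  by rewrite lee_fin.
pose b i : R := (if (i < n.+1)%N then 1 else 0)%R.
pose fn := F n.+1.
have fn0 : (0 <= fn)%R := F_ge0 n.+1.
have fn1 : (fn <= 1)%R := F_le1 n.+1.
have int_b (v : nat -> R) : Q.-integrable setT (EFin \o v) ->
    Q.-integrable setT (EFin \o (fun i => (b i - fn) * v i)%R).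
  move=> iv; apply: (le_integrable _ _ _ iv) => // i _ /=.
  rewrite lee_fin normrM ler_piMl// ler_norml /b.
  by case: ifP => _; apply/andP; split; lra.
have L (v : nat -> R) : Q.-integrable setT (EFin \o v) ->
    (\int[Q]_i ((b i - fn) * v i) = \sum_(i < n.+1) p i * v i - fn * \int[Q]_i v i)%R.
  move=> iv; rewrite -(Q_head v n.+1).
  rewrite -RintegralZl// -RintegralB//; first last.
  - have := integrableZl measurableT fn iv.
    by apply: eq_integrable.
  - apply: (le_integrable _ _ _ iv) => // i _ /=.
    by rewrite lee_fin; case: ifP => // _; rewrite normr0.
  apply: eq_Rintegral => i _; rewrite mulrBl; congr (_ - _)%R.
  by rewrite /b; case: ifP => _; rewrite ?mul1r ?mul0r.
have -> : (\sum_(i < n.+1) p i * (h i%:R - c) = \int[Q]_i ((b i - fn) * u i))%R.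
  rewrite L// /u RintegralB// Q_cst -/c.
  rewrite (eq_bigr (fun i : 'I_n.+1 => p i * h i%:R - p i * c)%R); last first.
    by move=> i _; rewrite mulrBr.
  rewrite [in RHS](eq_bigr (fun i : 'I_n.+1 => p i * h i%:R - p i * h n%:R)%R); last first.
    by move=> i _; rewrite mulrBr.
  rewrite !sumrB -!mulr_suml -/(F n.+1) -/fn; ring.
apply: (le_trans (le_normr_Rintegral measurableT (int_b _ int_u))).
(* The weight [b i - fn] is nonnegative up to [n] and nonpositive beyond, so its product with
   [i - n] is never positive. As [|u i| <= |i - n|], this integral dominates; it is the same
   covariance for [- id]. *)
have -> : (lam * p n = - \int[Q]_i ((b i - fn) * (i%:R - n%:R)))%R.
  rewrite L// RintegralB// Q_cst mean_id.
  rewrite (eq_bigr (fun i : 'I_n.+1 => p i * i%:R - p i * n%:R)%R); last first.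
    by move=> i _; rewrite mulrBr.
  rewrite sumrB sum_id -mulr_suml -/(F n.+1) -/fn.
  have -> : (F n = fn - p n)%R by rewrite /fn /F big_ord_recr /= addrK.
  ring.
rewrite -[leRHS]mulN1r -RintegralZl//; last exact: int_b.
apply: le_Rintegral => //.
- exact/integrable_norm/int_b.
- have := integrableZl measurableT (-1)%R (int_b _ int_lin).
  by apply: eq_integrable.
move=> i _; rewrite mulN1r normrM -mulNr.
have := u_le i; rewrite /b; case: ltnP => [ni|ni].
  rewrite (ler0_norm (_ : i%:R - n%:R <= 0)%R) ?subr_le0 ?ler_nat// => ui.
  rewrite (ger0_norm (_ : 0 <= 1 - fn)%R) ?subr_ge0// mulNr -mulrN.
  by rewrite ler_wpM2l ?subr_ge0.
rewrite (ger0_norm (_ : 0 <= i%:R - n%:R)%R) ?subr_ge0 ?ler_nat 1?ltnW// => ui.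
by rewrite sub0r normrN (ger0_norm fn0) mulNr mulNr opprK ler_wpM2l.
Qed.

(** The equation is a first-order recursion, solved by the partial sums of [p * (h - c)] divided by
    [lam * p n]; the bound 1 is then [partial_sum_bound]. The value at 0 is free because its
    coefficient vanishes. *)
Lemma poisson_stein_solution : exists g : nat -> R,
  [/\ g 0%N = 0%R, forall n, (`|g n| <= 1)%R &
   forall n, (lam * g n.+1 - n%:R * g n =
     h n%:R - \int[poisson_prob lam 0%N]_i h i%:R)%R].
Proof.
pose A n := (\sum_(i < n) p i * (h i%:R - c))%R.
pose g n := if n is m.+1 then (A m.+1 / (lam * p m))%R else 0%R.
have lp n : (lam * p n != 0)%R by rewrite gt_eqF// mulr_gt0.
exists g; split=> // [[|n]|n]; first by rewrite normr0.
  have lp0 : (0 < lam * p n)%R by rewrite mulr_gt0.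
  by rewrite /g normf_div (gtr0_norm lp0) ler_pdivrMr// mul1r partial_sum_bound.
rewrite -/Q -/c; have pn : (p n != 0)%R by rewrite gt_eqF.
have l0 : (lam != 0)%R by rewrite gt_eqF.
have A1 : (A n.+1 = A n + p n * (h n%:R - c))%R by rewrite /A big_ord_recr.
rewrite /g A1; case: n pn A1 => [|n] pn A1.
  by rewrite mul0r subr0 /A big_ord0 add0r; field; rewrite l0 pn.
have pn' : (p n != 0)%R by rewrite gt_eqF.
have -> : (lam * ((A n.+1 + p n.+1 * (h n.+1%:R - c)) / (lam * p n.+1)) =
   A n.+1 / p n.+1 + (h n.+1%:R - c))%R by field; rewrite l0 pn.
rewrite mulrCA.
have -> : (n.+1%:R / (lam * p n) = (p n.+1)^-1)%R.
  by rewrite -p_rec; field; rewrite pn /= addrC natr1 pnatr_eq0.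
ring.
Qed.

End poisson_stein.

(** * Stein's bound for a random variable with values in the natural numbers *)

Section stein_method.
Context d (Om : measurableType d) (R : realType) (P : probability Om R).
Variables (T : Om -> nat) (lam mu D : R) (h : R -> R).
Hypothesis mT : measurable_fun setT T.
Hypothesis lam_ge0 : (0 <= lam)%R.
Hypothesis D_ge0 : (0 <= D)%R.
Hypothesis T_mean : \int[P]_w ((T w)%:R)%:E = mu%:E.
Hypothesis hlip : lip1 h.

Let mTG (G : nat -> R) : measurable_fun setT (fun w => G (T w)).
Proof. exact: (@measurableT_comp _ _ _ _ _ _ G setT T _ mT). Qed.

Let int_T : P.-integrable setT (EFin \o (fun w => (T w)%:R)).
Proof.
apply/integrableP; split; first by apply/measurable_EFinP; exact: (mTG (fun i => i%:R)).
rewrite (eq_integral (fun w => ((T w)%:R)%:E)) ?T_mean ?ltry// => w _.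
by rewrite gee0_abs//= lee_fin.
Qed.

Let int_cst (r : R) : P.-integrable setT (EFin \o (fun _ : Om => r)).
Proof. exact: finite_measure_integrable_cst. Qed.

Let int_TG (G : nat -> R) (c C : R) :
  (forall i, `|G i| <= c + C * i%:R)%R -> (0 <= c)%R -> (0 <= C)%R ->
  P.-integrable setT (EFin \o (fun w => G (T w))).
Proof.
move=> Gc c0 C0.
have iL : P.-integrable setT (EFin \o (fun w => c + C * (T w)%:R)%R).
  have := integrableD measurableT (int_cst c) (integrableZl measurableT C int_T).
  by apply: eq_integrable.
apply: (le_integrable _ _ _ iL) => //; first by apply/measurable_EFinP; exact: mTG.
move=> w _ /=; rewrite lee_fin [leRHS]ger0_norm ?Gc//.
by rewrite addr_ge0// mulr_ge0.
Qed.

Let P_cst r : (\int[P]_w r = r)%R.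
Proof.
rewrite Rintegral_cst// (_ : fine _ = 1%R) ?mulr1//.
by have := probability_setT P => /= ->.
Qed.

Let mean : (\int[P]_w (T w)%:R = mu)%R.
Proof. by rewrite /Rintegral T_mean. Qed.

Let hT_growth i : (`|h i%:R| <= `|h 0| + 1 * i%:R)%R.
Proof.
rewrite mul1r; have := hlip i%:R 0%R; rewrite subr0 [X in (_ <= X)%R]ger0_norm// => hn.
rewrite -[h i%:R](subrK (h 0%R)) (le_trans (ler_normD _ _))//.
by rewrite addrC lerD2l.
Qed.

Let int_hT : P.-integrable setT (EFin \o (fun w => h (T w)%:R)).
Proof. by apply: (@int_TG (fun i => h i%:R) `|h 0|%R 1%R) => //; exact: hT_growth. Qed.

(** With [e] the mean of [G(T + 1)] and [t] that of [T G(T)], the Stein equation integrates to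
    [lam * (e - 1) - (t - mu)]. Replacing [lam] by [mu] costs [|mu - lam|] since [|e - 1| <= 1], and
    the hypothesis bounds [mu * e - t]. It is given as two inequalities to avoid subtraction of
    extended reals. *)
Lemma stein_method :
  (forall G : nat -> R, (forall i, 0 <= G i <= 2)%R ->
     \int[P]_w ((T w)%:R * G (T w))%:E <=
       mu%:E * \int[P]_w (G (T w).+1)%:E + D%:E /\
     mu%:E * \int[P]_w (G (T w).+1)%:E <=
       \int[P]_w ((T w)%:R * G (T w))%:E + D%:E) ->
  `| \int[P]_w (h (T w)%:R)%:E - \int[poisson_prob lam 0%N]_n (h n%:R)%:E |
  <= (`|mu - lam| + D)%:E.
Proof.
move=> H.
(* For [lam = 0] the Poisson law is the Dirac mass at 0 and no Stein equation is solved: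
   [|h(T) - h(0)| <= T] integrates to [mu]. *)
have [lam0|] := ltrP 0%R lam; last first.
  move=> lam_le0; have lam0 : lam = 0%R by apply/eqP; rewrite eq_le lam_le0.
  have -> : \int[poisson_prob lam 0%N]_n (h n%:R)%:E = (h 0%R)%:E.
    rewrite (eq_measure_integral (@dirac _ nat 0%N R)); last first.
      by move=> A _ _; rewrite /= /poisson_prob lam0 ltxx.
    by rewrite integral_dirac// diracE in_setT mul1e.
  rewrite -[X in `|X - _|](fineK (integrable_fin_num measurableT int_hT)).
  rewrite -EFinB lee_fin -/(Rintegral P setT (fun w => h (T w)%:R)).
  rewrite -(P_cst (h 0%R)) -RintegralB//.
  rewrite lam0 subr0; apply: (@le_trans _ _ mu); last by rewrite ler_wpDr// ler_norm.
  have ihh : P.-integrable setT (EFin \o (fun w => h (T w)%:R - h 0)%R).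
    have := integrableB measurableT int_hT (int_cst (h 0%R)).
    by apply: eq_integrable.
  apply: (le_trans (le_normr_Rintegral measurableT ihh)); rewrite -mean.
  apply: le_Rintegral => //; first exact: integrable_norm.
  by move=> w _; have := hlip (T w)%:R 0%R; rewrite subr0 (ger0_norm (ler0n _ _)).
have [g [g0 g1 gE]] := poisson_stein_solution lam0 hlip.
have iQ := poisson_lip_integrable lam0 hlip.
pose c := (\int[poisson_prob lam 0%N]_i h i%:R)%R.
have -> : \int[poisson_prob lam 0%N]_n (h n%:R)%:E = c%:E.
  by rewrite /c /Rintegral fineK//; exact: integrable_fin_num.
rewrite -[X in `|X - _|](fineK (integrable_fin_num measurableT int_hT)).
rewrite -EFinB lee_fin -/(Rintegral P setT (fun w => h (T w)%:R)).
pose G i : R := (1 + g i)%R.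
have G02 i : (0 <= G i <= 2)%R.
  by have := g1 i; rewrite ler_norml /G => /andP[? ?]; apply/andP; split; lra.
have iG : P.-integrable setT (EFin \o (fun w => G (T w).+1)).
  apply: (@int_TG (fun i => G i.+1) 2%R 0%R) => // i; rewrite mul0r addr0.
  by have /andP[? ?] := G02 i.+1; rewrite ger0_norm.
have iTG : P.-integrable setT (EFin \o (fun w => (T w)%:R * G (T w))%R).
  apply: (@int_TG (fun i => i%:R * G i)%R 0%R 2%R) => // i; rewrite add0r.
  have /andP[? ?] := G02 i.
  by rewrite ger0_norm ?mulr_ge0// mulrC ler_wpM2r.
have [] := H G G02.
rewrite -(fineK (integrable_fin_num measurableT iG)).
rewrite -(fineK (integrable_fin_num measurableT iTG)).
rewrite -!EFinM -!EFinD !lee_fin.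
rewrite -/(Rintegral P setT (fun w => G (T w).+1)).
rewrite -/(Rintegral P setT (fun w => (T w)%:R * G (T w))%R).
set e := Rintegral P setT (fun w => G (T w).+1).
set t := Rintegral P setT (fun w => (T w)%:R * G (T w))%R => H1 H2.
have -> : (\int[P]_w h (T w)%:R - c = lam * (e - 1) - (t - mu))%R.
  have i1 : P.-integrable setT (EFin \o (fun w => G (T w).+1 - 1)%R).
    by have := integrableB measurableT iG (int_cst 1%R); apply: eq_integrable.
  have i2 : P.-integrable setT (EFin \o (fun w => lam * (G (T w).+1 - 1))%R).
    by have := integrableZl measurableT lam i1; apply: eq_integrable.
  have i3 : P.-integrable setT (EFin \o (fun w => (T w)%:R * G (T w) - (T w)%:R)%R).
    by have := integrableB measurableT iTG int_T; apply: eq_integrable.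
  transitivity (\int[P]_w (h (T w)%:R - c))%R; first by rewrite RintegralB// P_cst.
  transitivity (\int[P]_w (lam * (G (T w).+1 - 1) - ((T w)%:R * G (T w) - (T w)%:R)))%R.
    by apply: eq_Rintegral => w _; rewrite -(gE (T w)) /G; ring.
  by rewrite RintegralB// RintegralZl// !RintegralB// P_cst mean.
have e1 : (`|e - 1| <= 1)%R.
  have e0 : (0 <= e)%R.
    by apply: Rintegral_ge0 => w _; have /andP[] := G02 (T w).+1.
  have e2 : (e <= 2)%R.
    rewrite -(P_cst 2%R); apply: le_Rintegral => // w _.
    by have /andP[] := G02 (T w).+1.
  by rewrite ler_norml; apply/andP; split; lra.
have -> : (lam * (e - 1) - (t - mu) = (lam - mu) * (e - 1) + (mu * e - t))%R by ring.
apply: (le_trans (ler_normD _ _)); apply: lerD.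
  by rewrite normrM distrC ler_piMr.
by rewrite ler_norml; apply/andP; split; lra.
Qed.

End stein_method.

Lemma poisson_lip_fin_num (R : realType) (lam : R) (h : R -> R) :
  (0 <= lam)%R -> lip1 h ->
  \int[poisson_prob lam 0%N]_n (h n%:R)%:E \is a fin_num.
Proof.
rewrite le_eqVlt => /predU1P[<- _|lam0 hlip]; last first.
  exact: integrable_fin_num (poisson_lip_integrable lam0 hlip).
rewrite (eq_measure_integral (@dirac _ nat 0%N R)); last first.
  by move=> A _ _; rewrite /= /poisson_prob ltxx.
by rewrite integral_dirac// diracE in_setT mul1e.
Qed.

(** * A fixed number of points *)

Lemma natmul_mule (R : realType) (x : \bar R) n : (x *+ n)%R = n%:R%:E * x.
Proof. by rewrite mule_natl; case: n. Qed.

Section cat_functions.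
Variables (k l : nat) (hl : (l <= k)%N).

(** The formula of [catf] over an arbitrary type, because index maps have to be concatenated as well
    as points. *)
Definition catg (T : Type) (x : 'I_l -> T) (y : 'I_(k - l) -> T) : 'I_k -> T :=
  fun i => match @fintype.split l (k - l) (cast_ord (esym (subnKC hl)) i) with
           | inl j => x j | inr j => y j end.

Lemma comp_catg (T U : Type) (F : T -> U) (x : 'I_l -> T) (y : 'I_(k - l) -> T) :
  F \o catg x y = catg (F \o x) (F \o y).
Proof. by apply/funext => i; rewrite /= /catg; case: fintype.split. Qed.

Lemma codom_catg (T : finType) (x : 'I_l -> T) (y : 'I_(k - l) -> T) v :
  (v \in [set catg x y i | i in [set: 'I_k]]%SET) = (v \in codom x) || (v \in codom y).
Proof.
apply/imsetP/orP.
  move=> [i _ ->]; rewrite /catg; case: fintype.split => j; [left|right]; exact: codom_f.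
have H (u : 'I_l + 'I_(k - l)) :
    catg x y (cast_ord (subnKC hl) (unsplit u)) =
    match u with inl j => x j | inr j => y j end.
  by rewrite /catg cast_ordK unsplitK.
case=> /codomP[j ->].
  by exists (cast_ord (subnKC hl) (unsplit (inl j))) => //; rewrite H.
by exists (cast_ord (subnKC hl) (unsplit (inr j))) => //; rewrite H.
Qed.

End cat_functions.

Section fixed_size.
Context d (X : measurableType d) (R : realType).
Variables (K : {finite_measure set X -> \bar R}) (k : nat).
Variable a : ('I_k -> X) -> bool.
Hypothesis asym : forall (s : {perm 'I_k}) x, a (x \o s) = a x.
Hypothesis ma : measurable_fun setT (a : power X k -> bool).
Local Notation "K ^^ n" := (pmeasure K n) (at level 30).

Local Notation ind b := (((b : bool)%:R : R)%:E).

Lemma ind_ge0 (b : bool) : 0 <= ind b.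
Proof. by rewrite lee_fin. Qed.

Lemma measurable_ind d' (T : measurableType d') (b : T -> bool) :
  measurable_fun setT b -> measurable_fun setT (fun x => ind (b x)).
Proof.
move=> mb; exact: (@measurableT_comp _ _ _ _ _ _ (fun c : bool => ind c) setT b _ mb).
Qed.

Lemma measurable_a n (t : 'I_k -> 'I_n) :
  measurable_fun setT (fun x : power X n => a (x \o t)).
Proof. exact: (measurableT_comp ma (@measurable_reindex _ X _ _ t)). Qed.

Lemma measurable_nat_fun d' (T : measurableType d') d2 (U : measurableType d2)
   (c : T -> nat) (G : nat -> U) :
  measurable_fun setT c -> measurable_fun setT (fun x => G (c x)).
Proof. by move=> mc; exact: (@measurableT_comp _ _ _ _ _ _ G setT c _ mc). Qed.

Lemma measurable_sumn d' (T : measurableType d') (I : Type) (r : seq I) (P : pred I)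
    (h : I -> T -> nat) : (forall i, measurable_fun setT (h i)) ->
  measurable_fun setT (fun x => (\sum_(i <- r | P i) h i x)%N).
Proof.
move=> mh; elim: r => [|i r IH].
  by under eq_fun do rewrite big_nil; exact: measurable_cst.
under eq_fun do rewrite big_cons; case: (P i) => //.
exact: measurable_fun_addn.
Qed.

Lemma measurable_inj_cnt n : measurable_fun setT (fun x : power X n => inj_cnt a x).
Proof.
apply: measurable_sumn => j.
exact: (@measurableT_comp _ _ _ _ _ _ nat_of_bool setT _ _ (measurable_a j)).
Qed.

Lemma measurable_set_cnt n : measurable_fun setT (fun x : power X n => set_cnt a x).
Proof. exact: (measurable_nat_fun (fun c => c %/ k`!)%N (@measurable_inj_cnt n)). Qed.

Lemma measurable_Gcnt n (G : nat -> \bar R) :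
  measurable_fun setT (fun x : power X n => G (set_cnt a x)).
Proof. exact: (measurable_nat_fun G (@measurable_set_cnt n)). Qed.

(** Exchangeability: a permutation of the [n] points carries any tuple [j] to [t] and preserves both
    the measure and the count, so the [n ^_ k] summands are equal. *)
Lemma exchange_inj_cnt n (t : 'I_k -> 'I_n) (G : nat -> \bar R) : injective t ->
  (forall i, 0 <= G i) ->
  \int[K ^^ n]_x ((inj_cnt a x)%:R%:E * G (set_cnt a x)) =
  (n ^_ k)%:R%:E * \int[K ^^ n]_x (ind (a (x \o t)) * G (set_cnt a x)).
Proof.
move=> it G0.
have mG := @measurable_Gcnt n G.
have mh (j : {ffun 'I_k -> 'I_n}) : measurable_fun setT
    (fun x : power X n => ind (a (x \o j)) * G (set_cnt a x)).
  by apply: emeasurable_funM => //; apply: measurable_ind; exact: measurable_a.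
pose r := [seq j : {ffun 'I_k -> 'I_n} <- index_enum _ | injectiveb j].
transitivity (\int[K ^^ n]_x \sum_(j <- r) (ind (a (x \o j)) * G (set_cnt a x))).
  apply: eq_integral => x _; rewrite /inj_cnt big_filter natr_sum -sumEFin.
  by rewrite ge0_sume_distrl.
rewrite ge0_integral_sum//; last first.
  by move=> j x _; rewrite mule_ge0// ind_ge0.
rewrite big_filter (eq_bigr (fun=> \int[K ^^ n]_x (ind (a (x \o t)) * G (set_cnt a x)))).
  rewrite sumr_const natmul_mule; congr (_%:R%:E * _).
  rewrite -[n in RHS]card_ord -[k in RHS]card_ord -card_inj_ffuns.
  by apply: eq_card => j; rewrite !inE.
move=> j /injectiveP ij; have [s sE] := inj_extend_perm ij it.
have := @integral_reindex _ X R K n n s (fun x => ind (a (x \o j)) * G (set_cnt a x))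
  perm_inj (mh j) _.
rewrite subnn expe0 mul1e => <-; last by move=> x; rewrite mule_ge0// ind_ge0.
apply: eq_integral => x _; rewrite set_cnt_perm//; congr (ind (a _) * _).
by apply/funext => i /=; rewrite sE.
Qed.

Lemma integral_head_tail m (G : nat -> \bar R) : (forall i, 0 <= G i) ->
  \int[K ^^ (k + m)]_x (ind (a (x \o @lshift k m)) * G (set_cnt a (x \o @rshift k m))) =
  (\int[K ^^ k]_x ind (a x)) * \int[K ^^ m]_x G (set_cnt a x).
Proof.
move=> G0; rewrite integral_ccat; last 2 first.
- apply: emeasurable_funM; first by apply: measurable_ind; exact: measurable_a.
  exact: (measurableT_comp (@measurable_Gcnt m G) (@measurable_reindex _ X _ _ (@rshift k m))).
- by move=> x; rewrite mule_ge0// ind_ge0.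
have mi : measurable_fun setT (fun x : power X k => ind (a x)) by exact: measurable_ind.
rewrite -ge0_integralZr//; last exact: integral_ge0.
apply: eq_integral => x _.
rewrite -ge0_integralZl//; last exact: measurable_Gcnt.
by apply: eq_integral => y _; rewrite ccatKl ccatKr.
Qed.

(** The [l]-th integral of [r_t], for a finite measure. Since [catf] takes a proof of [l <= k], a
    decision with default 0 turns it into a function of [l] alone, fit for sums over the overlap. *)
Definition overlap_int l : \bar R :=
  if @idP (l <= k)%N is ReflectT hl then
    iint K (fun x : 'I_l -> X =>
      let inner := iint K (fun y : 'I_(k - l) -> X => ind (a (catf hl x y))) in
      inner * inner)
  else 0.

Lemma overlap_intE l (hl : (l <= k)%N) : overlap_int l =
  iint K (fun x : 'I_l -> X =>
    let inner := iint K (fun y : 'I_(k - l) -> X => ind (a (catf hl x y))) in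
    inner * inner).
Proof.
rewrite /overlap_int; case: {-}_ / idP => [hl'|//]; by rewrite (bool_irrelevance hl' hl).
Qed.

Lemma measurable_inner l (hl : (l <= k)%N) : measurable_fun setT
  (fun x : power X l => \int[K ^^ (k - l)]_y ind (a (catf hl x y))).
Proof.
apply: (@measurable_fun_fubini_tonelli_F _ _ _ _ _ (K ^^ (k - l))
  (fun p : power X l * power X (k - l) => ind (a (catf hl p.1 p.2)))) => //.
by apply: measurable_ind; exact: (measurableT_comp ma (measurable_catf hl)).
Qed.

Lemma measurable_catf1 l (hl : (l <= k)%N) (x : 'I_l -> X) : measurable_fun setT
  (fun y : power X (k - l) => ind (a (catf hl x y))).
Proof.
apply: measurable_ind; apply: (measurableT_comp ma).
exact: (measurableT_comp (measurable_catf hl) (pair1_measurable (x : power X l))).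
Qed.

Lemma inner_ge0 l (hl : (l <= k)%N) (x : 'I_l -> X) :
  0 <= \int[K ^^ (k - l)]_y ind (a (catf hl x y)).
Proof. by apply: integral_ge0 => y _; exact: ind_ge0. Qed.

Lemma overlap_int_integral l (hl : (l <= k)%N) : overlap_int l =
  \int[K ^^ l]_x (\int[K ^^ (k - l)]_y ind (a (catf hl x y)) *
                  \int[K ^^ (k - l)]_y ind (a (catf hl x y))).
Proof.
rewrite overlap_intE.
have E (x : 'I_l -> X) : iint K (fun y : 'I_(k - l) -> X => ind (a (catf hl x y))) =
    \int[K ^^ (k - l)]_y ind (a (catf hl x y)).
  by apply: iintE; [exact: measurable_catf1|move=> y; exact: ind_ge0].
under [X in iint _ X]eq_fun do rewrite /= E.
apply: iintE; first by apply: emeasurable_funM; exact: measurable_inner.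
by move=> x; apply: mule_ge0; exact: inner_ge0.
Qed.

Lemma overlap_int_ge0 l : (l <= k)%N -> 0 <= overlap_int l.
Proof.
move=> hl; rewrite (overlap_int_integral hl); apply: integral_ge0 => x _.
by rewrite mule_ge0//; exact: inner_ge0.
Qed.

Lemma overlap_int_fin_num l : (l <= k)%N -> overlap_int l \is a fin_num.
Proof.
move=> hl; rewrite ge0_fin_numE ?overlap_int_ge0// (overlap_int_integral hl).
pose C := (K ^^ (k - l)) setT.
have CC : C * C = (fine C * fine C)%:E by rewrite EFinM fineK// fin_num_measure.
have leC (x : 'I_l -> X) : \int[K ^^ (k - l)]_y ind (a (catf hl x y)) <= C.
  rewrite -[C]mul1e -integral_cst//; apply: ge0_le_integral => //.
  - exact: measurable_catf1.
  - by move=> y _; rewrite lee_fin lern1 leq_b1.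
apply: (@le_lt_trans _ _ (\int[K ^^ l]_x (C * C))).
  apply: ge0_le_integral => //.
  - by move=> x _; rewrite mule_ge0//; exact: inner_ge0.
  - by apply: emeasurable_funM; exact: measurable_inner.
  - by move=> x _; rewrite lee_pmul ?inner_ge0.
rewrite CC integral_cst//; apply: lte_mul_pinfty => //.
  by have C0 : 0 <= C := measure_ge0 _ _; rewrite -CC mule_ge0.
by rewrite ltey_eq fin_num_measure.
Qed.

Lemma inj_enum_set (T : finType) (S : {set T}) s : #|S| = s ->
  exists e : 'I_s -> T, injective e /\ forall v, (v \in S) = (v \in codom e).
Proof.
move=> <-; exists enum_val; split; first exact: enum_val_inj.
move=> v; apply/idP/codomP => [vS|[i ->]]; last exact: enum_valP.
by exists (enum_rank_in vS v); rewrite enum_rankK_in.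
Qed.

(** The points of the two hits form three blocks: [l] common ones, and [k - l] belonging to each hit
    only. Given the common block the two hits are independent with equal conditional integrals,
    whence the square; points in neither hit contribute their mass. *)
Lemma integral_overlap m (j : {ffun 'I_k -> 'I_(k + m)}) : injective j ->
  \int[K ^^ (k + m)]_x (ind (a (x \o @lshift k m)) * ind (a (x \o j))) =
  K setT ^+ (m - (k - overlap j)) * overlap_int (overlap j).
Proof.
move=> ij; set l := overlap j.
have hl : (l <= k)%N := overlap_le j.
rewrite (overlap_int_integral hl).
pose J := [set j i | i in [set: 'I_k]]%SET.
pose H := [set @lshift k m i | i in [set: 'I_k]]%SET.
have cJ : #|J| = k by rewrite card_imset// cardsT card_ord.
have cH : #|H| = k by rewrite card_imset ?cardsT ?card_ord//; exact: lshift_inj.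
have HE v : (v \in H) = (v < k)%N.
  apply/imsetP/idP => [[i _ ->]|vk]; first exact: (ltn_ord i).
  by exists (Ordinal vk) => //; exact: val_inj.
have cHJ : #|(H :&: J)%SET| = l.
  rewrite /l /overlap -(card_imset _ ij); apply: eq_card => v.
  rewrite inE HE; apply/andP/imsetP.
    by move=> [vk /imsetP[i _ vi]]; exists i; rewrite // inE -vi.
  by move=> [i]; rewrite inE => jk ->; rewrite jk imset_f.
have cHdJ : #|(H :\: J)%SET| = (k - l)%N by rewrite cardsD cH cHJ.
have cJdH : #|(J :\: H)%SET| = (k - l)%N by rewrite cardsD cJ finset.setIC cHJ.
have [e0 [ie0 e0E]] := inj_enum_set cHJ.
have [e1 [ie1 e1E]] := inj_enum_set cHdJ.
have [e2 [ie2 e2E]] := inj_enum_set cJdH.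
have e0P i : e0 i \in (H :&: J)%SET by rewrite e0E codom_f.
have e1P i : e1 i \in (H :\: J)%SET by rewrite e1E codom_f.
have e2P i : e2 i \in (J :\: H)%SET by rewrite e2E codom_f.
(* [t] lists the three blocks one after the other; it is injective because they are disjoint. *)
pose t : 'I_(l + ((k - l) + (k - l))) -> 'I_(k + m) := ccat e0 (ccat e1 e2).
have it : injective t.
  move=> u v; rewrite /t /ccat.
  case: (split_ordP u) => u' ->; case: (split_ordP v) => v' ->.
  - by move=> /ie0 ->.
  - case: (split_ordP v') => v'' -> e.
      by have := e0P u'; rewrite e; have := e1P v''; rewrite !inE => /andP[/negbTE ->]; rewrite andbF.
    by have := e0P u'; rewrite e; have := e2P v''; rewrite !inE => /andP[/negbTE ->].
  - case: (split_ordP u') => u'' -> e.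
      by have := e0P v'; rewrite -e; have := e1P u''; rewrite !inE => /andP[/negbTE ->]; rewrite andbF.
    by have := e0P v'; rewrite -e; have := e2P u''; rewrite !inE => /andP[/negbTE ->].
  - case: (split_ordP u') => u'' ->; case: (split_ordP v') => v'' ->.
    + by move=> /ie1 ->.
    + move=> e; have := e1P u''; rewrite e; have := e2P v''.
      by rewrite !inE => /andP[/negbTE ->]; rewrite andbF.
    + move=> e; have := e1P v''; rewrite -e; have := e2P u''.
      by rewrite !inE => /andP[/negbTE ->]; rewrite andbF.
    + by move=> /ie2 ->.
(* [c1] and [c2] read the two hits off the blocks, common points first. By symmetry of [a] only
   their images [H] and [J] matter. *)
pose c1 : 'I_k -> 'I_(l + ((k - l) + (k - l))) :=
  catg hl (@lshift l _) (@rshift l _ \o @lshift (k - l) (k - l)).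
pose c2 : 'I_k -> 'I_(l + ((k - l) + (k - l))) :=
  catg hl (@lshift l _) (@rshift l _ \o @rshift (k - l) (k - l)).
have tc1 : t \o c1 = catg hl e0 e1.
  by rewrite comp_catg compA ccatKl ccatKr ccatKl.
have tc2 : t \o c2 = catg hl e0 e2.
  by rewrite comp_catg compA ccatKl ccatKr ccatKr.
have inj_of_card (c : 'I_k -> 'I_(k + m)) :
    #|[set c i | i in [set: 'I_k]]%SET| = k -> injective c.
  move=> ck u v; apply: (@imset_injP _ _ c [set: 'I_k]%SET _) => //.
  by rewrite ck cardsT card_ord.
have im1 : [set (t \o c1) i | i in [set: 'I_k]]%SET = H.
  apply/setP => v; rewrite tc1 codom_catg -e0E -e1E !inE.
  by case: (v \in H); rewrite ?andbF//= andbT orbN.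
have im2 : [set (t \o c2) i | i in [set: 'I_k]]%SET = J.
  apply/setP => v; rewrite tc2 codom_catg -e0E -e2E !inE.
  by case: (v \in J); rewrite ?andbF//= !andbT orbN.
have i1 : injective (t \o c1) by apply: inj_of_card; rewrite im1.
have i2 : injective (t \o c2) by apply: inj_of_card; rewrite im2.
pose u (z : power X (l + ((k - l) + (k - l)))) := ind (a (z \o c1)) * ind (a (z \o c2)).
have mu : measurable_fun setT u.
  by apply: emeasurable_funM; apply: measurable_ind; exact: measurable_a.
have u0 z : 0 <= u z by apply: mule_ge0; exact: ind_ge0.
transitivity (\int[K ^^ (k + m)]_x u (x \o t)).
  apply: eq_integral => x _; rewrite /u -(compA x t c1) -(compA x t c2).
  rewrite (sym_same_image asym x i1 (@lshift_inj k m)) ?im1//.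
  by rewrite (sym_same_image asym x i2 ij) ?im2.
rewrite integral_reindex//; congr (_ ^+ _ * _).
  have := leq_card _ it; rewrite !card_ord; lia.
rewrite integral_ccat//; apply: eq_integral => x _.
rewrite (@integral_ccat _ X R K _ _ (fun w => u (ccat x w))); last 2 first.
- exact: (measurableT_comp (measurableT_comp mu (@measurable_ccat _ X _ _))
    (pair1_measurable (x : power X l))).
- by move=> w; exact: u0.
have mi := @measurable_catf1 l hl x.
rewrite -ge0_integralZr//; last exact: inner_ge0.
apply: eq_integral => y _.
rewrite -ge0_integralZl//; apply: eq_integral => y' _.
rewrite /u /c1 /c2 !comp_catg ccatKl (compA _ (@rshift l _)) ccatKr ccatKl.
rewrite (compA _ (@rshift l _)) ccatKr ccatKr.
by [].
Qed.

Hypothesis k0 : (0 < k)%N.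

(** The subtraction is truncated and has its intended value only where the first [k] points form a
    hit; [excess_int] carries that indicator. *)
Definition excess m (x : 'I_(k + m) -> X) : nat :=
  (set_cnt a x - (set_cnt a (x \o @rshift k m)).+1)%N.

Definition excess_int m : \bar R :=
  \int[K ^^ (k + m)]_x (ind (a (x \o @lshift k m)) * (excess x)%:R%:E).

Lemma measurable_excess m : measurable_fun setT (fun x : power X (k + m) =>
  ind (a (x \o @lshift k m)) * (excess x)%:R%:E).
Proof.
apply: emeasurable_funM; first by apply: measurable_ind; exact: measurable_a.
apply: (measurable_nat_fun (fun i => i%:R%:E)); apply: measurable_fun_subn.
  exact: measurable_set_cnt.
apply: (measurable_nat_fun S).
exact: (measurableT_comp (@measurable_set_cnt m) (@measurable_reindex _ X _ _ (@rshift k m))).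
Qed.

Lemma excess_sum m (x : 'I_(k + m) -> X) : a (x \o @lshift k m) ->
  set_cnt a x = (excess x + (set_cnt a (x \o @rshift k m)).+1)%N /\
  (excess x * k`! = \sum_(j : {ffun 'I_k -> 'I_(k + m)} | injectiveb j &&
     (0 < overlap j < k)) a (x \o j))%N.
Proof.
move=> ax; have := inj_cnt_split asym k0 ax.
rewrite !set_cntE// -mulSn => e.
have le : ((set_cnt a (x \o @rshift k m)).+1 <= set_cnt a x)%N.
  by rewrite -(leq_pmul2r (fact_gt0 k)) e leq_addr.
split; first by rewrite subnK.
by rewrite /excess mulnBl e addKn.
Qed.

(** By [integral_overlap] a tuple contributes through its overlap alone, so [sum_overlap] applies.
    The factor [k!] passes from hits as sets to ordered tuples. *)
Lemma excess_int_overlap m : (k`!)%:R%:E * excess_int m =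
  \sum_(l < k.+1 | (0 < l < k)%N) ('C(k, l) * k ^_ l * m ^_ (k - l))%:R%:E *
    (K setT ^+ (m - (k - l)) * overlap_int l).
Proof.
pose F l := K setT ^+ (m - (k - l)) * overlap_int l.
transitivity (\sum_(l < k.+1 | (0 < l < k)%N)
    (F l *+ ('C(k, l) * k ^_ l * m ^_ (k - l)))%R); last first.
  by apply: eq_bigr => l _; rewrite natmul_mule.
rewrite -(@sum_overlap k _ m F (fun l => 0 < l < k)%N).
pose r := [seq j : {ffun 'I_k -> 'I_(k + m)} <- index_enum _ |
  injectiveb j && (0 < overlap j < k)%N].
have mb (j : {ffun 'I_k -> 'I_(k + m)}) : measurable_fun setT
    (fun x : power X (k + m) => ind (a (x \o @lshift k m)) * ind (a (x \o j))).
  by apply: emeasurable_funM; apply: measurable_ind; exact: measurable_a.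
rewrite /excess_int -ge0_integralZl//; last exact: measurable_excess.
transitivity (\int[K ^^ (k + m)]_x
    \sum_(j <- r) (ind (a (x \o @lshift k m)) * ind (a (x \o j)))).
  apply: eq_integral => x _; case: (boolP (a (x \o @lshift k m))) => ax.
    have [_ e] := excess_sum ax.
    rewrite mul1e -EFinM -natrM mulnC e big_filter natr_sum -sumEFin.
    by apply: eq_bigr => j _; rewrite mul1e.
  by rewrite mul0e mule0 big1// => j _; rewrite mul0e.
rewrite ge0_integral_sum//.
rewrite big_filter; apply: eq_bigr => j /andP[/injectiveP ij _].
exact: integral_overlap.
Qed.

Lemma integral_set_cnt m (G : nat -> R) : (forall i, 0 <= G i)%R ->
  \int[K ^^ (k + m)]_x ((set_cnt a x)%:R * G (set_cnt a x))%:E =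
  ('C(k + m, k))%:R%:E *
    \int[K ^^ (k + m)]_x (ind (a (x \o @lshift k m)) * (G (set_cnt a x))%:E).
Proof.
move=> G0; have f0 : (k`!%:R != 0 :> R)%R by rewrite pnatr_eq0 -lt0n fact_gt0.
have fV0 : (0 <= (k`!%:R)^-1 :> R)%R by rewrite invr_ge0.
(* Dividing [G] by [k!] beforehand turns the ordered count into [set_cnt], and the falling factorial
   into a binomial coefficient. *)
have := @exchange_inj_cnt (k + m) (@lshift k m)
  (fun i => ((k`!%:R)^-1 * G i)%:E) (@lshift_inj k m) _.
rewrite (eq_integral (fun x : power X (k + m) =>
    ((set_cnt a x)%:R * G (set_cnt a x))%:E)); last first.
  move=> x _; rewrite set_cntE// natrM -EFinM; congr EFin.
  by rewrite mulrA mulfK.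
move=> -> //; last by move=> i; rewrite lee_fin mulr_ge0.
under eq_integral do rewrite EFinM muleCA.
rewrite ge0_integralZl//; last 2 first.
- apply: emeasurable_funM; first by apply: measurable_ind; exact: measurable_a.
  exact: (measurable_Gcnt (fun i => (G i)%:E)).
- by move=> x _; rewrite mule_ge0 ?lee_fin.
rewrite muleA -EFinM; congr (_%:E * _).
by rewrite -bin_ffact natrM mulfK.
Qed.

Let alpha := \int[K ^^ k]_x ind (a x).

Lemma integral_head m (G : nat -> R) : (forall i, 0 <= G i <= 2)%R ->
  \int[K ^^ (k + m)]_x (ind (a (x \o @lshift k m)) * (G (set_cnt a x))%:E) <=
    alpha * \int[K ^^ m]_x (G (set_cnt a x).+1)%:E + 2%:E * excess_int m /\
  alpha * \int[K ^^ m]_x (G (set_cnt a x).+1)%:E <=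
    \int[K ^^ (k + m)]_x (ind (a (x \o @lshift k m)) * (G (set_cnt a x))%:E)
    + 2%:E * excess_int m.
Proof.
move=> G02.
have G0 i : (0 <= G i)%R by case/andP: (G02 i).
have G2 i : (G i <= 2)%R by case/andP: (G02 i).
rewrite -(@integral_head_tail m (fun i => (G i.+1)%:E)); last first.
  by move=> i; rewrite lee_fin.
have ma0 : measurable_fun setT (fun x : power X (k + m) => ind (a (x \o @lshift k m))).
  by apply: measurable_ind; exact: measurable_a.
have mG : measurable_fun setT (fun x : power X (k + m) =>
    ind (a (x \o @lshift k m)) * (G (set_cnt a x))%:E).
  by apply: emeasurable_funM => //; exact: (measurable_Gcnt (fun i => (G i)%:E)).
have mG' : measurable_fun setT (fun x : power X (k + m) =>
    ind (a (x \o @lshift k m)) * (G (set_cnt a (x \o @rshift k m)).+1)%:E).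
  apply: emeasurable_funM => //.
  exact: (measurableT_comp (measurable_Gcnt (fun i => (G i.+1)%:E))
    (@measurable_reindex _ X _ _ (@rshift k m))).
have mE := @measurable_excess m.
have E0 (x : power X (k + m)) : 0 <= ind (a (x \o @lshift k m)) * (excess x)%:R%:E.
  by rewrite mule_ge0 ?lee_fin.
rewrite /excess_int -!ge0_integralZl//.
rewrite -!ge0_integralD//; first last.
all: try exact: measurable_funeM.
all: try by move=> x _; rewrite ?mule_ge0 ?lee_fin.
have key (x : power X (k + m)) : a (x \o @lshift k m) ->
    (G (set_cnt a x) <= G (set_cnt a (x \o @rshift k m)).+1 + 2 * (excess x)%:R /\
    G (set_cnt a (x \o @rshift k m)).+1 <= G (set_cnt a x) + 2 * (excess x)%:R)%R.
  move=> ax; have [-> _] := excess_sum ax.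
  (* Without excess both arguments of [G] agree; otherwise the excess is at least 1, while two
     values of [G] differ by at most 2. *)
  case: (excess x) => [|e]; first by rewrite add0n mulr0 addr0.
  have := G2 (e.+1 + (set_cnt a (x \o @rshift k m)).+1)%N.
  have := G0 (e.+1 + (set_cnt a (x \o @rshift k m)).+1)%N.
  have := G2 (set_cnt a (x \o @rshift k m)).+1.
  have := G0 (set_cnt a (x \o @rshift k m)).+1.
  have : (1 <= e.+1%:R :> R)%R by rewrite ler1n.
  by move=> ? ? ? ? ?; split; lra.
split; apply: ge0_le_integral => //.
all: try exact: measurable_funeM.
all: try by move=> x _; rewrite ?adde_ge0 ?mule_ge0 ?lee_fin.
all: try by apply: emeasurable_funD => //; exact: measurable_funeM.
all: move=> x _; case: (boolP (a (x \o @lshift k m))) => ax;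
  rewrite ?mul0e ?mule0 ?adde0// !mul1e -EFinM -EFinD lee_fin; by case: (key x ax).
Qed.

(** For [G] the identity the comparison has no error, which is how the excess gets expressed through
    the second moment. *)
Lemma integral_head_sqr m :
  \int[K ^^ (k + m)]_x (ind (a (x \o @lshift k m)) * (set_cnt a x)%:R%:E) =
  excess_int m + alpha * \int[K ^^ m]_x ((set_cnt a x).+1%:R)%:E.
Proof.
rewrite -(@integral_head_tail m (fun i => (i.+1%:R)%:E))//.
have ma0 : measurable_fun setT (fun x : power X (k + m) => ind (a (x \o @lshift k m))).
  by apply: measurable_ind; exact: measurable_a.
have mG' : measurable_fun setT (fun x : power X (k + m) =>
    ind (a (x \o @lshift k m)) * ((set_cnt a (x \o @rshift k m)).+1%:R)%:E).
  apply: emeasurable_funM => //.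
  exact: (measurableT_comp (measurable_Gcnt (fun i => (i.+1%:R)%:E))
    (@measurable_reindex _ X _ _ (@rshift k m))).
have mE := @measurable_excess m.
rewrite /excess_int -ge0_integralD//; first last.
all: try by move=> x _; rewrite ?mule_ge0 ?lee_fin.
apply: eq_integral => x _; case: (boolP (a (x \o @lshift k m))) => ax.
  have [e _] := excess_sum ax.
  by rewrite !mul1e -EFinD -natrD -e.
by rewrite !mul0e adde0.
Qed.

End fixed_size.

(** * Poisson points in a window *)

Lemma esum_finType (R : realType) (I : finType) (P : pred I) (F : I -> \bar R) :
  (forall i, 0 <= F i) -> \esum_(i in [set i | P i]) F i = \sum_(i | P i) F i.
Proof.
move=> F0; rewrite esum_fset//; last exact: finite_finset.
rewrite -[RHS]big_filter [RHS]fsbig_seq; last by rewrite filter_uniq// index_enum_uniq.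
have -> // : [set i | P i] = [set` [seq i <- index_enum I | P i]].
by apply/seteqP; split => i /=; rewrite mem_filter mem_index_enum andbT.
Qed.

(** The map [e] enumerates the indices in use: those of the points in a window, or the first [n]
    integers for a binomial process. *)
Lemma esum_inj_ffun (R : realType) (k n : nat) (q : nat -> Prop) (e : 'I_n -> nat)
    (F : {ffun 'I_k -> nat} -> \bar R) :
  injective e -> (forall i, q i <-> exists j, i = e j) -> (forall i, 0 <= F i) ->
  \esum_(i in [set i : {ffun 'I_k -> nat} | injective i /\ forall j, q (i j)]) F i
  = \sum_(j : {ffun 'I_k -> 'I_n} | injectiveb j) F [ffun v => e (j v)].
Proof.
move=> ie qe F0.
rewrite -(esum_finType (fun j : {ffun 'I_k -> 'I_n} => injectiveb j)
  (F := fun j => F [ffun v => e (j v)]))//.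
apply: (@reindex_esum _ _ _ [set j : {ffun 'I_k -> 'I_n} | injectiveb j] _
  (fun j : {ffun 'I_k -> 'I_n} => [ffun v => e (j v)])).
split.
- move=> j /= /injectiveP ij; split.
    by move=> u v; rewrite !ffunE => /ie/ij.
  by move=> v; apply/qe; exists (j v); rewrite ffunE.
- move=> j j' _ _ /ffunP jj'; apply/ffunP => v.
  by apply: ie; have := jj' v; rewrite !ffunE.
- move=> i [ii qi].
  have H v : exists u, i v == e u by have /qe[u ->] := qi v; exists u.
  have gE v : i v = e (xchoose (H v)) by exact/eqP/(xchooseP (H v)).
  exists [ffun v => xchoose (H v)]; last by apply/ffunP => v; rewrite !ffunE -gE.
  by apply/injectiveP => u v; rewrite !ffunE => uv; apply: ii; rewrite !gE uv.
Qed.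

Lemma nneseries_enum (R : realType) n (q : nat -> bool) (e : 'I_n -> nat)
    (F : nat -> \bar R) :
  injective e -> (forall i, q i <-> exists j, i = e j) -> (forall i, 0 <= F i) ->
  \sum_(i <oo) (if q i then F i else 0) = \sum_(j < n) F (e j).
Proof.
move=> ie qe F0; rewrite -[LHS]eseries_mkcond nneseries_esum//.
rewrite -(esum_finType xpredT (F := fun j => F (e j)))//.
apply: (@reindex_esum _ _ _ [set j : 'I_n | true] _ e); split.
- by move=> j _ /=; apply/qe; exists j.
- by move=> j j' _ _ /ie.
- by move=> i /qe[j ->]; exists j.
Qed.

(** * Enumerating finitely many selected indices *)

Section index_enumeration.
Variable q : nat -> bool.

Definition rank m : nat := (\sum_(i < m) q i)%N.

(** The selected index of rank [j], with default 0 if there is none. Being total, it can be composed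
    with [pt] whatever the number of points. *)
Definition nth_index j : nat :=
  if pselect (exists i, q i && (rank i == j)) is left h then xchoose h else 0%N.

Lemma rankS m : rank m.+1 = (rank m + q m)%N.
Proof. by rewrite /rank big_ord_recr. Qed.

Lemma rank_mono m n : (m <= n)%N -> (rank m <= rank n)%N.
Proof.
elim: n => [|n IH]; first by rewrite leqn0 => /eqP ->.
rewrite leq_eqVlt => /predU1P[-> //|]; rewrite ltnS => /IH mn.
by rewrite rankS (leq_trans mn)// leq_addr.
Qed.

Lemma rank_inj i i' : q i -> q i' -> rank i = rank i' -> i = i'.
Proof.
wlog ii' : i i' / (i < i')%N.
  move=> H qi qi' r; case: (ltngtP i i') => // ii'; first exact: H.
  by apply/esym/H.
move=> qi _ r; have := rank_mono ii'; rewrite rankS qi -r addn1 ltnn.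
by [].
Qed.

(** The partial sums are integers, so a series with sum [n] attains [n] after finitely many terms,
    and no later index can satisfy [q]. *)
Lemma rank_finite_series (R : realType) n :
  \sum_(i <oo) ((q i)%:R%:E : \bar R) = (n%:R)%:E ->
  exists2 N, rank N = n & forall i, (N <= i)%N -> ~~ q i.
Proof.
have partE m : \sum_(0 <= i < m) ((q i)%:R%:E : \bar R) = ((rank m)%:R)%:E.
  by rewrite big_mkord sumEFin /rank natr_sum.
move=> qn.
have rle m : (rank m <= n)%N.
  rewrite -(ler_nat R) -lee_fin -partE -qn; apply: nneseries_lim_ge => i _ _.
  by rewrite lee_fin.
have [N rN] : exists N, (n <= rank N)%N.
  apply: contrapT => /forallNP H.
  have n0 : (0 < n)%N by have := H 0%N; case: n {qn rle H}.
  suff : (n%:R%:E : \bar R) <= n.-1%:R%:E.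
    by rewrite lee_fin ler_nat -ltnS prednK// ltnn.
  rewrite -qn; apply: lime_le.
    by apply: is_cvg_nneseries => i _ _; rewrite lee_fin.
  apply: nearW => m; rewrite partE lee_fin ler_nat -ltnS prednK//.
  by rewrite ltnNge; apply/negP/H.
have {}rN : rank N = n by apply/eqP; rewrite eqn_leq rle rN.
exists N => // i Ni; apply/negP => qi.
have := rle i.+1; rewrite rankS qi addn1 -rN ltnNge.
by rewrite rank_mono.
Qed.

Lemma nth_index_rank i : q i -> nth_index (rank i) = i.
Proof.
move=> qi; rewrite /nth_index; case: pselect => [h|]; last first.
  by move=> []; exists i; rewrite qi eqxx.
by have /andP[qx /eqP rx] := xchooseP h; apply: rank_inj.
Qed.

Variables (n N : nat).
Hypothesis rankN : rank N = n.
Hypothesis qN : forall i, (N <= i)%N -> ~~ q i.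

Lemma nth_indexP j : (j < n)%N -> q (nth_index j) /\ rank (nth_index j) = j.
Proof.
move=> jn.
have [m [mN]] : exists m, (m <= N)%N /\ (j < rank m)%N by exists N; rewrite rankN.
elim: m mN => [|m IH] mN; first by rewrite /rank big_ord0.
rewrite rankS; case: (ltnP j (rank m)) => [jm _|mj]; first exact: IH (ltnW mN) jm.
case qm : (q m); last by rewrite addn0 ltnNge mj.
rewrite addn1 ltnS => jm; have {mj}jm : rank m = j by apply/eqP; rewrite eqn_leq mj.
by rewrite -jm nth_index_rank.
Qed.

Lemma nth_index_inj : injective (fun j : 'I_n => nth_index j).
Proof.
move=> i j ij; apply/val_inj => /=.
by have [_ <-] := nth_indexP (ltn_ord i); rewrite ij; have [_ ->] := nth_indexP (ltn_ord j).
Qed.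

Lemma nth_index_onto i : q i <-> exists j : 'I_n, i = nth_index j.
Proof.
split=> [qi|[j ->]]; last by have [] := nth_indexP (ltn_ord j).
have rn : (rank i < n)%N.
  have iN : (i < N)%N by rewrite ltnNge; apply/negP => /qN; rewrite qi.
  by have := rank_mono iN; rewrite rankS qi addn1 rankN.
by exists (Ordinal rn); rewrite /= nth_index_rank.
Qed.

End index_enumeration.

(** The coloured count vanishes as soon as some class of [b] exceeds that of [col]. Both families of
    class sizes sum to [n], so if it does not vanish they agree, and the falling factorials become
    factorials. *)
Lemma coloured_bij_count (C : finType) n (col b : 'I_n -> C) :
  (\sum_(j : {ffun 'I_n -> 'I_n} | injectiveb j) [forall i, col (j i) == b i] =
   [forall c, #|[set i | col i == c]%SET| == #|[set i | b i == c]%SET|] *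
   \prod_c (#|[set i | b i == c]%SET|)`!)%N.
Proof.
have -> : (\sum_(j : {ffun 'I_n -> 'I_n} | injectiveb j) [forall i, col (j i) == b i] =
    #|[set j : {ffun 'I_n -> 'I_n} | injectiveb j & [forall i, col (j i) == b i]]%SET|)%N.
  by rewrite -sum1dep_card big_mkcondr.
rewrite card_inj_coloured; case: forallP => [e|ne].
  by rewrite mul1n; apply: eq_bigr => c _; rewrite (eqP (e c)) ffactnn.
rewrite mul0n; apply/eqP; apply: contrapT => nz; apply: ne.
have le c : (#|[set i | b i == c]%SET| <= #|[set i | col i == c]%SET|)%N.
  rewrite leqNgt; apply/negP => lt; apply: nz.
  by rewrite (bigD1 c)//= ffact_small// mul0n.
have sum_n (g : 'I_n -> C) : (\sum_c #|[set i | g i == c]%SET| = n)%N.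
  rewrite -[RHS]card_ord -sum1_card (partition_big g xpredT)//=.
  by apply: eq_bigr => c _; rewrite -sum1dep_card.
move=> c; rewrite eqn_leq le andbT.
have := sum_n col; rewrite -[RHS](sum_n b) (bigD1 c)//= [RHS](bigD1 c)//= => e.
rewrite -(leq_add2r (\sum_(i | i != c) #|[set j | col j == i]%SET|)%N) e leq_add2l.
exact: leq_sum.
Qed.

Lemma measure_partition d (X : measurableType d) (R : realType)
    (m : {measure set X -> \bar R}) (I : finType) (Q : pred I) (C : I -> set X) D :
  (forall i, measurable (C i)) -> measurable D ->
  (forall x, ((\1_D x : R) = \sum_(i | Q i) \1_(C i) x)%R) ->
  m D = \sum_(i | Q i) m (C i).
Proof.
move=> mC mD DE; rewrite -[D]setIT -integral_indic//.
under eq_integral do rewrite DE -sumEFin.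
rewrite -[RHS]big_filter.
transitivity (\int[m]_x \sum_(i <- [seq i <- index_enum I | Q i]) (\1_(C i) x : R)%:E).
  by apply: eq_integral => x _; rewrite big_filter.
rewrite ge0_integral_sum//.
  by apply: eq_bigr => i _; rewrite integral_indic// setIT.
by move=> i; apply/measurable_EFinP; exact: measurable_indic.
Qed.

Lemma sum_measureP d (T : measurableType d) (R : realType) (I : Type) (r : seq I)
    (m : I -> {measure set T -> \bar R}) :
  exists mu : {measure set T -> \bar R}, forall A, mu A = \sum_(i <- r) m i A.
Proof.
elim: r => [|i r [mu muE]]; first by exists mzero => A; rewrite big_nil.
exists (measure_add (m i) mu) => A.
by rewrite big_cons -muE; exact: measure_addE.
Qed.

Lemma poisson_pmf_series (R : realType) (M : R) : (0 <= M)%R ->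
  \sum_(n <oo) ((expR (- M) / n`!%:R * M ^+ n)%R)%:E = 1 :> \bar R.
Proof.
move=> M0; rewrite [RHS](_ : _ = (expR (- M))%:E * (expR M)%:E); last first.
  by rewrite -EFinM expRN mulVf ?gt_eqF ?expR_gt0.
under eq_eseriesr do rewrite -mulrA EFinM.
rewrite nneseriesZl/=; last first.
  by move=> n _; rewrite lee_fin mulr_ge0 ?invr_ge0// exprn_ge0.
congr *%E; rewrite expRE -EFin_lim; last first.
  rewrite /pseries/=; under eq_fun do rewrite mulrC.
  exact: is_cvg_series_exp_coeff.
by apply/congr_lim/funext => n/=; rewrite /pseries/= /series/= -sumEFin.
Qed.

(** * The law of a Poisson process in a window of finite mass *)

Section poisson_window.
Context d (X : measurableType d) (R : realType).
Context dO (Om : measurableType dO) (P : probability Om R).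
Variables (kappa : Om -> \bar R) (pt : nat -> Om -> X).
Variable Kt : {measure set X -> \bar R}.
Hypothesis mkappa : measurable_fun setT kappa.
Hypothesis mpt : forall i, measurable_fun setT (pt i).
Variable W : set X.
Hypothesis mW : measurable W.
Hypothesis KW : Kt W < +oo.
Let K : {finite_measure set X -> \bar R} := mfrestr mW KW.

Definition active (A : set X) w i : bool := ((i%:R)%:E < kappa w) && (pt i w \in A).

Lemma counting_active A w :
  Defs.counting kappa pt w A = \sum_(i <oo) ((active A w i)%:R%:E : \bar R).
Proof.
rewrite /Defs.counting esum_mkcond -nneseries_esumT; last by move=> i; case: ifP; rewrite // lee_fin.
apply: eq_eseriesr => i _; rewrite /active indicE.
rewrite (_ : (i \in _) = ((i%:R)%:E < kappa w)); first by case: ltP.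
by apply/idP/idP => [/set_mem|/mem_set].
Qed.

Lemma measurable_active A i : measurable A ->
  measurable_fun setT (fun w => active A w i).
Proof.
move=> mA; apply: measurable_and.
  apply: (measurable_fun_bool true); rewrite setTI.
  rewrite (_ : _ @^-1` _ = [set w | (i%:R)%:E < kappa w]); last first.
    by apply/seteqP; split.
  by rewrite -[X in measurable X]setTI; exact: emeasurable_fun_o_infty.
apply: (measurable_fun_bool true); rewrite setTI.
rewrite (_ : _ @^-1` _ = pt i @^-1` A).
  by rewrite -[X in measurable X]setTI; exact: mpt.
by apply/seteqP; split => w /=; [move/set_mem|move/mem_set].
Qed.

Lemma measurable_counting A : measurable A ->
  measurable_fun setT (fun w => Defs.counting kappa pt w A).
Proof.
move=> mA; under eq_fun do rewrite counting_active.
apply: ge0_emeasurable_sum => [i w _ _|i _]; first by rewrite lee_fin.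
exact/measurable_ind/measurable_active.
Qed.

Definition window_size n := [set w | Defs.counting kappa pt w W = (n%:R)%:E].

Lemma measurable_counting_eq A n : measurable A ->
  measurable [set w | Defs.counting kappa pt w A = (n%:R)%:E].
Proof.
move=> mA; have := measurable_counting mA measurableT (emeasurable_set1 n%:R%:E).
by rewrite setTI.
Qed.

(** The first [n] points in [W], by increasing index. On [window_size n] these are all its points;
    elsewhere the default of [nth_index] keeps the map defined and measurable. *)
Definition window_points n w : power X n := fun j => pt (nth_index (active W w) j) w.

Lemma measurable_window_points n : measurable_fun setT (@window_points n).
Proof.
apply: measurable_fun_power => j _ A mA; rewrite setTI.
pose B i := [set w | active W w i && (rank (active W w) i == j)].
have mB i : measurable (B i).
  have : measurable_fun setT (fun w => active W w i && (rank (active W w) i == j)).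
    apply: measurable_and; first exact: measurable_active.
    apply: measurable_fun_eqn; last exact: measurable_cst.
    apply: measurable_sumn => u.
    exact: (@measurableT_comp _ _ _ _ _ _ nat_of_bool setT _ _ (measurable_active u mW)).
  move=> /(_ measurableT [set true] _); rewrite setTI; apply.
  by [].
have mptA i : measurable (pt i @^-1` A).
  by rewrite -[X in measurable X]setTI; exact: mpt.
(* Split by which index has rank [j]; where there is none, the default index 0 is read. *)
rewrite (_ : _ @^-1` _ = (\bigcup_i (B i `&` pt i @^-1` A)) `|`
    ((~` \bigcup_i B i) `&` pt 0%N @^-1` A)).
  apply: measurableU.
    by apply: bigcupT_measurable => i; exact: measurableI.
  by apply: measurableI => //; apply: measurableC; exact: bigcupT_measurable.
apply/seteqP; split => w /=; rewrite /window_points.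
  move=> Aw; have [[i _ Bi]|nB] := pselect ((\bigcup_i B i) w).
    left; exists i => //; split => //=; move: Bi => /= /andP[qi /eqP ri].
    by move: Aw; rewrite -ri nth_index_rank.
  right; split => //; move: Aw; rewrite /nth_index; case: pselect => // -[i Bi].
  by exfalso; apply: nB; exists i.
case=> [[i _ [/= /andP[qi /eqP ri] Ai]]|[nB A0]].
  by rewrite -ri nth_index_rank.
rewrite /nth_index; case: pselect => // -[i Bi].
by exfalso; apply: nB; exists i.
Qed.

Lemma window_enum n w : window_size n w ->
  injective (fun j : 'I_n => nth_index (active W w) j) /\
  forall i, active W w i <-> exists j : 'I_n, i = nth_index (active W w) j.
Proof.
rewrite /window_size /= counting_active => /rank_finite_series[N rN qN].
by split; [exact: nth_index_inj rN|exact: nth_index_onto rN qN].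
Qed.

Lemma counting_window n w A : window_size n w -> A `<=` W ->
  Defs.counting kappa pt w A = (#|[set j : 'I_n | window_points w j \in A]%SET|%:R)%:E.
Proof.
move=> wn AW; have [ie qe] := window_enum wn.
rewrite counting_active.
transitivity (\sum_(i <oo) (if active W w i then (pt i w \in A)%:R%:E : \bar R else 0)).
  apply: eq_eseriesr => i _; rewrite /active.
  case: (_ < _)%E => //=; case: (boolP (pt i w \in A)) => iA; last by case: ifP.
  by rewrite (mem_set (AW _ (set_mem iA))).
rewrite (nneseries_enum (e := fun j : 'I_n => nth_index (active W w) j))//.
rewrite sumEFin -natr_sum; congr (_%:R%:E).
by rewrite -sum1dep_card [RHS]big_mkcond; apply: eq_bigr => j _; rewrite /window_points; case: (_ \in _).
Qed.

Hypothesis count_law : forall (m : nat) (A : 'I_m -> set X) (n : 'I_m -> nat),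
  (forall j, measurable (A j)) -> (forall j, Kt (A j) < +oo) ->
  (forall j j', j != j' -> A j `&` A j' = set0) ->
  P [set w | forall j, Defs.counting kappa pt w (A j) = ((n j)%:R)%:E]
  = \prod_(j < m) (poisson_pmf' (fine (Kt (A j))) (n j))%:E.

Lemma count_law_fin (C : finType) (A : C -> set X) (n : C -> nat) :
  (forall c, measurable (A c)) -> (forall c, Kt (A c) < +oo) ->
  (forall c c', c != c' -> A c `&` A c' = set0) ->
  P [set w | forall c, Defs.counting kappa pt w (A c) = ((n c)%:R)%:E]
  = (\prod_c poisson_pmf' (fine (Kt (A c))) (n c))%:E.
Proof.
move=> mA KA dA.
have := @count_law #|C| (A \o enum_val) (n \o enum_val) (fun=> mA _) (fun=> KA _).
rewrite prodEFin (_ : [set w | _] = [set w | forall c, Defs.counting kappa pt w (A c) = ((n c)%:R)%:E]).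
  move=> ->; last by move=> j j' jj'; apply: dA; rewrite (inj_eq enum_val_inj).
  congr EFin; rewrite [RHS](reindex (@enum_val C C))//=.
  by apply: onW_bij; exact: enum_val_bij.
apply/seteqP; split => w /=; last by move=> H j; exact: H.
by move=> H c; have := H (enum_rank c); rewrite /= enum_rankK.
Qed.

Lemma integral_indicator_fun (D : set Om) (b : Om -> bool) :
  measurable D -> (forall w, b w <-> D w) ->
  \int[P]_w (b w)%:R%:E = P D :> \bar R.
Proof.
move=> mD bD; rewrite -[D in RHS]setIT -integral_indic//.
apply: eq_integral => w _; rewrite indicE; congr (_%:R%:E); congr nat_of_bool.
by apply/idP/idP => [/bD/mem_set|/set_mem/bD].
Qed.

(* Cut W into the cells of the partition generated by the E i. Prescribing the
   cells of the n points fixes the cell counts; the product of al(c)! bijections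
   realising them cancels the factorials in the Poisson probabilities. *)
Lemma window_box n (E : 'I_n -> set X) : (forall i, measurable (E i)) ->
  \sum_(j : {ffun 'I_n -> 'I_n} | injectiveb j)
    P (window_size n `&` [set w | box E (window_points w \o j)])
  = (expR (- fine (Kt W)))%:E * pmeasure K n (box E).
Proof.
move=> mE; rewrite pmeasure_box//.
pose cell x : {set 'I_n} := [set i | x \in E i]%SET.
pose C (c : {set 'I_n}) := W `&` [set x | cell x = c].
have mcell c : measurable [set x | cell x = c].
  rewrite (_ : [set x | _] = \bigcap_(i in [set: 'I_n])
      (if i \in c then E i else ~` E i)).
    apply: fin_bigcap_measurable => // i _; case: ifP => _ //.
    exact: measurableC.
  apply/seteqP; split => x /=.
    move=> <- i _; rewrite inE; case: ifPn => [/set_mem//|/negP xE Ex].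
    by apply: xE; exact: mem_set.
  move=> H; apply/setP => i; rewrite inE; have := H i I.
  by case: ifP => _ Ei; [exact: mem_set|exact: memNset].
have mC c : measurable (C c) by exact: measurableI.
have CW c : C c `<=` W by move=> x [].
have KC c : Kt (C c) < +oo.
  by apply: le_lt_trans KW; apply: le_measure; rewrite ?inE//.
have dC c c' : c != c' -> C c `&` C c' = set0.
  move=> cc'; apply/seteqP; split => // x [[_ /= xc] [_ /= xc']].
  by move: cc'; rewrite -xc -xc' eqxx.
pose kc c := fine (Kt (C c)).
have kcE c : Kt (C c) = (kc c)%:E by rewrite fineK// ge0_fin_numE.
have KWE : Kt W = (\sum_c kc c)%:E.
  rewrite (@measure_partition _ X R Kt _ xpredT C)// -?sumEFin.
    by apply: eq_bigr => c _; rewrite kcE.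
  move=> x; rewrite (bigD1 (cell x))//= big1 ?addr0.
    rewrite !indicE; congr (_%:R); congr nat_of_bool.
    by apply/idP/idP => /set_mem Wx; apply: mem_set; [split|case: Wx].
  by move=> c cx; rewrite indicE memNset// => -[_ /= xc]; rewrite xc eqxx in cx.
have KEE i : K (E i) = (\sum_(c : {set 'I_n} | i \in c) kc c)%:E.
  rewrite /K /= /mfrestr /mrestr.
  rewrite (@measure_partition _ X R Kt _ (fun c : {set 'I_n} => i \in c) C)// -?sumEFin.
  - by apply: eq_bigr => c _; rewrite kcE.
  - exact: measurableI.
  move=> x; rewrite big_mkcond (bigD1 (cell x))//= big1 ?addr0.
    rewrite !indicE [i \in cell x]inE; case: (boolP (x \in E i)) => xE.
      congr (_%:R); congr nat_of_bool.
      apply/idP/idP => /set_mem Wx; apply: mem_set; first by case: Wx.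
      by case: Wx => Wx _; split => //; exact/set_mem.
    by rewrite memNset// => -[Ex _]; move/negP: xE; apply; exact: mem_set.
  move=> c cx; case: ifP => // _; rewrite indicE memNset// => -[_ /= xc].
  by rewrite xc eqxx in cx.
pose al (b : {ffun 'I_n -> {set 'I_n}}) c := #|[set i | b i == c]%SET|.
have al_sum b : (\sum_c al b c = n)%N.
  rewrite -[RHS]card_ord -sum1_card (partition_big b xpredT)//=.
  by apply: eq_bigr => c _; rewrite /al -sum1dep_card.
pose Ev b := [set w | forall c, Defs.counting kappa pt w (C c) = ((al b c)%:R)%:E].
have mEv b : measurable (Ev b).
  rewrite (_ : Ev b = \bigcap_(c in [set: {set 'I_n}])
     [set w | Defs.counting kappa pt w (C c) = ((al b c)%:R)%:E]).
    by apply: fin_bigcap_measurable => // c _; exact: measurable_counting_eq.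
  by apply/seteqP; split => w /=; [move=> H c _|move=> H c]; exact: H.
pose Q (i : 'I_n) : pred {set 'I_n} := fun c => i \in c.
have mwb (j : {ffun 'I_n -> 'I_n}) :
    measurable (window_size n `&` [set w | box E (window_points w \o j)]).
  apply: measurableI; first exact: measurable_counting_eq.
  rewrite -[X in measurable X]setTI.
  exact: (measurableT_comp (@measurable_reindex _ X _ _ j) (@measurable_window_points n)
    measurableT (measurable_box mE)).
pose bx (j : {ffun 'I_n -> 'I_n}) w :=
  `[< window_size n w >] && [forall i, i \in cell (window_points w (j i))].
have bxP j w : bx j w <-> (window_size n `&` [set w | box E (window_points w \o j)]) w.
  split=> [/andP[/asboolP ? /forallP H]|[? H]].
    by split => //= i; have := H i; rewrite inE => /set_mem.
  apply/andP; split; first exact/asboolP.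
  by apply/forallP => i; rewrite inE; apply: mem_set; exact: H.
pose r := [seq j : {ffun 'I_n -> 'I_n} <- index_enum _ | injectiveb j].
pose rb := [seq b : {ffun 'I_n -> {set 'I_n}} <- index_enum _ | b \in family Q].
pose fac b := (\prod_c (al b c)`!)%N.
(* For each prescription [b] of cells compatible with the box, the number of relabellings realising
   it is [fac b] if the cell counts are those of [b], and 0 otherwise. *)
have pointwise w : (\sum_(j <- r) bx j w = \sum_(b <- rb) fac b * `[< Ev b w >])%N.
  rewrite !big_filter.
  (* Outside [window_size n] both sides vanish, because the cell counts prescribed by any [b] add up
     to [n]. *)
  have [wn|nwn] := pselect (window_size n w); last first.
    rewrite [LHS]big1; last by move=> j _; rewrite /bx asboolF.
    rewrite [RHS]big1//.
    move=> b _; rewrite asboolF ?muln0// => Evw; apply: nwn.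
    rewrite /window_size /= counting_active.
    transitivity (\sum_c Defs.counting kappa pt w (C c)); last first.
      by rewrite (eq_bigr (fun c => (al b c)%:R%:E)) ?sumEFin -?natr_sum ?al_sum// => c _; exact: Evw.
    under [RHS]eq_bigr do rewrite counting_active.
    rewrite -nneseries_sum//; apply: eq_eseriesr => i _.
    rewrite sumEFin -natr_sum; congr (_%:R%:E).
    rewrite (bigD1 (cell (pt i w)))//= big1 ?addn0.
      rewrite /active; congr (nat_of_bool (_ && _)).
      by apply/idP/idP => /set_mem Wx; apply: mem_set; [split|case: Wx].
    move=> c cx; rewrite /active memNset ?andbF// => -[_ /= xc].
    by rewrite xc eqxx in cx.
  have [ie qe] := window_enum wn.
  have yW (j : 'I_n) : W (window_points w j).
    have : active W w (nth_index (active W w) j) by apply/qe; exists j.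
    by move=> /andP[_ /set_mem].
  transitivity (\sum_(j : {ffun 'I_n -> 'I_n} | injectiveb j)
     \sum_(b in family Q) [forall i, cell (window_points w (j i)) == b i])%N.
    apply: eq_bigr => j _; pose b0 := [ffun i => cell (window_points w (j i))].
    rewrite big_mkcond (bigD1 b0)//= big1 ?addn0.
      rewrite /bx asboolT//=.
      have -> : [forall i, cell (window_points w (j i)) == b0 i].
        by apply/forallP => i; rewrite ffunE.
      case: (boolP (b0 \in _)) => [/familyP H|/familyP H].
        by apply/eqP; rewrite eqb1; apply/forallP => i; have := H i; rewrite ffunE.
      apply/eqP; rewrite eqb0; apply/negP => /forallP H'; apply: H => i.
      by rewrite ffunE; exact: H'.
    move=> b bb0; case: ifP => // _; apply/eqP; rewrite eqb0; apply/negP => /forallP H.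
    by move/eqP: bb0; apply; apply/ffunP => i; rewrite ffunE (eqP (H i)).
  rewrite exchange_big /=; apply: eq_bigr => b _.
  rewrite (coloured_bij_count (fun i => cell (window_points w i)) b) mulnC.
  congr (_ * nat_of_bool _)%N.
  have cE c : Defs.counting kappa pt w (C c) =
      (#|[set i : 'I_n | cell (window_points w i) == c]%SET|%:R)%:E.
    rewrite (counting_window wn (CW c)); congr (_%:R%:E); apply: eq_card => i.
    rewrite !inE; apply/idP/eqP => [/set_mem[]//|ic].
    by apply: mem_set; split.
  apply/forallP/asboolP => [H c|H c].
    by rewrite cE (eqP (H c)).
  have := H c; rewrite cE => -[/eqP]; rewrite eqr_nat; exact.
rewrite -big_filter -/r.
rewrite (eq_bigr (fun j => \int[P]_w (bx j w)%:R%:E)); last first.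
  by move=> j _; rewrite (integral_indicator_fun (mwb j) (bxP j)).
have m_ind (b : Om -> bool) D : measurable D -> (forall w, b w <-> D w) ->
    measurable_fun setT (fun w => ((b w)%:R : R)%:E).
  move=> mD bD; apply/measurable_EFinP.
  rewrite (_ : (fun w => _) = (\1_D : Om -> R)); first exact: measurable_indic.
  apply/funext => w; rewrite indicE; congr (_%:R); congr nat_of_bool.
  by apply/idP/idP => [/bD/mem_set|/set_mem/bD].
rewrite -ge0_integral_sum//; last by move=> j; exact: (m_ind _ _ (mwb j) (bxP j)).
have EvP b w : `[< Ev b w >] <-> Ev b w by split=> /asboolP.
transitivity (\int[P]_w \sum_(b <- rb) ((fac b)%:R%:E * (`[< Ev b w >]%:R)%:E : \bar R)).
  apply: eq_integral => w _; rewrite sumEFin -natr_sum pointwise natr_sum -sumEFin.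
  by apply: eq_bigr => b _; rewrite natrM EFinM.
rewrite ge0_integral_sum//; last first.
  by move=> b; apply: measurable_funeM; exact: (m_ind _ _ (mEv b) (EvP b)).
rewrite (eq_bigr (fun b : {ffun 'I_n -> {set 'I_n}} =>
    (expR (- fine (Kt W)) * \prod_i kc (b i))%:E)); last first.
  move=> b _; rewrite ge0_integralZl//; last exact: (m_ind _ _ (mEv b) (EvP b)).
  rewrite (integral_indicator_fun (mEv b) (EvP b)) count_law_fin// -EFinM; congr EFin.
  rewrite KWE /= -sumrN expR_sum /fac natr_prod -big_split /=.
  rewrite [X in (_ * X)%R](partition_big b xpredT)//= -big_split /=.
  apply: eq_bigr => c _; rewrite (eq_bigr (fun=> kc c)); last by move=> i /eqP ->.
  rewrite prodr_const -[X in (_ ^+ X)%R]cardsE -/(al b c) /poisson_pmf' -/(kc c).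
  have nz : ((al b c)`!%:R != 0 :> R)%R by rewrite pnatr_eq0 -lt0n fact_gt0.
  by field; rewrite nz.
rewrite big_filter sumEFin -mulr_sumr EFinM; congr (_ * _).
under [RHS]eq_bigr do rewrite KEE.
by rewrite prodEFin bigA_distr_big_dep.
Qed.

Let M := fine (Kt W).

(** [window_box] determines the sum over all relabellings on boxes, hence as a measure; on a
    permutation-invariant event its [n!] summands coincide. *)
Lemma window_symmetric n (E : set (power X n)) : measurable E ->
  (forall (j : {ffun 'I_n -> 'I_n}) x, injective j -> E (x \o j) <-> E x) ->
  P (window_size n `&` [set w | E (window_points w)]) =
  (expR (- M) / n`!%:R)%:E * pmeasure K n E.
Proof.
move=> mE Esym.
have mws : measurable (window_size n) by exact: measurable_counting_eq.
have my (j : {ffun 'I_n -> 'I_n}) :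
    measurable_fun setT (fun w => window_points w \o j : power X n).
  exact: (measurableT_comp (@measurable_reindex _ X _ _ j) (@measurable_window_points n)).
pose mj j := projT1 (cid (pushforwardP (mrestr P mws) (my j))).
have mjE j A : mj j A = P ([set w | A (window_points w \o j)] `&` window_size n).
  by rewrite /mj; case: cid => /= m [-> _].
have [mu muE] := @sum_measureP _ _ R _
  [seq j : {ffun 'I_n -> 'I_n} <- index_enum _ | injectiveb j] mj.
have e0 : (0 <= expR (- M))%R by exact: expR_ge0.
have muK A : measurable A -> mscale (NngNum e0) (pmeasure K n) A = mu A.
  apply: power_measure_unique => //.
    by rewrite /mscale /= lte_mul_pinfty ?lee_fin// ltey_eq fin_num_measure.
  move=> F mF; rewrite muE big_filter -[LHS]/((expR (- M))%:E * pmeasure K n (box F)).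
  rewrite -window_box//; apply: eq_bigr => j _.
  by rewrite mjE setIC.
have := muK E mE; rewrite muE big_filter.
rewrite (eq_bigr (fun=> P (window_size n `&` [set w | E (window_points w)]))); last first.
  move=> j /injectiveP ij; rewrite mjE setIC; congr (P _).
  by apply/seteqP; split => w [wn /= Ew]; split => //=; apply/(Esym j _ ij).
rewrite sumr_const natmul_mule.
have -> : #|[pred j : {ffun 'I_n -> 'I_n} | injectiveb j]| = n`!.
  rewrite -ffactnn -[n in RHS]card_ord -card_inj_ffuns.
  by apply: eq_card => j; rewrite !inE.
rewrite -[LHS]/((expR (- M))%:E * pmeasure K n E) => e.
have nz : (n`!%:R != 0 :> R)%R by rewrite pnatr_eq0 -lt0n fact_gt0.
by rewrite EFinM muleAC e muleAC -EFinM mulfV// mul1e.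
Qed.

Variables (k : nat) (a : ('I_k -> X) -> bool).
Hypothesis asym : forall (s : {perm 'I_k}) x, a (x \o s) = a x.
Hypothesis ma : measurable_fun setT (a : power X k -> bool).

(** The number of points is recovered from the counting value. The test fails only where the window
    holds infinitely many points, a null event on which the count is set to 0. *)
Definition window_count w : nat :=
  let n := Num.truncn (fine (Defs.counting kappa pt w W)) in
  if `[< window_size n w >] then set_cnt a (@window_points n w) else 0%N.

Lemma window_countE n w : window_size n w ->
  window_count w = set_cnt a (@window_points n w).
Proof.
move=> wn; rewrite /window_count.
have -> : Num.truncn (fine (Defs.counting kappa pt w W)) = n.
  by rewrite wn /= Num.Theory.natrK.
by rewrite asboolT.
Qed.

Lemma window_size_disj : trivIset setT window_size.
Proof.
apply/trivIsetP => i j _ _ ij; apply/seteqP; split => // w [wi wj].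
move: wi; rewrite /window_size /= wj => -[/eqP].
by rewrite eqr_nat eq_sym (negbTE ij).
Qed.

Let N0 := ~` (\bigcup_n window_size n).

Let m_ws n : measurable (window_size n).
Proof. exact: measurable_counting_eq. Qed.

Let m_wsB n (B : set nat) :
  measurable (window_size n `&` [set w | B (set_cnt a (@window_points n w))]).
Proof.
apply: measurableI => //; rewrite -[X in measurable X]setTI.
have mB : measurable B by [].
exact: (measurableT_comp (measurable_set_cnt (n := n) ma) (@measurable_window_points n)
  measurableT mB).
Qed.

Let preimage_count (B : set nat) : window_count @^-1` B =
  \bigcup_n (window_size n `&` [set w | B (set_cnt a (@window_points n w))])
  `|` (if 0%N \in B then N0 else set0).
Proof.
apply/seteqP; split => w.
  move=> Bw; have [[n _ wn]|nw] := pselect ((\bigcup_n window_size n) w).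
    by left; exists n => //; split => //=; rewrite -window_countE.
  right; move: Bw; rewrite /= /window_count asboolF => [/mem_set ->//|wn].
  by apply: nw; exists (Num.truncn (fine (Defs.counting kappa pt w W))).
case=> [[n _ [wn /= Bn]]|]; first by rewrite /= (window_countE wn).
case: ifPn => // /set_mem B0 nw; rewrite /= /window_count asboolF// => wn.
by apply: nw; exists (Num.truncn (fine (Defs.counting kappa pt w W))).
Qed.

Lemma measurable_window_count : measurable_fun setT window_count.
Proof.
move=> _ B _; rewrite setTI preimage_count; apply: measurableU.
  exact: bigcupT_measurable.
by case: ifP => // _; apply: measurableC; exact: bigcupT_measurable.
Qed.

Lemma window_size_prob n : P (window_size n) = (expR (- M) / n`!%:R * M ^+ n)%:E.
Proof.
have := @count_law_fin unit (fun=> W) (fun=> n) (fun=> mW) (fun=> KW).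
rewrite (_ : [set w | _] = window_size n).
  move=> ->; last by case=> -[].
  rewrite (big_pred1 tt); last by case.
  by rewrite /poisson_pmf'; congr EFin; rewrite -/M; ring.
by apply/seteqP; split => w /=; [exact|move=> H []].
Qed.

(** The Poisson weights of the events [window_size n] sum to 1. *)
Lemma window_size_total : P N0 = 0.
Proof.
have M0 : (0 <= M)%R by exact: fine_ge0.
have mU : measurable (\bigcup_n window_size n) by exact: bigcupT_measurable.
rewrite /N0 probability_setC// measure_bigcup//; last exact: window_size_disj.
rewrite (eq_eseriesl (Q := xpredT)); last by move=> n; exact: in_setT.
rewrite (eq_eseriesr (g := fun n => (expR (- M) / n`!%:R * M ^+ n)%R%:E)).
  by rewrite poisson_pmf_series// subee.
by move=> n _; exact: window_size_prob.
Qed.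

(** [set_cnt] is invariant under relabelling, so [window_symmetric] applies to every event it
    defines, and the null set [N0] drops out. *)
Lemma window_count_law (G : nat -> \bar R) : (forall i, 0 <= G i) ->
  \int[P]_w G (window_count w) =
  \sum_(n <oo) ((expR (- M) / n`!%:R)%R)%:E *
    \int[pmeasure K n]_x G (set_cnt a x).
Proof.
move=> G0.
have [muT [muTE muTi]] := pushforwardP P measurable_window_count.
pose mn n := projT1 (cid (pushforwardP (pmeasure K n) (measurable_set_cnt (n := n) ma))).
have mnE n : (forall A, mn n A = pmeasure K n ([set x | A (set_cnt a x)])) /\
    forall u : nat -> \bar R, measurable_fun setT u -> (forall x, 0 <= u x) ->
      \int[mn n]_x u x = \int[pmeasure K n]_x u (set_cnt a x).
  by rewrite /mn; case: cid.
have c0 n : (0 <= expR (- M) / n`!%:R)%R by rewrite divr_ge0// expR_ge0.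
pose m n := mscale (NngNum (c0 n)) (mn n).
rewrite -muTi//.
rewrite (eq_measure_integral (mseries m 0%N)); last first.
  move=> B _ _; rewrite muTE preimage_count.
  pose F n := window_size n `&` [set w | B (set_cnt a (@window_points n w))].
  pose N0B : set Om := if 0%N \in B then N0 else set0.
  have mN0B : measurable N0B.
    by rewrite /N0B; case: ifP => // _; apply: measurableC; exact: bigcupT_measurable.
  transitivity (P (\bigcup_n F n) + P N0B).
    apply: measureU => //; first exact: bigcupT_measurable.
    apply/seteqP; split => // w [[n _ [wn _]]]; rewrite /N0B; case: ifP => // _ nw.
    by apply: nw; exists n.
  have -> : P N0B = 0.
    by rewrite /N0B; case: ifP => _; [exact: window_size_total|exact: measure0].
  rewrite adde0.
  transitivity (\sum_(n <oo) P (F n)).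
    rewrite measure_bigcup//; last first.
      apply/trivIsetP => i j _ _ ij; apply/seteqP; split => // w [[wi _] [wj _]].
      by have /trivIsetP/(_ i j I I ij)/seteqP[H _] := window_size_disj; exact: (H w).
      by move=> i _; exact: m_wsB.
    by rewrite (eq_eseriesl (Q := xpredT)) => [//|n]; exact: in_setT.
  apply: eq_eseriesr => n _.
  transitivity ((expR (- M) / n`!%:R)%:E * pmeasure K n [set x | B (set_cnt a x)]).
    apply: (window_symmetric (E := [set x | B (set_cnt a x)])).
      have mB : measurable B by [].
      rewrite -[X in measurable X]setTI.
      exact: (measurable_set_cnt (n := n) ma measurableT mB).
    move=> j x ij /=; have -> // : set_cnt a (x \o j) = set_cnt a x.
    have -> : x \o j = x \o perm ij by apply/funext => i; rewrite /= permE.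
    exact: set_cnt_perm.
  by rewrite -(mnE n).1.
rewrite ge0_integral_measure_series//; apply: eq_eseriesr => n _.
by rewrite ge0_integral_mscale// (mnE n).2.
Qed.

End poisson_window.

(** * Moments in a window *)

Section window_moments.
Context d (X : measurableType d) (R : realType).
Context dO (Om : measurableType dO) (P : probability Om R).
Variables (K : {finite_measure set X -> \bar R}) (M : R).
Hypothesis M0 : (0 <= M)%R.
Hypothesis KM : K setT = M%:E.
Variables (k : nat) (a : ('I_k -> X) -> bool).
Hypothesis asym : forall (s : {perm 'I_k}) x, a (x \o s) = a x.
Hypothesis ma : measurable_fun setT (a : power X k -> bool).
Hypothesis k0 : (0 < k)%N.
Variable T : Om -> nat.
Hypothesis mT : measurable_fun setT T.
Let w n : R := (expR (- M) / n`!%:R)%R.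
Hypothesis lawT : forall (G : nat -> \bar R), (forall i, 0 <= G i) ->
  \int[P]_u G (T u) = \sum_(n <oo) (w n)%:E * \int[pmeasure K n]_x G (set_cnt a x).

Local Notation "K ^^ n" := (pmeasure K n) (at level 30).
Local Notation ind b := (((b : bool)%:R : R)%:E).

Let w0 n : (0 <= w n)%R.
Proof. by rewrite divr_ge0// expR_ge0. Qed.

Let wk n : (0 <= w n / k`!%:R)%R.
Proof. by rewrite divr_ge0. Qed.

(** Once a hit is singled out among [k + m] points, the remaining [m] again carry a Poisson
    weight. *)
Let w_bin m : (w (k + m) * 'C(k + m, k)%:R = w m / k`!%:R)%R.
Proof.
have nz n : (n`!%:R != 0 :> R)%R by rewrite pnatr_eq0 -lt0n fact_gt0.
have /(congr1 (fun i : nat => i%:R : R)%R) := bin_fact (leq_addr m k).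
rewrite addKn !natrM /w => <-.
have nb : ('C(k + m, k)%:R != 0 :> R)%R by rewrite pnatr_eq0 -lt0n bin_gt0 leq_addr.
by field; rewrite !nz nb.
Qed.

Definition window_excess : \bar R :=
  \sum_(m <oo) (w m / k`!%:R)%:E * excess_int K a m.

Let alpha := \int[K ^^ k]_x ind (a x).
Let mu := (k`!%:R^-1)%:E * alpha.

Let excess_ge0 m : 0 <= excess_int K a m.
Proof. by apply: integral_ge0 => x _; rewrite mule_ge0// lee_fin. Qed.

Lemma window_excess_ge0 : 0 <= window_excess.
Proof. by apply: nneseries_ge0 => m _ _; rewrite mule_ge0 ?lee_fin. Qed.

Let alpha_ge0 : 0 <= alpha.
Proof. by apply: integral_ge0 => x _; rewrite lee_fin. Qed.

Let alphaE : alpha = (fine alpha)%:E.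
Proof.
rewrite fineK// ge0_fin_numE//; apply: (@le_lt_trans _ _ (\int[K ^^ k]_x 1)).
  apply: ge0_le_integral => //; first exact: measurable_ind.
  by move=> x _; rewrite lee_fin lern1 leq_b1.
by rewrite integral_cst// mul1e ltey_eq fin_num_measure.
Qed.

Let weighted (G : nat -> R) : (forall i, 0 <= G i)%R ->
  \int[P]_u ((T u)%:R * G (T u))%:E =
  \sum_(m <oo) (w m / k`!%:R)%:E *
    \int[K ^^ (k + m)]_x (ind (a (x \o @lshift k m)) * (G (set_cnt a x))%:E).
Proof.
move=> G0.
have H0 (m : nat) : 0 <= (m%:R * G m)%:E by rewrite lee_fin mulr_ge0.
rewrite (lawT H0).
pose f n := (w n)%:E * \int[K ^^ n]_x ((set_cnt a x)%:R * G (set_cnt a x))%:E.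
have f0 n : 0 <= f n.
  by rewrite mule_ge0 ?lee_fin//; apply: integral_ge0 => x _; exact: H0.
transitivity (\sum_(n <oo) f n); first by [].
(* Fewer than [k] points contain no hit, so the series effectively starts at [k]. *)
rewrite (nneseries_split 0%N k); last by move=> n _; exact: f0.
rewrite [X in X + _]big1_seq ?add0e; last first.
  move=> n /andP[_]; rewrite mem_index_iota add0n => /andP[_ nk].
  rewrite /f integral0_eq ?mule0// => x _.
  by rewrite /set_cnt inj_cnt_small// div0n mul0r.
rewrite add0n -nneseries_addn//; apply: eq_eseriesr => m _.
have -> : f (m + k)%N = f (k + m)%N by rewrite addnC.
by rewrite /f integral_set_cnt// muleA -EFinM w_bin.
Qed.

Let head_tail (G : nat -> R) : (forall i, 0 <= G i)%R ->
  \sum_(m <oo) (w m / k`!%:R)%:E * (alpha * \int[K ^^ m]_x (G (set_cnt a x).+1)%:E) =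
  mu * \int[P]_u (G (T u).+1)%:E.
Proof.
move=> G0; rewrite (lawT (G := fun i => (G i.+1)%:E)); last by move=> i; rewrite lee_fin.
have I0 m : 0 <= \int[K ^^ m]_x (G (set_cnt a x).+1)%:E.
  by apply: integral_ge0 => x _; rewrite lee_fin.
rewrite /mu alphaE -EFinM -nneseriesZl; last by move=> m _; rewrite mule_ge0 ?lee_fin.
apply: eq_eseriesr => m _; rewrite !muleA -!EFinM; congr (_%:E * _).
by move: (fine alpha) (w m) => u v; ring.
Qed.

Let weighted_nonneg m (G : nat -> R) : (forall i, 0 <= G i)%R ->
  0 <= \int[K ^^ (k + m)]_x (ind (a (x \o @lshift k m)) * (G (set_cnt a x))%:E).
Proof. by move=> G0; apply: integral_ge0 => x _; rewrite mule_ge0 ?lee_fin. Qed.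

Lemma window_mean : \int[P]_u (T u)%:R%:E = mu.
Proof.
rewrite (eq_integral (fun u => ((T u)%:R * 1)%:E)); last by move=> u _; rewrite mulr1.
rewrite (weighted (G := fun=> 1%R))//.
transitivity (mu * \int[P]_u (1 : R)%:E); last first.
  by rewrite integral_cst// mul1e [X in _ * X](probability_setT P) mule1.
rewrite -(head_tail (G := fun=> 1%R))//; apply: eq_eseriesr => m _; congr (_ * _).
by rewrite -(integral_head_tail K ma m (G := fun=> 1)).
Qed.

Lemma window_stein (G : nat -> R) : (forall i, 0 <= G i <= 2)%R ->
  \int[P]_u ((T u)%:R * G (T u))%:E <=
    mu * \int[P]_u (G (T u).+1)%:E + 2%:E * window_excess /\
  mu * \int[P]_u (G (T u).+1)%:E <=
    \int[P]_u ((T u)%:R * G (T u))%:E + 2%:E * window_excess.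
Proof.
move=> G02; have G0 i : (0 <= G i)%R by case/andP: (G02 i).
have I0 m : 0 <= alpha * \int[K ^^ m]_x (G (set_cnt a x).+1)%:E.
  by rewrite mule_ge0//; apply: integral_ge0 => x _; rewrite lee_fin.
have E0 m : 0 <= 2%:E * excess_int K a m by rewrite mule_ge0// lee_fin.
rewrite weighted// -head_tail// /window_excess.
rewrite -nneseriesZl; last by move=> m _; rewrite mule_ge0 ?lee_fin.
have wI0 m : 0 <= (w m / k`!%:R)%:E * (alpha * \int[K ^^ m]_x (G (set_cnt a x).+1)%:E).
  by rewrite mule_ge0// lee_fin.
have wE0 m : 0 <= 2%:E * ((w m / k`!%:R)%:E * excess_int K a m).
  by rewrite !mule_ge0// lee_fin.
have wG0 m : 0 <= (w m / k`!%:R)%:E *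
    \int[K ^^ (k + m)]_x (ind (a (x \o @lshift k m)) * (G (set_cnt a x))%:E).
  by rewrite mule_ge0 ?lee_fin// weighted_nonneg.
split; rewrite -nneseriesD//; apply: lee_nneseries => // m _;
  rewrite [X in _ + X]muleCA -ge0_muleDr//; try exact: weighted_nonneg;
  apply: lee_wpmul2l; rewrite ?lee_fin//;
  by have [] := integral_head K asym ma k0 m G02.
Qed.

(** Since [mu] is the mean of [T], this identifies [window_excess] with [E T^2 - E T - (E T)^2] when
    the second moment is finite. *)
Lemma window_sqr : \int[P]_u ((T u)%:R * (T u)%:R)%:E =
  window_excess + mu * \int[P]_u ((T u).+1%:R)%:E.
Proof.
rewrite (weighted (G := fun i => i%:R))// -(head_tail (G := fun i => i%:R))//.
rewrite /window_excess -nneseriesD; last 2 first.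
- by move=> m _; rewrite mule_ge0 ?lee_fin.
- move=> m _; rewrite mule_ge0 ?lee_fin ?mule_ge0//; apply: integral_ge0 => x _.
  by rewrite lee_fin.
apply: eq_eseriesr => m _; rewrite -ge0_muleDr//; last first.
  by rewrite mule_ge0//; apply: integral_ge0 => x _; rewrite lee_fin.
by congr (_ * _); exact: integral_head_sqr.
Qed.

(** The factorial moment of order [q] of the Poisson law is [M ^ q]; lowering the exponent to
    [m - q] replaces a division, so that [M = 0] is included. *)
Let pmf_ffact_series q : \sum_(m <oo) ((w m * (m ^_ q)%:R * M ^+ (m - q))%R)%:E = 1 :> \bar R.
Proof.
pose f m : \bar R := ((w m * (m ^_ q)%:R * M ^+ (m - q))%R)%:E.
have f0 m : 0 <= f m by rewrite lee_fin !mulr_ge0// exprn_ge0.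
transitivity (\sum_(n <oo) f n); first by [].
rewrite (nneseries_split 0%N q); last by move=> n _; exact: f0.
rewrite [X in X + _]big1_seq ?add0e; last first.
  move=> n /andP[_]; rewrite mem_index_iota add0n => /andP[_ nq].
  by rewrite /f ffact_small// mulr0 mul0r.
rewrite add0n -nneseries_addn// -[RHS](poisson_pmf_series M0).
apply: eq_eseriesr => m _; rewrite /f addnK; congr (_ * _)%:E.
have nz n : (n`!%:R != 0 :> R)%R by rewrite pnatr_eq0 -lt0n fact_gt0.
have /(congr1 (fun i : nat => i%:R : R)%R) := ffact_fact (leq_addl m q).
rewrite addnK natrM /w => <-.
have nf : (((m + q) ^_ q)%:R != 0 :> R)%R by rewrite pnatr_eq0 -lt0n ffact_gt0 leq_addl.
by field; rewrite nf nz.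
Qed.

Lemma window_excess_le :
  window_excess <= \sum_(l < k.+1 | (0 < l < k)%N)
    ('C(k, l)%:R / k`!%:R)%:E * overlap_int K a l.
Proof.
have nz n : (n`!%:R != 0 :> R)%R by rewrite pnatr_eq0 -lt0n fact_gt0.
have O0 (l : 'I_k.+1) : 0 <= overlap_int K a l.
  exact/overlap_int_ge0/(ltn_ord l).
(* The exact weight of overlap [l]: one [k!] for the orderings of the reference hit, the other for
   those of the second hit. *)
pose c l : R := ('C(k, l)%:R * (k ^_ l)%:R / (k`!%:R * k`!%:R))%R.
have c0 l : (0 <= c l)%R by rewrite divr_ge0// mulr_ge0.
pose g l m : R := (w m * (m ^_ (k - l))%:R * M ^+ (m - (k - l)))%R.
have g0 l m : (0 <= g l m)%R by rewrite !mulr_ge0// exprn_ge0.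
have -> : window_excess = \sum_(l < k.+1 | (0 < l < k)%N) (c l)%:E * overlap_int K a l.
  transitivity (\sum_(m <oo) \sum_(l < k.+1 | (0 < l < k)%N)
      ((g l m)%:E * ((c l)%:E * overlap_int K a l))).
    apply: eq_eseriesr => m _.
    transitivity ((w m / k`!%:R / k`!%:R)%:E * (k`!%:R%:E * excess_int K a m)).
      by rewrite muleA -EFinM divfK.
    rewrite excess_int_overlap// ge0_sume_distrr; last first.
      by move=> l _; rewrite !mule_ge0 ?lee_fin// KM -EFin_expe lee_fin exprn_ge0.
    apply: eq_bigr => l _; rewrite KM -EFin_expe !muleA -!EFinM; congr (_%:E * _).
    by rewrite /c /g !natrM; field; rewrite nz.
  rewrite nneseries_sum; last by move=> m l _; rewrite !mule_ge0// lee_fin.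
  apply: eq_bigr => l _.
  have /fineK <- := overlap_int_fin_num K ma (ltn_ord l : l <= k)%N.
  rewrite -EFinM; under eq_eseriesr do rewrite muleC.
  rewrite nneseriesZl; last by move=> m _; rewrite lee_fin.
  by rewrite pmf_ffact_series mule1.
(* Equality is lost only here, through [k ^_ l <= k!]. *)
apply: lee_sum => l _; apply: lee_wpmul2r => //; rewrite lee_fin /c.
rewrite -mulrA ler_wpM2l// ler_pdivrMr ?mulr_gt0 ?ltr0n ?fact_gt0//.
rewrite mulrA mulVf ?nz// mul1r ler_nat -(ffact_fact (ltn_ord l : l <= k)%N).
by rewrite leq_pmulr ?fact_gt0.
Qed.

End window_moments.

(** * Overlap integrals *)

Section monotonicity.
Context d (X : measurableType d) (R : realType).
Implicit Types K : {measure set X -> \bar R}.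

(** The integral is a supremum over simple functions, so monotonicity holds for all nonnegative
    functions, including the inner integrals of [r_t] over [Kt], whose measurability is not
    established. *)
Lemma integral_le_measure K K' (u u' : X -> \bar R) :
  (forall A, measurable A -> K A <= K' A) ->
  (forall x, 0 <= u x) -> (forall x, u x <= u' x) ->
  \int[K]_x u x <= \int[K']_x u' x.
Proof.
move=> KK' u0 uu'; have u'0 x : 0 <= u' x by exact: le_trans (uu' x).
rewrite !ge0_integralTE//; apply: ge_ereal_sup => _ [h /= hu <-].
apply: (le_trans (le_measure_sintegral KK' h)); apply: ereal_sup_ubound.
by exists h => //= x; exact: le_trans (uu' x).
Qed.

Lemma iint_ge0 K n (u : ('I_n -> X) -> \bar R) :
  (forall x, 0 <= u x) -> 0 <= iint K u.
Proof.
elim: n u => [|n IH] u u0; first exact: u0.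
by rewrite iintS; apply: integral_ge0 => x _; exact: IH.
Qed.

Lemma iint_le_measure K K' n (u u' : ('I_n -> X) -> \bar R) :
  (forall A, measurable A -> K A <= K' A) ->
  (forall x, 0 <= u x) -> (forall x, u x <= u' x) -> iint K u <= iint K' u'.
Proof.
move=> KK'; elim: n u u' => [|n IH] u u' u0 uu'; first exact: uu'.
rewrite !iintS; apply: integral_le_measure => // x; first exact: iint_ge0.
by apply: IH.
Qed.

End monotonicity.

Section overlap_bound.
Context d (X : measurableType d) d' (Y : measurableType d') (R : realType).
Variables (k : nat) (f : ('I_k -> X) -> Y) (B : set Y) (Kt : {measure set X -> \bar R}).

Lemma r_t_ge0 : 0 <= r_t f B Kt.
Proof. by rewrite /r_t; case: ifP => // _; exact: bigmax_ge_id. Qed.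

Lemma overlap_int_le_r_t (K : {finite_measure set X -> \bar R}) l :
  (forall A, measurable A -> K A <= Kt A) -> (0 < l < k)%N ->
  overlap_int K (fun x => f x \in B) l <= r_t f B Kt.
Proof.
move=> KK' /andP[l0 lk].
have -> : r_t f B Kt = \big[Order.max/0]_(l < k | (0 < l)%N)
    iint Kt (fun x : 'I_l -> X =>
      let inner := iint Kt (fun y : 'I_(k - l) -> X =>
                     (\1_B (f (catf (ltnW (ltn_ord l)) x y)) : R)%:E) in
      inner * inner).
  by rewrite /r_t ifN// -ltnNge; lia.
apply: le_trans (le_bigmax_cond _ _ (l0 : (0 < Ordinal lk)%N)).
rewrite (overlap_intE K _ (ltnW (ltn_ord (Ordinal lk)))).
have in0 (x : 'I_l -> X) : 0 <= iint K (fun y : 'I_(k - l) -> X =>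
    ((f (catf (ltnW (ltn_ord (Ordinal lk))) x y) \in B)%:R : R)%:E).
  by apply: iint_ge0 => y; rewrite lee_fin.
apply: iint_le_measure => // x /=; first by rewrite mule_ge0.
by apply: lee_pmul => //; apply: iint_le_measure => // y; rewrite lee_fin.
Qed.

Lemma sum_overlap_le_r_t (r : nat -> \bar R) :
  (forall l, (0 < l < k)%N -> r l <= r_t f B Kt) ->
  \sum_(l < k.+1 | (0 < l < k)%N) ('C(k, l)%:R / k`!%:R)%:E * r l <=
  (2 ^+ k / k`!%:R)%:E * r_t f B Kt.
Proof.
move=> rle; have f0 : (0 <= (k`!%:R)^-1 :> R)%R by rewrite invr_ge0.
apply: (@le_trans _ _ (\sum_(l < k.+1 | (0 < l < k)%N)
    ('C(k, l)%:R / k`!%:R)%:E * r_t f B Kt)).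
  apply: lee_sum => l lk; apply: lee_wpmul2l; last exact: rle.
  by rewrite lee_fin divr_ge0.
rewrite -ge0_sume_distrl; last by move=> l _; rewrite lee_fin divr_ge0.
apply: lee_wpmul2r; first exact: r_t_ge0.
rewrite sumEFin lee_fin -mulr_suml ler_wpM2r// -natr_sum -natrX ler_nat.
rewrite -[2%N]/(1 + 1)%N Pascal big_mkcond /=; apply: leq_sum => l _.
by rewrite !exp1n !muln1; case: ifP.
Qed.

End overlap_bound.

(** * Homogeneity in the base measure *)

Section scaling.
Context d (X : measurableType d) (R : realType).
Variables (K K' : {finite_measure set X -> \bar R}) (c : R).
Hypothesis c0 : (0 <= c)%R.
Hypothesis KK' : forall A, measurable A -> K' A = c%:E * K A.

Lemma integral_pmeasure_scale n (u : power X n -> \bar R) :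
  measurable_fun setT u -> (forall x, 0 <= u x) ->
  \int[pmeasure K' n]_x u x = (c ^+ n)%:E * \int[pmeasure K n]_x u x.
Proof.
move=> mu u0; have cn0 : (0 <= c ^+ n)%R by rewrite exprn_ge0.
transitivity (\int[mscale (NngNum cn0) (pmeasure K n)]_x u x); last first.
  by rewrite ge0_integral_mscale.
apply: eq_measure_integral => A mA _; apply: power_measure_unique => //.
  by rewrite ltey_eq fin_num_measure.
move=> E mE; rewrite -[RHS]/((c ^+ n)%:E * pmeasure K n (box E)).
rewrite pmeasure_box//; transitivity (\prod_(i < n) K' (E i)); first exact: pmeasure_box.
rewrite (eq_bigr (fun i => c%:E * K (E i))); last by move=> i _; exact: (KK' (mE i)).
by rewrite big_split /= prodEFin prodr_const card_ord.
Qed.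

(** The [l] outer points are integrated once and the [k - l] inner ones twice, because of the
    square: degree [k + (k - l)] in all. *)
Lemma overlap_int_scale k (a : ('I_k -> X) -> bool) l :
  measurable_fun setT (a : power X k -> bool) -> (l <= k)%N ->
  overlap_int K' a l = (c ^+ (k + (k - l)))%:E * overlap_int K a l.
Proof.
move=> ma hl; rewrite !(overlap_int_integral _ ma hl).
have mi := measurable_inner K ma hl; have i0 := inner_ge0 K a hl.
have E (x : 'I_l -> X) : \int[pmeasure K' (k - l)]_y (((a (catf hl x y))%:R : R)%:E) =
    (c ^+ (k - l))%:E * \int[pmeasure K (k - l)]_y (((a (catf hl x y))%:R : R)%:E).
  by apply: integral_pmeasure_scale; [exact: measurable_catf1|move=> y; rewrite lee_fin].
under eq_integral do rewrite E muleACA.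
have m2 := emeasurable_funM mi mi.
rewrite integral_pmeasure_scale.
- rewrite ge0_integralZl//; last 2 first.
  + by move=> x _; rewrite mule_ge0// i0.
  + by rewrite -EFinM lee_fin mulr_ge0// exprn_ge0.
  rewrite muleA -!EFinM -!exprD; congr ((_ ^+ _)%:E * _); lia.
- exact: measurable_funeM.
- by move=> x; rewrite mule_ge0 ?mule_ge0 ?i0// -?EFinM lee_fin exprn_ge0.
Qed.

End scaling.

(** * Exhausting the space by windows *)

(** The sum is a supremum over finite subsets, and a finite subset of an increasing union lies in
    one of its members. *)
Lemma esum_bigcup_cvg (R : realType) (I : choiceType) (D : nat -> set I)
    (F : I -> \bar R) : (forall n m, (n <= m)%N -> D n `<=` D m) ->
  (forall i, 0 <= F i) ->
  \esum_(i in D n) F i @[n --> \oo] --> \esum_(i in \bigcup_n D n) F i.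
Proof.
move=> ndD F0.
have mono (A A' : set I) : A `<=` A' -> \esum_(i in A) F i <= \esum_(i in A') F i.
  move=> AA'; rewrite esum_mkcond [leRHS]esum_mkcond; apply: le_esum => i _.
  case: ifPn => [/set_mem/AA'/mem_set ->//|_]; by case: ifP.
have nd : nondecreasing_seq (fun n => \esum_(i in D n) F i).
  by move=> n m nm; apply: mono; exact: ndD.
suff -> : \esum_(i in \bigcup_n D n) F i = ereal_sup (range (fun n => \esum_(i in D n) F i)).
  exact: ereal_nondecreasing_cvgn.
apply/eqP; rewrite eq_le; apply/andP; split; last first.
  by apply: ge_ereal_sup => _ [n _ <-]; apply: mono; exact: bigcup_sup.
apply: ge_ereal_sup => _ [A [finA AD] <-].
have [N AN] : exists N, A `<=` D N.
  move/finite_seqP : finA AD => [s ->]; elim: s => [|i s IH] sD.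
    by exists 0%N => i.
  have [N sN] : exists N, [set` s] `<=` D N.
    by apply: IH => j /= js; apply: sD; rewrite /= inE js orbT.
  have [n _ iDn] : (\bigcup_n D n) i by apply: sD; rewrite /= inE eqxx.
  exists (maxn n N) => j /=; rewrite inE => /predU1P[->|js].
    by apply: ndD iDn; exact: leq_maxl.
  by apply: (ndD N); [exact: leq_maxr|exact: sN].
apply: (@le_trans _ _ (\esum_(i in D N) F i)).
  by apply: ereal_sup_ubound; exists A.
by apply: ereal_sup_ubound; exists N.
Qed.

Lemma measurable_esum d (T : measurableType d) (R : realType) (I : countType)
    (D : T -> I -> bool) (F : I -> T -> \bar R) :
  (forall i, measurable_fun setT (fun w => D w i)) ->
  (forall i, measurable_fun setT (F i)) -> (forall i w, 0 <= F i w) ->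
  measurable_fun setT (fun w => \esum_(i in [set i | D w i]) F i w).
Proof.
move=> mD mF F0.
have E w : \esum_(i in [set i | D w i]) F i w =
    \sum_(n <oo) (if @pickle_inv I n is Some i then (D w i)%:R%:E * F i w else 0).
  rewrite esum_mkcond.
  rewrite (eq_esum (b := fun i => (D w i)%:R%:E * F i w)); last first.
    move=> i _; rewrite (_ : (i \in _) = D w i); first by case: (D w i); rewrite ?mul1e ?mul0e.
    by apply/idP/idP => [/set_mem|/mem_set].
  (* An empty [I] has no element to serve as default in the reindexing along [pickle_inv]. *)
  have [i0|noI] := pselect (exists i : I, True); last first.
    rewrite esum1; last by move=> i; exfalso; apply: noI; exists i.
    rewrite eseries0// => n _ _; case: (@pickle_inv I n) => // i.
    by exfalso; apply: noI; exists i.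
  move: i0 => [i0 _].
  rewrite (@reindex_esum _ _ _ [set n | @pickle_inv I n != None] _
     (fun n => odflt i0 (@pickle_inv I n))); last first.
    split => //.
    - move=> n m; rewrite !inE /= => Pn Pm.
      case En : (@pickle_inv I n) Pn => [i|]//= _; case Em : (@pickle_inv I m) Pm => [j|]//= _ ij.
      have := @pickle_invK I n; have := @pickle_invK I m.
      by rewrite En Em /= ij => <- <-.
    - by move=> i _; exists (pickle i); rewrite /= pickleK_inv.
  rewrite esum_mkcond -nneseries_esumT; last first.
    by move=> n; case: ifP => // _; rewrite mule_ge0 ?lee_fin.
  apply: eq_eseriesr => n _.
  case En : (@pickle_inv I n) => [i|] /=.
    by rewrite mem_set//= En.
  by rewrite memNset//= En.
under eq_fun do rewrite E.
apply: ge0_emeasurable_sum => [n w _ _|n _].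
  by case: pickle_inv => // i; rewrite mule_ge0 ?lee_fin.
case: pickle_inv => [i|]; last exact: measurable_cst.
by apply: emeasurable_funM => //; exact: measurable_ind.
Qed.

Lemma measurable_lip (R : realType) (h : R -> R) : lip1 h ->
  measurable_fun setT h.
Proof.
move=> hlip; apply: continuous_measurable_fun => x.
apply/cvgrPdist_le => /= e e0; near=> y.
apply: (le_trans (hlip x y)); near: y.
exact: cvgr_dist_le.
Unshelve. all: by end_near. Qed.

(** * Poisson approximation for a Poisson process, by monotone limits *)

Section poisson_case.
Context d (X : measurableType d) (R : realType).
Context dO (Om : measurableType dO) (P : probability Om R).
Variables (kappa : Om -> \bar R) (pt : nat -> Om -> X).
Variable Kt : {measure set X -> \bar R}.
Hypothesis mkappa : measurable_fun setT kappa.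
Hypothesis mpt : forall i, measurable_fun setT (pt i).
Hypothesis count_law : forall (m : nat) (A : 'I_m -> set X) (n : 'I_m -> nat),
  (forall j, measurable (A j)) -> (forall j, Kt (A j) < +oo) ->
  (forall j j', j != j' -> A j `&` A j' = set0) ->
  P [set w | forall j, Defs.counting kappa pt w (A j) = ((n j)%:R)%:E]
  = \prod_(j < m) (poisson_pmf' (fine (Kt (A j))) (n j))%:E.
Variables (k : nat) (a : ('I_k -> X) -> bool).
Hypothesis asym : forall (s : {perm 'I_k}) x, a (x \o s) = a x.
Hypothesis ma : measurable_fun setT (a : power X k -> bool).
Hypothesis k0 : (0 < k)%N.

Local Notation ind b := (((b : bool)%:R : R)%:E).

(** [S_stat] restricted to tuples of points in [W]. Unlike [window_count] it is monotone in [W] for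
    every [w]; the two agree almost surely when [W] has finite mass. *)
Definition tuple_sum (W : set X) (w : Om) : \bar R :=
  (k`!%:R^-1)%:E * \esum_(i in [set i : {ffun 'I_k -> nat} |
    injectiveb i && [forall j, active kappa pt W w (i j)]])
    ind (a (fun j => pt (i j) w)).

Let f0 : (0 <= (k`!%:R)^-1 :> R)%R.
Proof. by rewrite invr_ge0. Qed.

Lemma tuple_sum_ge0 W w : 0 <= tuple_sum W w.
Proof. by rewrite mule_ge0 ?lee_fin//; apply: esum_ge0 => i _; rewrite lee_fin. Qed.

Let m_all (I : finType) (b : I -> Om -> bool) :
  (forall i, measurable_fun setT (b i)) ->
  measurable_fun setT (fun w => [forall i, b i w]).
Proof.
move=> mb; rewrite (_ : (fun w => _) = (fun w => (\sum_i ~~ b i w)%N == 0%N)).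
  apply: measurable_fun_eqn; last exact: measurable_cst.
  apply: measurable_sumn => i.
  exact: (@measurableT_comp _ _ _ _ _ _ (fun c : bool => nat_of_bool (~~ c)) setT _ _ (mb i)).
apply/funext => w; rewrite sum_nat_eq0; apply/forallP/forallP => H i.
  by rewrite (H i).
by have := H i; case: (b i w).
Qed.

Lemma measurable_tuple_sum W : measurable W -> measurable_fun setT (tuple_sum W).
Proof.
move=> mW; apply: measurable_funeM; apply: measurable_esum => [i|i|i w].
- apply: measurable_and; first exact: measurable_cst.
  by apply: m_all => j; exact: measurable_active.
- apply: measurable_ind; apply: (measurableT_comp ma).
  by apply: measurable_fun_power => j; exact: mpt.
- by rewrite lee_fin.
Qed.

Section one_window.
Variable W : set X.
Hypothesis mW : measurable W.
Hypothesis KW : Kt W < +oo.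
Let K : {finite_measure set X -> \bar R} := mfrestr mW KW.
Let M := fine (Kt W).
Let T := window_count kappa pt W a.

Lemma tuple_sum_window n w : window_size kappa pt W n w ->
  tuple_sum W w = (T w)%:R%:E.
Proof.
move=> wn; have [ie qe] := window_enum wn.
rewrite /T (window_countE a wn) /tuple_sum.
have -> : [set i : {ffun 'I_k -> nat} | injectiveb i &&
      [forall j, active kappa pt W w (i j)]] =
    [set i : {ffun 'I_k -> nat} | injective i /\ forall j, active kappa pt W w (i j)].
  apply/seteqP; split => i /=.
    by move=> /andP[/injectiveP ? /forallP ?].
  by move=> [/injectiveP -> /forallP ->].
rewrite (esum_inj_ffun ie qe); last by move=> i; rewrite lee_fin.
rewrite sumEFin -natr_sum -EFinM; congr EFin.
rewrite (eq_bigr (fun j : {ffun 'I_k -> 'I_n} =>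
    nat_of_bool (a (@window_points _ _ _ _ _ kappa pt W n w \o j)))); last first.
  move=> j _; congr (nat_of_bool (a _)); apply/funext => v.
  by rewrite ffunE.
by rewrite -/(inj_cnt a _) set_cntE// natrM mulrC mulfK// pnatr_eq0 -lt0n fact_gt0.
Qed.

Let mT : measurable_fun setT T.
Proof. exact: measurable_window_count. Qed.

Let ae_T : {ae P, forall w, setT w -> tuple_sum W w = (T w)%:R%:E}.
Proof.
have m_ws n : measurable (window_size kappa pt W n) by exact: measurable_counting_eq.
exists (~` \bigcup_n window_size kappa pt W n); split.
- by apply: measurableC; exact: bigcupT_measurable.
- have H := @window_size_total _ _ _ _ _ P kappa pt Kt mkappa mpt W mW KW count_law.
  exact: H.
move=> w /= H [n _ wn]; apply: H => _.
exact: tuple_sum_window wn.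
Qed.

Let ge0_intT (g : \bar R -> \bar R) : (forall x, 0 <= x -> 0 <= g x) ->
  measurable_fun setT g ->
  \int[P]_w g (tuple_sum W w) = \int[P]_w g (T w)%:R%:E.
Proof.
move=> g0 mg; apply: ge0_ae_eq_integral => //.
- exact: (measurableT_comp mg (measurable_tuple_sum mW)).
- exact: (measurable_nat_fun (fun i => g i%:R%:E) mT).
- by move=> w _; apply: g0; exact: tuple_sum_ge0.
- by move=> w _; apply: g0; rewrite lee_fin.
by case: ae_T => N [mN PN HN]; exists N; split => // w /= H; apply: HN => /= E; apply: H => _; rewrite E.
Qed.

Let law (G : nat -> \bar R) (G0 : forall i, 0 <= G i) :=
  window_count_law mkappa mpt mW KW count_law ma G0.

(** The moments are delivered as reals, so that the bound can be passed to the limit with ordinary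
    subtraction. *)
Lemma window_bounds : \int[P]_w (tuple_sum W w * tuple_sum W w) < +oo ->
  exists e s : R, [/\ \int[P]_w tuple_sum W w = e%:E,
    \int[P]_w (tuple_sum W w * tuple_sum W w) = s%:E,
    forall lam h, (0 <= lam)%R -> lip1 h ->
     `|\int[P]_w (h (fine (tuple_sum W w)))%:E - \int[poisson_prob lam 0%N]_n (h n%:R)%:E|
       <= (`|e - lam| + 2 * (s - e - e * e))%:E &
    (s - e - e * e)%:E <= \sum_(l < k.+1 | (0 < l < k)%N)
      ('C(k, l)%:R / k`!%:R)%:E * overlap_int K a l].
Proof.
have M0 : (0 <= M)%R by exact: fine_ge0.
have KM : K setT = M%:E.
  by rewrite /K /= /mfrestr /mrestr setTI fineK// ge0_fin_numE.
have mid : measurable_fun setT (fun x : \bar R => x) by exact: measurable_id.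
rewrite (ge0_intT (g := fun x => x * x)); last 2 first.
- by move=> x x0; rewrite mule_ge0.
- exact: emeasurable_funM.
rewrite (ge0_intT (g := fun x => x))//.
have mean := window_mean asym ma law.
have sqr := window_sqr asym ma k0 law.
have E0 : 0 <= \int[P]_w (T w)%:R%:E by apply: integral_ge0 => w _; rewrite lee_fin.
have mTR : measurable_fun setT (fun w => (T w)%:R%:E : \bar R).
  exact: (measurable_nat_fun (fun i => i%:R%:E) mT).
have mTT : measurable_fun setT (fun w => ((T w)%:R * (T w)%:R)%:E : \bar R).
  exact: (measurable_nat_fun (fun i => (i%:R * i%:R)%:E) mT).
rewrite (eq_integral (fun w => ((T w)%:R * (T w)%:R)%:E))// => Eoo.
have Efin : \int[P]_w (T w)%:R%:E \is a fin_num.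
  rewrite ge0_fin_numE//; apply: le_lt_trans Eoo; apply: ge0_le_integral => //.
  by move=> w _; rewrite lee_fin -natrM ler_nat; nia.
have Sfin : \int[P]_w ((T w)%:R * (T w)%:R)%:E \is a fin_num.
  rewrite ge0_fin_numE//; apply: integral_ge0 => w _.
  by rewrite lee_fin mulr_ge0.
pose e := fine (\int[P]_w (T w)%:R%:E).
pose s := fine (\int[P]_w ((T w)%:R * (T w)%:R)%:E).
have eE : \int[P]_w (T w)%:R%:E = e%:E by rewrite fineK.
have sE : \int[P]_w ((T w)%:R * (T w)%:R)%:E = s%:E by rewrite fineK.
have muE : (k`!%:R^-1)%:E * \int[pmeasure K k]_x ind (a x) = e%:E by rewrite -eE mean.
(* A finite second moment makes the excess finite, and [window_sqr] can be solved for it. *)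
have VE : window_excess K M a = (s - e - e * e)%:E.
  move: sqr; rewrite muE sE.
  have -> : \int[P]_u ((T u).+1%:R)%:E = (e + 1)%:E.
    rewrite (eq_integral (fun u => (T u)%:R%:E + 1%:E)); last first.
      by move=> u _; rewrite -EFinD natr1.
    rewrite ge0_integralD//.
    by rewrite eE integral_cst// mul1e [X in _ + X](probability_setT P).
  move=> H; have Vfin : window_excess K M a \is a fin_num.
    rewrite ge0_fin_numE; last exact: window_excess_ge0.
    apply: (@le_lt_trans _ _ s%:E); last exact: ltry.
    have e0 : (0 <= e)%R by exact: fine_ge0.
    by rewrite H leeDl// -EFinM lee_fin mulr_ge0// addr_ge0.
  move: H; rewrite -(fineK Vfin) -EFinM -EFinD => -[->]; congr EFin; ring.
exists e, s; split => //; last first.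
  rewrite -VE; exact: window_excess_le.
move=> lam h lam0 hlip.
have -> : \int[P]_w (h (fine (tuple_sum W w)))%:E = \int[P]_w (h (T w)%:R)%:E.
  apply: ae_eq_integral => //.
  - apply/measurable_EFinP; apply: (measurableT_comp (measurable_lip hlip)).
    exact: (measurableT_comp (fine_measurable measurableT) (measurable_tuple_sum mW)).
  - exact: (measurable_nat_fun (fun i => (h i%:R)%:E) mT).
  case: ae_T => N [mN PN HN]; exists N; split => // w /= H; apply: HN => /= E.
  by apply: H => _; rewrite E.
have V0 : (0 <= s - e - e * e)%R.
  by rewrite -lee_fin -VE; exact: window_excess_ge0.
apply: stein_method => //; first by rewrite mulr_ge0.
move=> G G02; have := window_stein asym ma k0 law G02.
by rewrite VE muE -EFinM.
Qed.

End one_window.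

Variable F : nat -> set X.
Hypothesis ndF : forall n m, (n <= m)%N -> F n `<=` F m.
Hypothesis mF : forall n, measurable (F n).
Hypothesis KF : forall n, Kt (F n) < +oo.
Hypothesis FT : \bigcup_n F n = setT.

Let S := tuple_sum setT.
Let Sn n := tuple_sum (F n).

Let Sn_nd w n m : (n <= m)%N -> Sn n w <= Sn m w.
Proof.
move=> nm; apply: lee_wpmul2l; first by rewrite lee_fin.
rewrite esum_mkcond [leRHS]esum_mkcond; apply: le_esum => i _.
case: ifPn => [/set_mem/= /andP[ii /forallP H]|_]; last by case: ifP; rewrite // lee_fin.
rewrite ifT//; apply: mem_set => /=; rewrite ii; apply/forallP => j.
by have /andP[? /set_mem Fj] := H j; apply/andP; split => //; apply: mem_set; exact: ndF Fj.
Qed.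

Let Sn_cvg w : Sn n w @[n --> \oo] --> S w.
Proof.
pose D n := [set i : {ffun 'I_k -> nat} |
  injectiveb i && [forall j, active kappa pt (F n) w (i j)]].
apply: cvgeZl => //.
have -> : [set i : {ffun 'I_k -> nat} | injectiveb i &&
    [forall j, active kappa pt setT w (i j)]] = \bigcup_n D n.
  apply/seteqP; split => i /=; last first.
    move=> [n _ /= /andP[-> /forallP H]]; apply/forallP => j.
    by have /andP[? _] := H j; apply/andP; split => //; exact: mem_set.
  move=> /andP[ii /forallP H].
  have E j : exists n, F n (pt (i j) w).
    have : (\bigcup_n F n) (pt (i j) w) by rewrite FT.
    by move=> [n _ ?]; exists n.
  exists (\max_j projT1 (cid (E j))) => //; apply/andP; split => //; apply/forallP => j.
  have /andP[? _] := H j; apply/andP; split => //; apply: mem_set.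
  by case: (cid (E j)) (leq_bigmax (F := fun j => projT1 (cid (E j))) j) => n /= Fn nm; exact: ndF nm _ Fn.
apply: esum_bigcup_cvg => [n m nm i /= /andP[-> /forallP H]|i]; last by rewrite lee_fin.
apply/forallP => j; have /andP[? /set_mem Fj] := H j; apply/andP; split => //.
by apply: mem_set; exact: ndF Fj.
Qed.

Let S_ge w n : Sn n w <= S w.
Proof.
rewrite -(cvg_lim _ (@Sn_cvg w))//; apply: lime_ge.
  by apply/cvg_ex; exists (S w); exact: Sn_cvg.
by near=> m; apply: Sn_nd; near: m; exact: nbhs_infty_ge.
Unshelve. all: by end_near. Qed.

(** For 1-Lipschitz [h], [|h(S) - h(Sn)| <= S - Sn] integrates to [e - en], which tends to 0 by
    monotone convergence. The bound [r] is asked for all finite measures below [Kt], among them the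
    restrictions of [Kt] to the windows. *)
Lemma poisson_limit : \int[P]_w (S w * S w) < +oo ->
  exists e s : R, [/\ \int[P]_w S w = e%:E,
    \int[P]_w (S w * S w) = s%:E,
    forall lam h, (0 <= lam)%R -> lip1 h ->
     `|\int[P]_w (h (fine (S w)))%:E - \int[poisson_prob lam 0%N]_n (h n%:R)%:E|
       <= (`|e - lam| + 2 * (s - e - e * e))%:E &
    forall r : \bar R, (forall K : {finite_measure set X -> \bar R},
      (forall A, measurable A -> K A <= Kt A) ->
      \sum_(l < k.+1 | (0 < l < k)%N)
        ('C(k, l)%:R / k`!%:R)%:E * overlap_int K a l <= r) ->
      (s - e - e * e)%:E <= r].
Proof.
move=> S2oo.
have S0 w : 0 <= S w := tuple_sum_ge0 _ w.
have Sn0 n w : 0 <= Sn n w := tuple_sum_ge0 _ w.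
have mS : measurable_fun setT S by exact: measurable_tuple_sum.
have mSn n : measurable_fun setT (Sn n) by exact: measurable_tuple_sum.
have mS2 := emeasurable_funM mS mS.
have mSn2 n := emeasurable_funM (mSn n) (mSn n).
have Sn2_le n w : Sn n w * Sn n w <= S w * S w by exact: lee_pmul.
have Sn2oo n : \int[P]_w (Sn n w * Sn n w) < +oo.
  apply: le_lt_trans S2oo; apply: ge0_le_integral => // w _.
  by rewrite mule_ge0.
have /choice[eK H] : forall n, exists eK : R * R,
   [/\ \int[P]_w Sn n w = eK.1%:E, \int[P]_w (Sn n w * Sn n w) = eK.2%:E,
    forall lam h, (0 <= lam)%R -> lip1 h ->
     `|\int[P]_w (h (fine (Sn n w)))%:E - \int[poisson_prob lam 0%N]_n (h n%:R)%:E|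
       <= (`|eK.1 - lam| + 2 * (eK.2 - eK.1 - eK.1 * eK.1))%:E &
    (eK.2 - eK.1 - eK.1 * eK.1)%:E <= \sum_(l < k.+1 | (0 < l < k)%N)
      ('C(k, l)%:R / k`!%:R)%:E * overlap_int (mfrestr (mF n) (KF n)) a l].
  move=> n; have [e [s He]] := window_bounds (mF n) (KF n) (Sn2oo n).
  by exists (e, s).
pose en n := (eK n).1; pose sn n := (eK n).2.
have c1 : \int[P]_w Sn n w @[n --> \oo] --> \int[P]_w S w.
  rewrite (eq_integral (fun w => limn (Sn ^~ w))); last first.
    by move=> w _; apply/esym/cvg_lim => //; exact: Sn_cvg.
  apply: cvg_monotone_convergence => //.
  by move=> w _ n m nm; exact: Sn_nd.
have c2 : \int[P]_w (Sn n w * Sn n w) @[n --> \oo] --> \int[P]_w (S w * S w).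
  rewrite (eq_integral (fun w => limn (fun n => Sn n w * Sn n w))); last first.
    move=> w _; apply/esym/cvg_lim => //; apply: cvgeM; try exact: Sn_cvg.
    (* Both factors have the same limit, so the product of 0 and infinity cannot occur. *)
    by rewrite /mule_def; case: (S w) => [r| |] //=; rewrite !andbF.
  apply: cvg_monotone_convergence => //.
    by move=> n w _; rewrite mule_ge0.
  by move=> w _ n m nm; apply: lee_pmul => //; exact: Sn_nd.
have S2fin : \int[P]_w (S w * S w) \is a fin_num.
  by rewrite ge0_fin_numE//; apply: integral_ge0 => w _; rewrite mule_ge0.
have en0 n : (0 <= en n)%R.
  by have [E _ _ _] := H n; rewrite -lee_fin -E; apply: integral_ge0 => w _; exact: Sn0.
(* Over the whole space [S] is compared with [1 + S * S], which bounds any nonnegative extended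
   real. *)
have Sfin : \int[P]_w S w \is a fin_num.
  rewrite ge0_fin_numE; last by apply: integral_ge0 => w _; exact: S0.
  apply: (@le_lt_trans _ _ (1 + \int[P]_w (S w * S w))); last first.
    by rewrite lte_add_pinfty// ltry.
  have P1 : \int[P]_w (1 : \bar R) = 1.
    by rewrite integral_cst// mul1e; exact: probability_setT.
  apply: (@le_trans _ _ (\int[P]_w (1 + S w * S w))); last first.
    rewrite ge0_integralD//; first by rewrite P1.
    by move=> w _; rewrite mule_ge0.
  apply: ge0_le_integral => //; first exact: emeasurable_funD.
  move=> w _; case: (S w) (S0 w) => [r r0|_|//]; last by rewrite mulyy addey.
  rewrite -EFinM -EFinD lee_fin; nra.
pose e := fine (\int[P]_w S w); pose s := fine (\int[P]_w (S w * S w)).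
have eE : \int[P]_w S w = e%:E by rewrite fineK.
have sE : \int[P]_w (S w * S w) = s%:E by rewrite fineK.
have en_cvg : en n @[n --> \oo] --> e.
  have c : (en n)%:E @[n --> \oo] --> e%:E.
    rewrite -eE (_ : (fun n => (en n)%:E) = fun n => \int[P]_w Sn n w)//.
    by apply/funext => n; have [-> _ _ _] := H n.
  exact: (fine_cvg c).
have sn_cvg : sn n @[n --> \oo] --> s.
  have c : (sn n)%:E @[n --> \oo] --> s%:E.
    rewrite -sE (_ : (fun n => (sn n)%:E) = fun n => \int[P]_w (Sn n w * Sn n w))//.
    by apply/funext => n; have [_ -> _ _] := H n.
  exact: (fine_cvg c).
have vn_cvg : (sn n - en n - en n * en n)%R @[n --> \oo] --> (s - e - e * e)%R.
  by apply: cvgB; [exact: cvgB|exact: cvgM].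
exists e, s; split => //; last first.
  move=> r Hr; have : (sn n - en n - en n * en n)%:E @[n --> \oo] --> (s - e - e * e)%:E.
    by apply/fine_cvgP; split; first exact: nearW.
  move=> cv; rewrite -(cvg_lim _ cv)//; apply: lime_le.
    by apply/cvg_ex; eexists; exact: cv.
  apply: nearW => n; have [_ _ _ le] := H n; apply: (le_trans le); apply: Hr => A mA.
  by rewrite /= /mfrestr /mrestr; apply: le_measure; rewrite ?inE//; exact: measurableI.
move=> lam h lam0 hlip.
have mh := measurable_lip hlip.
have mfS : measurable_fun setT (fun w => fine (S w)).
  exact: (measurableT_comp (fine_measurable measurableT) mS).
have mfSn n : measurable_fun setT (fun w => fine (Sn n w)).
  exact: (measurableT_comp (fine_measurable measurableT) (mSn n)).
have intS : P.-integrable setT S.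
  apply/integrableP; split => //.
  rewrite (eq_integral S); first by rewrite eE ltry.
  by move=> w _; rewrite gee0_abs.
(* [fine] sends infinity to 0, so the Lipschitz comparison of [S] with [Sn] is valid only where [S]
   is finite. *)
have aeS : {ae P, forall w, setT w -> S w \is a fin_num} := integrable_ae measurableT intS.
have int_lip (V : Om -> \bar R) (I : R) : measurable_fun setT V -> (forall w, 0 <= V w) ->
    \int[P]_w V w = I%:E -> P.-integrable setT (EFin \o (fun w => h (fine (V w)))).
  move=> mV V0 VI.
  have iV : P.-integrable setT (fun w => `|h 0|%:E + V w).
    apply: integrableD => //; first exact: finite_measure_integrable_cst.
    apply/integrableP; split => //; rewrite (eq_integral V) ?VI ?ltry// => w _.
    by rewrite gee0_abs.
  apply: (le_integrable _ _ _ iV) => //.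
    apply/measurable_EFinP; apply: (measurableT_comp mh).
    exact: (measurableT_comp (fine_measurable measurableT) mV).
  move=> w _ /=; rewrite [leRHS]gee0_abs; last by rewrite adde_ge0.
  case: (V w) (V0 w) => [r r0|_|//]; last by rewrite addey// leey.
  rewrite /= -EFinD lee_fin; have := hlip r 0%R.
  rewrite subr0 (ger0_norm (_ : 0 <= r)%R)// => hr.
  by rewrite -[h r](subrK (h 0%R)) (le_trans (ler_normD _ _))// addrC lerD2l.
have i1 := int_lip S e mS S0 eE.
have i2 n : P.-integrable setT (EFin \o (fun w => h (fine (Sn n w)))).
  by have [E _ _ _] := H n; exact: (int_lip _ _ (mSn n) (Sn0 n) E).
have step n : (`|\int[P]_w (h (fine (S w)))%:E - \int[P]_w (h (fine (Sn n w)))%:E|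
    <= (e - en n)%:E).
  have i12 := integrableB measurableT i1 (i2 n).
  rewrite -integralB//; last exact: (i2 n).
  apply: (le_trans (le_abse_integral _ measurableT (measurable_int _ i12))).
  rewrite EFinB leeBrDr//; have [E _ _ _] := H n.
  rewrite -eE -E -ge0_integralD//; last exact: (measurableT_comp _ (measurable_int _ i12)).
  apply: ae_ge0_le_integral => //.
  - by move=> w _; rewrite adde_ge0.
  - apply: emeasurable_funD => //.
    exact: (measurableT_comp _ (measurable_int _ i12)).
  case: aeS => N [mN PN HN]; exists N; split => // w /= Hw; apply: HN => /= fS.
  apply: Hw => _; have := fS I; have := S_ge w n.
  have := Sn0 n w; have := S0 w.
  case: (S w) => [r| |]//; case: (Sn n w) => [r'| |]// r0 r'0 r'r _ /=.
  have := hlip r r'; rewrite !lee_fin in r0 r'0 r'r *.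
  by rewrite (ger0_norm (_ : 0 <= r - r')%R) ?subr_ge0// lerBrDr.
have f1 : \int[P]_w (h (fine (S w)))%:E \is a fin_num.
  exact: (integrable_fin_num measurableT i1).
have f2 : forall n, \int[P]_w (h (fine (Sn n w)))%:E \is a fin_num.
  by move=> n; exact: (integrable_fin_num measurableT (i2 n)).
rewrite -(fineK f1) -(fineK (poisson_lip_fin_num lam0 hlip)) -EFinB lee_fin.
set q := fine (\int[poisson_prob lam 0%N]_n (h n%:R)%:E).
set u := fine (\int[P]_w (h (fine (S w)))%:E).
(* Truncation error plus window bound: it dominates the fixed number [|u - q|] for every [n], and
   its limit is the claimed bound. *)
pose b n := (e - en n + (`|en n - lam| + 2 * (sn n - en n - en n * en n)))%R.
have ub n : (`|u - q| <= b n)%R.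
  have := step n; have [_ _ /(_ lam h lam0 hlip) + _] := H n.
  rewrite -(fineK f1) -(fineK (f2 n)) -(fineK (poisson_lip_fin_num lam0 hlip)).
  rewrite -!EFinB !lee_fin -/u -/q => le1 le2.
  by apply: (le_trans (ler_distD _ _ _)); exact: (lerD le2 le1).
have b_cvg : b n @[n --> \oo] --> (e - e + (`|e - lam| + 2 * (s - e - e * e)))%R.
  apply: cvgD; first by apply: cvgB; [exact: cvg_cst|].
  apply: cvgD; last by apply: cvgM; [exact: cvg_cst|].
  by apply: cvg_norm; apply: cvgB; [|exact: cvg_cst].
have -> : (`|e - lam| + 2 * (s - e - e * e) = limn b)%R.
  by rewrite (cvg_lim _ b_cvg)// subrr add0r.
by apply: limr_ge; [apply/cvg_ex; eexists; exact: b_cvg|exact: nearW].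
Qed.

End poisson_case.

(** * Binomial moments *)

Lemma leq_ffact n m k : (n <= m)%N -> (n ^_ k <= m ^_ k)%N.
Proof.
elim: k n m => [|k IH] n m nm; first by rewrite !ffactn0.
by rewrite !ffactnS leq_mul// IH//; lia.
Qed.

Lemma ffact_le_exp n k : (n ^_ k <= n ^ k)%N.
Proof.
elim: k n => [|k IH] n; first by rewrite ffactn0.
rewrite ffactnS expnS leq_mul2l (leq_trans (IH _)) ?orbT//.
by case: k {IH} => [//|k]; rewrite leq_exp2r//; lia.
Qed.

(** The discrete derivative of the falling factorial. *)
Lemma ffact_pascal n k : (n.+1 ^_ k.+1 = n ^_ k.+1 + k.+1 * n ^_ k)%N.
Proof.
rewrite ffactSS ffactnSr; have [kn|nk] := leqP k n.
  by rewrite [(_ * (n - k))%N]mulnC -mulnDl; congr (_ * _)%N; lia.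
by rewrite ffact_small// !muln0 mul0n.
Qed.

(* An injection of [k] into [n] that meets a given set of size p sends one of k
   indices to one of p points. *)
Lemma ffact_subn_le n k p : (0 < k)%N ->
  (n * n ^_ k <= n * (n - p) ^_ k + k * p * n ^_ k)%N.
Proof.
case: k => // k _.
have [->|n0] := posnP n; first by rewrite mul0n.
elim: p => [|p IH]; first by rewrite subn0 muln0 mul0n addn0.
apply: (leq_trans IH).
suff : (n * (n - p) ^_ k.+1 <= n * (n - p.+1) ^_ k.+1 + k.+1 * n ^_ k.+1)%N by nia.
have [pn|np] := ltnP p n; last by rewrite (_ : (n - p = 0)%N) ?ffact0n ?muln0//; lia.
have -> : (n - p = (n - p.+1).+1)%N by lia.
rewrite ffact_pascal mulnDr leq_add2l mulnCA leq_mul2l /=.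
rewrite ffactnS leq_mul2l; apply/orP; right; apply: leq_ffact; lia.
Qed.

Lemma double_sqr_le_exp6 k : (2 * (k * k) <= 6 ^ k)%N.
Proof. elim: k => [//|[//|k] IH]; rewrite expnS; nia. Qed.

(** Absorbs the cost of replacing T' by T into the last error term: [ffact_subn_le] with [p = k]
    gives [n * (1 - c) <= k * k], and [t <= n]. The constant [6 ^ k] only has to dominate
    [2 * (k * k)]. *)
Lemma ffact_ratio_le (R : realType) n k (t : R) : (0 < k)%N -> (0 < t <= n%:R)%R ->
  (2 * (1 - ((n - k) ^_ k)%:R / (n ^_ k)%:R) <= 6 ^+ k * k`!%:R / t)%R.
Proof.
move=> k0 /andP[t0 tn].
have n0 : (0 < n%:R :> R)%R by exact: lt_le_trans tn.
have k6 : (2 * (k%:R * k%:R) <= 6 ^+ k * k`!%:R :> R)%R.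
  have := double_sqr_le_exp6 k; have := fact_gt0 k => f0 k6.
  have : (2 * (k * k) <= 6 ^ k * k`!)%N by rewrite (leq_trans k6)// leq_pmulr.
  by rewrite -(ler_nat R) !natrM natrX.
rewrite ler_pdivlMr//; apply: (le_trans _ k6).
rewrite -mulrA ler_wpM2l//.
(* For [n < k] the denominator vanishes and the ratio is 0, in accordance with the convention; then
   [t <= n < k] suffices. *)
have [nk|kn] := ltnP n k.
  rewrite (ffact_small nk) invr0 mulr0 subr0 mul1r (le_trans tn)// -natrM ler_nat; nia.
have f0 : (0 < (n ^_ k)%:R :> R)%R by rewrite ltr0n ffact_gt0.
set c := (_ / _)%R.
have cE : (((n - k) ^_ k)%:R = c * (n ^_ k)%:R)%R by rewrite divfK// lt0r_neq0.
have := ffact_subn_le n k k0; rewrite -(ler_nat R) natrD !natrM cE => H.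
have {}H : (n%:R * (1 - c) <= k%:R * k%:R)%R.
  by rewrite -(ler_pM2r f0); lra.
have [c1|c1] := lerP c 1%R; last first.
  by apply: (@le_trans _ _ 0%R); rewrite ?mulr_ge0// nmulr_rle0 ?ltW// subr_lt0.
by apply: le_trans H; rewrite mulrC ler_wpM2r// subr_ge0.
Qed.

Section binomial_moments.
Context d (X : measurableType d) (R : realType).
Context dO (Om : measurableType dO) (P : probability Om R).
Variable K : {finite_measure set X -> \bar R}.
Hypothesis K1 : K setT = 1.
Variables (k : nat) (a : ('I_k -> X) -> bool).
Hypothesis asym : forall (s : {perm 'I_k}) x, a (x \o s) = a x.
Hypothesis ma : measurable_fun setT (a : power X k -> bool).
Hypothesis k0 : (0 < k)%N.

Local Notation "K ^^ n" := (pmeasure K n) (at level 30).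
Local Notation ind b := (((b : bool)%:R : R)%:E).

Let Kn1 n : (K ^^ n) setT = 1.
Proof.
rewrite (_ : setT = box (fun=> setT)); last by apply/seteqP; split => // x _ i.
transitivity (\prod_(i < n) K setT); first exact: pmeasure_box.
by rewrite big1.
Qed.

Let alpha := \int[K ^^ k]_x ind (a x).

Let alpha_ge0 : 0 <= alpha.
Proof. by apply: integral_ge0 => x _; rewrite lee_fin. Qed.

Let alphaE : alpha = (fine alpha)%:E.
Proof.
rewrite fineK// ge0_fin_numE//; apply: (@le_lt_trans _ _ (\int[K ^^ k]_x 1)).
  apply: ge0_le_integral => //; first exact: measurable_ind.
  by move=> x _; rewrite lee_fin lern1 leq_b1.
by rewrite integral_cst// mul1e [ltLHS]Kn1 ltry.
Qed.

Lemma integral_set_cnt_prob n :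
  \int[K ^^ n]_x (set_cnt a x)%:R%:E = 'C(n, k)%:R%:E * alpha.
Proof.
have [nk|kn] := ltnP n k.
  rewrite bin_small// mul0e; apply: integral0_eq => x _.
  by rewrite /set_cnt inj_cnt_small// div0n.
rewrite -(subnKC kn); move: (n - k)%N => m.
rewrite (eq_integral (fun x : power X (k + m) => ((set_cnt a x)%:R * 1)%:E)); last first.
  by move=> x _; rewrite mulr1.
rewrite (integral_set_cnt K asym ma m (G := fun=> 1%R))//; congr (_ * _).
rewrite (integral_head_tail K ma m (G := fun=> 1))//.
by rewrite integral_cst// mul1e [X in _ * X]Kn1 mule1.
Qed.

Variables (m : nat) (T : Om -> nat).
Hypothesis mT : measurable_fun setT T.
Hypothesis lawT : forall (G : nat -> \bar R), (forall i, 0 <= G i) ->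
  \int[P]_u G (T u) = \int[K ^^ (k + m)]_x G (set_cnt a x).

Let C := ('C(k + m, k)%:R : R).
Let mu : R := (C * fine alpha)%R.

Let mu_ge0 : (0 <= mu)%R.
Proof. by rewrite mulr_ge0// fine_ge0. Qed.

Let mean : \int[P]_u (T u)%:R%:E = mu%:E.
Proof.
rewrite (lawT (G := fun i => i%:R%:E)); last by move=> i; rewrite lee_fin.
by rewrite integral_set_cnt_prob alphaE.
Qed.

Let eps := excess_int K a m.

Let eps_ge0 : 0 <= eps.
Proof. by apply: integral_ge0 => x _; rewrite mule_ge0// lee_fin. Qed.

Let epsE : eps = (fine eps)%:E.
Proof.
rewrite fineK// ge0_fin_numE//.
apply: (@le_lt_trans _ _ (\int[K ^^ (k + m)]_x ((k + m) ^_ k)%:R%:E)).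
  apply: ge0_le_integral => //.
  - exact: measurable_excess.
  - move=> x _; rewrite -EFinM -natrM lee_fin ler_nat.
    apply: leq_trans (inj_cnt_le a x).
    rewrite -[leqRHS]mul1n leq_mul ?leq_b1// /excess.
    by rewrite (leq_trans (leq_subr _ _))// /set_cnt leq_div.
by rewrite integral_cst// [X in _ * X]Kn1 mule1 ltry.
Qed.

Let V : R := (C * fine eps)%R.
(** The mean number of hits among [m] points; it equals [c * mu], which is where the correction
    factor [c] comes from. *)
Let mum : R := ('C(m, k)%:R * fine alpha)%R.
Let I p (G : nat -> R) := \int[K ^^ p]_x (G (set_cnt a x).+1)%:E.

Let I_ge0 p (G : nat -> R) : (forall i, 0 <= G i)%R -> 0 <= I p G.
Proof. by move=> G0; apply: integral_ge0 => x _; rewrite lee_fin. Qed.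

Let I_fin p (G : nat -> R) : (forall i, 0 <= G i <= 2)%R -> I p G = (fine (I p G))%:E.
Proof.
move=> G02; have G0 i : (0 <= G i)%R by case/andP: (G02 i).
rewrite fineK// ge0_fin_numE ?I_ge0//; apply: (@le_lt_trans _ _ (\int[K ^^ p]_x 2%:E)).
  apply: ge0_le_integral => //.
  - by move=> x _; rewrite lee_fin.
  - exact: (measurable_Gcnt ma (fun i => (G i.+1)%:E)).
  by move=> x _; rewrite lee_fin; case/andP: (G02 (set_cnt a x).+1).
by rewrite integral_cst// [X in _ * X]Kn1 mule1 ltry.
Qed.

Let drop_head (G : nat -> \bar R) : (forall i, 0 <= G i) ->
  \int[K ^^ (k + m)]_x G (set_cnt a (x \o @rshift k m)) = \int[K ^^ m]_x G (set_cnt a x).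
Proof.
move=> G0.
have := @integral_reindex _ X R K m (k + m) (@rshift k m) (fun x => G (set_cnt a x))
  (@rshift_inj _ _) (measurable_Gcnt ma G) (fun x => G0 _).
by rewrite K1 -EFin_expe expr1n mul1e.
Qed.

(* The first k of the k + m points change the count T by at most T - T', which
   integrates to mu - mum. *)
Let head_influence (G : nat -> R) : (forall i, 0 <= G i <= 2)%R ->
  (fine (I (k + m) G) + 2 * mum <= fine (I m G) + 2 * mu)%R /\
  (fine (I m G) + 2 * mum <= fine (I (k + m) G) + 2 * mu)%R.
Proof.
move=> G02; have G0 i : (0 <= G i)%R by case/andP: (G02 i).
have muE p : (2 * ('C(p, k)%:R * fine alpha))%:E =
    \int[K ^^ p]_x (2 * (set_cnt a x)%:R)%:E :> \bar R.
  under eq_integral do rewrite EFinM.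
  rewrite ge0_integralZl//; first by rewrite integral_set_cnt_prob alphaE -!EFinM.
  exact: (measurable_Gcnt ma (fun i => i%:R%:E)).
rewrite -!lee_fin !EFinD -!I_fin// !muE.
have d1 := drop_head (G := fun i => (G i.+1)%:E) (fun i => G0 i.+1).
have d2 := drop_head (G := fun i => (2 * i%:R)%:E) (fun i => mulr_ge0 (ler0n R 2) (ler0n R i)).
rewrite /I -d1 -d2.
have m1 (H : nat -> R) : measurable_fun setT (fun x : power X (k + m) => (H (set_cnt a x))%:E).
  exact: (measurable_Gcnt ma (fun i => (H i)%:E)).
have m2 (H : nat -> R) : measurable_fun setT
    (fun x : power X (k + m) => (H (set_cnt a (x \o @rshift k m)))%:E).
  exact: (measurableT_comp (measurable_Gcnt ma (fun i => (H i)%:E))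
    (@measurable_reindex _ X _ _ (@rshift k m))).
have h1 := m1 (fun i => G i.+1); have h2 := m2 (fun i => G i.+1).
have h3 := m1 (fun i => 2 * i%:R)%R; have h4 := m2 (fun i => 2 * i%:R)%R.
rewrite -!ge0_integralD//; try by move=> x _; rewrite lee_fin ?mulr_ge0.
have key (x : 'I_(k + m) -> X) : (set_cnt a (x \o @rshift k m) <= set_cnt a x)%N.
  rewrite leq_div2r// -inj_cnt_overlap0 /inj_cnt [leqRHS](bigID (fun j : {ffun _ -> _} =>
    overlap j == 0%N)) /=.
  exact: leq_addr.
split; apply: ge0_le_integral => //; try by move=> x _; rewrite -EFinD lee_fin addr_ge0// mulr_ge0.
all: try by apply: emeasurable_funD.
all: move=> x _; rewrite -!EFinD lee_fin.
all: have := key x; rewrite leq_eqVlt => /predU1P[->//|]; rewrite -(ler_nat R) -natr1.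
all: have /andP[] := G02 (set_cnt a x).+1.
all: have /andP[] := G02 (set_cnt a (x \o @rshift k m)).+1; lra.
Qed.

Let weighted (G : nat -> R) : (forall i, 0 <= G i)%R ->
  \int[P]_u ((T u)%:R * G (T u))%:E =
  C%:E * \int[K ^^ (k + m)]_x (ind (a (x \o @lshift k m)) * (G (set_cnt a x))%:E).
Proof.
move=> G0; rewrite (lawT (G := fun i => (i%:R * G i)%:E)); last first.
  by move=> i; rewrite lee_fin mulr_ge0.
exact: integral_set_cnt.
Qed.

(** [integral_head] compares with the count among the last [m] points; [head_influence] exchanges it
    for [T] at the price [2 * (mu - mum)], multiplied by [mu]. *)
Let stein (G : nat -> R) : (forall i, 0 <= G i <= 2)%R ->
  let D := (2 * V + 2 * (mu * (mu - mum)))%R in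
  \int[P]_u ((T u)%:R * G (T u))%:E <= mu%:E * \int[P]_u (G (T u).+1)%:E + D%:E /\
  mu%:E * \int[P]_u (G (T u).+1)%:E <= \int[P]_u ((T u)%:R * G (T u))%:E + D%:E.
Proof.
move=> G02 D; have G0 i : (0 <= G i)%R by case/andP: (G02 i).
rewrite weighted// (lawT (G := fun i => (G i.+1)%:E)); last by move=> i; rewrite lee_fin.
rewrite -/(I (k + m) G).
have [] := integral_head K asym ma k0 m G02.
rewrite -/(I m G) -/alpha -/eps (I_fin m G02) (I_fin (k + m) G02) alphaE epsE.
set J := integral _ _ _.
have J0 : 0 <= J by apply: integral_ge0 => x _; rewrite mule_ge0 ?lee_fin.
have [] := head_influence G02.
move: (fine (I m G)) (fine (I (k + m) G)) => i1 i2 H1 H2.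
case: J J0 => [J J0|_|//]; last first.
  by rewrite -!EFinM -!EFinD.
rewrite -!EFinM -!EFinD !lee_fin => H3 H4.
have C0 : (0 <= C)%R by [].
have {}H3 := ler_wpM2l C0 H3; have {}H4 := ler_wpM2l C0 H4.
have {}H1 := ler_wpM2l mu_ge0 H1; have {}H2 := ler_wpM2l mu_ge0 H2.
rewrite /D /V; rewrite /mu in H1 H2 *; split; lra.
Qed.

Let sqr : \int[P]_u ((T u)%:R * (T u)%:R)%:E = (V + mu * (mum + 1))%:E.
Proof.
rewrite (weighted (G := fun i => i%:R))// [X in _ * X](integral_head_sqr K asym ma k0).
have -> : \int[K ^^ m]_x (set_cnt a x).+1%:R%:E = (mum + 1)%:E.
  transitivity (\int[K ^^ m]_x ((set_cnt a x)%:R%:E + 1%:E)).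
    by apply: eq_integral => x _; rewrite -EFinD natr1.
  rewrite ge0_integralD//; last exact: (measurable_Gcnt ma (fun i => i%:R%:E)).
  by rewrite integral_cst// [X in _ + _ * X]Kn1 mule1 integral_set_cnt_prob alphaE.
transitivity (C%:E * ((fine eps)%:E + (fine alpha)%:E * (mum + 1)%:E)).
  by rewrite -epsE -alphaE.
rewrite -[LHS]/((C * (fine eps + fine alpha * (mum + 1)))%:E) /V /mu; congr EFin; ring.
Qed.

(** The falling factorials of order [k] and [k - l] are bounded by powers of the number of points.
    These are exactly the powers by which [overlap_int] grows when the probability [K] is multiplied
    by that number. *)
Let excess_le : V%:E <= \sum_(l < k.+1 | (0 < l < k)%N)
  ('C(k, l)%:R / k`!%:R)%:E * (((k + m)%:R ^+ (k + (k - l)))%:E * overlap_int K a l).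
Proof.
have kf : (k`!%:R != 0 :> R)%R by rewrite pnatr_eq0 -lt0n fact_gt0.
have -> : V%:E = (((k + m) ^_ k)%:R / (k`!%:R * k`!%:R))%:E * (k`!%:R%:E * eps).
  by rewrite epsE -!EFinM /V /C -bin_ffact natrM; congr EFin; field; rewrite kf.
rewrite excess_int_overlap// ge0_sume_distrr; last first.
  move=> l _; rewrite K1 -EFin_expe expr1n mul1e mule_ge0//.
  exact/overlap_int_ge0/(ltn_ord l).
apply: lee_sum => l lk; rewrite K1 -EFin_expe expr1n mul1e !muleA -!EFinM.
apply: lee_wpmul2r; first exact/overlap_int_ge0/(ltn_ord l).
rewrite lee_fin exprD -!natrX !natrM.
set A := ((k + m) ^_ k)%:R%R; set B := (m ^_ (k - l))%:R%R.
have -> : (A / (k`!%:R * k`!%:R) * ('C(k, l)%:R * (k ^_ l)%:R * B) =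
  'C(k, l)%:R / k`!%:R * (((k ^_ l)%:R / k`!%:R) * (A * B)) :> R)%R.
  by field; rewrite kf.
rewrite ler_wpM2l ?divr_ge0// -[leRHS]mul1r ler_pM ?divr_ge0 ?mulr_ge0//.
  rewrite ler_pdivrMr ?mul1r ?ltr0n ?fact_gt0// ler_nat.
  by rewrite -(ffact_fact (ltn_ord l : l <= k)%N) leq_pmulr ?fact_gt0.
rewrite ler_pM// ler_nat ?ffact_le_exp// (leq_trans (ffact_le_exp _ _))//.
by rewrite leq_exp2r ?leq_addl//; lia.
Qed.

Lemma binomial_bounds : let c := ((m ^_ k)%:R / ((k + m) ^_ k)%:R : R)%R in
  exists e s : R, [/\ \int[P]_u (T u)%:R%:E = e%:E,
    \int[P]_u ((T u)%:R * (T u)%:R)%:E = s%:E,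
    forall lam h, (0 <= lam)%R -> lip1 h ->
     `|\int[P]_u (h (T u)%:R)%:E - \int[poisson_prob lam 0%N]_n (h n%:R)%:E|
       <= (`|e - lam| + (2 * (s - e - c * (e * e)) + 2 * (1 - c) * (e * e)))%:E &
    (s - e - c * (e * e))%:E <= \sum_(l < k.+1 | (0 < l < k)%N)
      ('C(k, l)%:R / k`!%:R)%:E * (((k + m)%:R ^+ (k + (k - l)))%:E * overlap_int K a l)].
Proof.
move=> c.
have cmu : (c * mu = mum)%R.
  have nf p : (k <= p)%N -> ((p ^_ k)%:R != 0 :> R)%R.
    by move=> kp; rewrite pnatr_eq0 -lt0n ffact_gt0.
  rewrite /c /mu /mum /C mulrA; congr (_ * _)%R.
  rewrite -!bin_ffact !natrM.
  have nb : ('C(k + m, k)%:R != 0 :> R)%R by rewrite pnatr_eq0 -lt0n bin_gt0 leq_addr.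
  have kf : (k`!%:R != 0 :> R)%R by rewrite pnatr_eq0 -lt0n fact_gt0.
  by field; rewrite nb kf.
(* With [mum = c * mu], removing [mu] and [c * (mu * mu)] from the second moment leaves the excess
   term [V]. *)
have VE : (V + mu * (mum + 1) - mu - c * (mu * mu) = V)%R by rewrite -cmu; ring.
exists mu, (V + mu * (mum + 1))%R; rewrite VE; split => //.
move=> lam h lam0 hlip.
have -> : (2 * (1 - c) * (mu * mu) = 2 * (mu * (mu - mum)))%R by rewrite -cmu; ring.
apply: (stein_method mT lam0 _ mean hlip stein).
have cu0 : (0 <= fine eps)%R by exact: fine_ge0.
have mumle : (mum <= mu)%R.
  by rewrite ler_wpM2r ?fine_ge0// ler_nat leq_bin2l// leq_addl.
by apply: addr_ge0; apply: mulr_ge0 => //; apply: mulr_ge0; rewrite ?subr_ge0.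
Qed.

End binomial_moments.

(** * Binomial processes *)

Lemma le_ceiln (R : realType) (t : R) : (0 <= t -> t <= (ceiln t)%:R)%R.
Proof.
move=> t0; rewrite /ceiln pmulrn abszE ger0_norm; first exact: ceil_ge.
by rewrite ceil_ge0 (lt_le_trans _ t0)// ltrN10.
Qed.

Section binomial_process.
Context d (X : measurableType d) d' (Y : measurableType d') (R : realType).
Context dO (Om : measurableType dO) (P : probability Om R).
Variables (K1 : probability X R) (n : nat) (pt : nat -> Om -> X).
Hypothesis bin_pt : is_binomial_process P n pt K1.
Variables (k : nat) (f : ('I_k -> X) -> Y) (B : set Y).
Let a (x : 'I_k -> X) : bool := f x \in B.
Hypothesis asym : forall (s : {perm 'I_k}) x, a (x \o s) = a x.
Hypothesis ma : measurable_fun setT (a : power X k -> bool).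
Hypothesis k0 : (0 < k)%N.

Let y (w : Om) : power X n := fun i => pt i w.
Let T w := set_cnt a (y w).

Let my : measurable_fun setT y.
Proof. by apply: measurable_fun_power => i; have [+ _] := bin_pt; apply. Qed.

Let mT : measurable_fun setT T.
Proof. exact: (measurableT_comp (measurable_set_cnt ma (n := n)) my). Qed.

Lemma S_stat_binomial w : S_stat f B (fun=> (n%:R : R)%:E) pt w = (T w)%:R%:E.
Proof.
rewrite /S_stat (esum_inj_ffun (e := val : 'I_n -> nat)
  (q := fun i => (i%:R : R)%:E < (n%:R : R)%:E)).
- rewrite (eq_bigr (fun j : {ffun 'I_k -> 'I_n} => ((a (y w \o j))%:R : R)%:E)); last first.
    move=> j _; rewrite indicE; congr ((nat_of_bool _)%:R)%:E.
    by congr (f _ \in B); apply/funext => v; rewrite ffunE.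
  rewrite sumEFin -natr_sum -EFinM; congr EFin.
  rewrite -/(inj_cnt a _) set_cntE// natrM mulrC mulfK ?pnatr_eq0 -?lt0n ?fact_gt0//.
- exact: val_inj.
- move=> i; rewrite lte_fin ltr_nat; split => [i_n|[j ->]].
    by exists (Ordinal i_n).
  exact: ltn_ord.
- by move=> i; rewrite lee_fin.
Qed.

Let law (K : {finite_measure set X -> \bar R}) (KK1 : forall A, K A = K1 A)
    (G : nat -> \bar R) : (forall i, 0 <= G i) ->
  \int[P]_u G (T u) = \int[pmeasure K n]_x G (set_cnt a x).
Proof.
move=> G0; have [Q [QE Qint]] := pushforwardP P my.
rewrite -(Qint (fun x => G (set_cnt a x)) (measurable_Gcnt ma G) (fun x => G0 _)).
apply: eq_measure_integral => A mA _; apply: power_measure_unique => //.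
  by rewrite QE preimage_setT [ltLHS]probability_setT ltry.
move=> E mE; rewrite QE [RHS]pmeasure_box//.
(* The law of the points is prescribed for sequences of sets, so the finite family is extended by
   the whole space. *)
pose A' i := if insub i is Some j then E j else setT.
have A'E (i : 'I_n) : A' i = E i by rewrite /A' valK.
have mA' i : measurable (A' i) by rewrite /A'; case: insub.
have [_ /(_ A' mA')] := bin_pt.
under [in RHS]eq_bigr do rewrite A'E -KK1.
move=> <-; congr (P _); apply/seteqP; split => w /= H.
  by move=> i i_n; have := H (Ordinal i_n); rewrite -A'E.
by move=> i; have := H i (ltn_ord i); rewrite A'E.
Qed.

Let K1T : K1 setT = 1.
Proof. exact: probability_setT. Qed.

Let S := S_stat f B (fun=> (n%:R : R)%:E) pt : Om -> \bar R.

Lemma binomial_process_bounds (Kt : {measure set X -> \bar R}) :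
  (forall A, measurable A -> Kt A = n%:R%:E * K1 A) ->
  let c := (((n - k) ^_ k)%:R / (n ^_ k)%:R : R)%R in
  exists e s : R, [/\ \int[P]_w S w = e%:E,
    \int[P]_w (S w * S w) = s%:E,
    forall lam h, (0 <= lam)%R -> lip1 h ->
     `|\int[P]_w (h (fine (S w)))%:E - \int[poisson_prob lam 0%N]_n (h n%:R)%:E|
       <= (`|e - lam| + (2 * (s - e - c * (e * e)) + 2 * (1 - c) * (e * e)))%:E &
    (s - e - c * (e * e))%:E <= (2 ^+ k / k`!%:R)%:E * r_t f B Kt].
Proof.
move=> KtE c.
have K1oo : K1 setT < +oo by rewrite K1T ltry.
have [K KE] := finite_measureP K1oo.
have SE : S = fun w => (T w)%:R%:E by apply/funext => w; exact: S_stat_binomial.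
(* With fewer than [k] points there are no hits and both moments are 0; otherwise [n] is [k + m]
   with [m = n - k]. *)
rewrite SE; have [nk|kn] := ltnP n k.
  have T0 w : T w = 0%N by rewrite /T /set_cnt inj_cnt_small// div0n.
  have S1 : \int[P]_w (T w)%:R%:E = (0 : R)%:E.
    by apply: integral0_eq => w _; rewrite T0.
  exists 0%R, 0%R; rewrite !mulr0 !subr0; split => //.
  - by apply: integral0_eq => w _; rewrite T0 mul0e.
  - move=> lam h lam0 hlip; rewrite mulr0 addr0.
    apply: (stein_method mT lam0 _ S1 hlip) => // G _.
    have -> : \int[P]_w ((T w)%:R * G (T w))%:E = 0.
      by apply: integral0_eq => w _; rewrite T0 mul0r.
    by rewrite mul0e adde0.
  - apply: mule_ge0; last exact: r_t_ge0.
    by rewrite lee_fin; apply: divr_ge0 => //; exact: exprn_ge0.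
(* The dimension is generalised because [k + (n - k)] equals [n] without being convertible to it. *)
have law' p : p = n -> forall G : nat -> \bar R, (forall i, 0 <= G i) ->
    \int[P]_u G (T u) = \int[pmeasure K p]_x G (set_cnt a x).
  by move=> -> G G0; exact: law.
have KT : K setT = 1 by rewrite KE.
have := binomial_bounds KT asym ma k0 mT (law' _ (subnKC kn)).
rewrite (subnKC kn) => -[e [s [Ee Es H1 H2]]].
exists e, s; split => //; apply: (le_trans H2).
have Ktoo : Kt setT < +oo by rewrite KtE// K1T mule1 ltry.
(* [Kf] is [Kt] as a finite measure; passing to it from [K] absorbs the powers of [n]. *)
have [Kf KfE] := finite_measureP Ktoo.
apply: (@sum_overlap_le_r_t _ _ _ _ _ _ _ _ _
  (fun l => ((n%:R : R) ^+ (k + (k - l)))%:E * overlap_int K a l)) => l lk.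
rewrite -(overlap_int_scale (K' := Kf) _ _ ma) //; last 1 first.
- by move/andP: lk => [_ /ltnW].
- by apply: overlap_int_le_r_t => // A _; rewrite KfE.
- by move=> A mA; rewrite KfE KtE// KE.
Qed.

End binomial_process.

(** * The statistic, the Wasserstein distance and the final bounds *)

Lemma S_stat_tuple_sum d (X : measurableType d) (R : realType) dO
    (Om : measurableType dO) d' (Y : measurableType d') (k : nat)
    (f : ('I_k -> X) -> Y) (B : set Y) (kappa : Om -> \bar R) (pt : nat -> Om -> X) :
  S_stat f B kappa pt = tuple_sum kappa pt (fun x => f x \in B) setT.
Proof.
apply/funext => w; rewrite /S_stat /tuple_sum; congr (_ * esum _ _).
apply/seteqP; split => i /=.
  move=> [/injectiveP -> /= H]; apply/forallP => j.
  by rewrite /active H in_setT.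
move=> /andP[/injectiveP ij /forallP H]; split=> // j.
by have /andP[] := H j.
Qed.

Lemma dW_poisson_le dO (Om : measurableType dO) (R : realType)
    (P : probability Om R) (S : Om -> \bar R) (lam : R) (D : \bar R) :
  (forall h, lip1 h -> `|\int[P]_w (h (fine (S w)))%:E -
     \int[poisson_prob lam 0%N]_n (h n%:R)%:E| <= D) -> dW_poisson P S lam <= D.
Proof. by move=> H; apply: ge_ereal_sup => _ [h [hlip ->]]; exact: H. Qed.

Lemma symmetric_fun_comp (X Y : Type) k (f : ('I_k -> X) -> Y) (B : set Y) :
  symmetric_fun f -> forall (s : {perm 'I_k}) x, (f (x \o s) \in B) = (f x \in B).
Proof. by move=> sf s x; congr (_ \in B); exact: sf. Qed.

Lemma measurable_prod_fun_mem d (X : measurableType d) d' (Y : measurableType d')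
    k (f : ('I_k -> X) -> Y) (B : set Y) : measurable_prod_fun f -> measurable B ->
  measurable_fun setT ((fun x => f x \in B) : power X k -> bool).
Proof.
move=> mf mB; apply: (measurable_fun_bool true); rewrite setTI.
have := mf _ mB; congr (measurable (_ : set (power X k))).
by apply/seteqP; split => x /=; [move=> ?; exact/mem_set|move=> /set_mem].
Qed.

Lemma double_excess_le (R : realType) k (v : R) (r : \bar R) : v%:E <= (2 ^+ k / k`!%:R)%:E * r ->
  2%:E * v%:E <= (2 ^+ k.+1 / k`!%:R)%:E * r.
Proof.
move=> H; rewrite exprS -mulrA [in leRHS]EFinM -muleA.
by apply: lee_wpmul2l => //; rewrite lee_fin.
Qed.

Unset Implicit Arguments. Set Strict Implicit. Set Printing Implicit Defensive.

Theorem theorem7p1 (R : realType) (X Y : ptopologicalType) (k : nat)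
  (f : ('I_k -> borelT X) -> borelT Y) (B : set (borelT Y)) (lambda t : R) :
  lcscH X -> lcscH Y -> (0 < k)%N ->
  measurable_prod_fun f -> symmetric_fun f -> measurable B ->
  (0 <= lambda)%R -> (1 <= t)%R ->
  (* Poisson case: mu_t = eta_t, Poisson process with intensity K_t = t K *)
  (forall (dO : measure_display) (Omega : measurableType dO)
     (P : probability Omega R) (K Kt : {measure set (borelT X) -> \bar R})
     (kappa : Omega -> \bar R) (pt : nat -> Omega -> borelT X),
     sigma_finite [set: borelT X] K ->
     (forall A, measurable A -> Kt A = t%:E * K A) ->
     is_poisson_process P kappa pt Kt ->
     let S := S_stat f B kappa pt in
     let ES := \int[P]_w S w in
     let ES2 := \int[P]_w (S w * S w) in
     ES2 < +oo ->
     dW_poisson P S lambda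
       <= `|ES - lambda%:E| + 2%:E * (ES2 - ES - ES * ES) /\
     `|ES - lambda%:E| + 2%:E * (ES2 - ES - ES * ES)
       <= `|ES - lambda%:E| + (2 ^+ k.+1 / (k`!)%:R)%:E * r_t f B Kt)
  /\
  (* binomial case: mu_t = beta_t, ceil(t) i.i.d. points with law K_1,
     K_t = ceil(t) K_1 *)
  (forall (dO : measure_display) (Omega : measurableType dO)
     (P : probability Omega R) (K1 : probability (borelT X) R)
     (Kt : {measure set (borelT X) -> \bar R})
     (pt : nat -> Omega -> borelT X),
     (forall A, measurable A -> Kt A = ((ceiln t)%:R)%:E * K1 A) ->
     is_binomial_process P (ceiln t) pt K1 ->
     let S := S_stat f B (fun _ => ((ceiln t)%:R)%:E) pt in
     let ES := \int[P]_w S w in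
     let ES2 := \int[P]_w (S w * S w) in
     let c := ((((ceiln t - k) ^_ k)%:R / ((ceiln t) ^_ k)%:R)%R)%:E in
     ES2 < +oo ->
     dW_poisson P S lambda
       <= `|ES - lambda%:E| + 2%:E * (ES2 - ES - c * (ES * ES))
          + (6 ^+ k * (k`!)%:R / t)%:E * (ES * ES) /\
     `|ES - lambda%:E| + 2%:E * (ES2 - ES - c * (ES * ES))
          + (6 ^+ k * (k`!)%:R / t)%:E * (ES * ES)
       <= `|ES - lambda%:E| + (2 ^+ k.+1 / (k`!)%:R)%:E * r_t f B Kt
          + (6 ^+ k * (k`!)%:R / t)%:E * (ES * ES)).
Proof.
move=> _ _ k0 mf sf mB lam0 t1; have t0 : (0 < t)%R by exact: lt_le_trans t1.
have asym := symmetric_fun_comp B sf; have ma := measurable_prod_fun_mem mf mB.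
split=> [dO Omega P K Kt kappa pt sK KtE [mkappa _ mpt _ law] S ES ES2 S2oo|].
  (* Sigma-finiteness provides the windows: increasing sets that cover the space and have finite
     [K]-measure, hence finite [Kt]-measure. *)
  have [F [FT ndF mF]] := (sigma_finiteP _ _).1 sK.
  have KtF n : Kt (F n) < +oo.
    have [mFn KFn] := mF n; rewrite KtE//.
    by apply: lte_mul_pinfty => //; rewrite lee_fin ltW.
  have ndF' n m : (n <= m)%N -> F n `<=` F m by move=> /ndF/subsetPset.
  move: S2oo; rewrite /ES2 /ES /S S_stat_tuple_sum => S2oo.
  have [e [s [-> -> Hd Hr]]] := poisson_limit mkappa mpt law asym ma k0
    ndF' (fun n => (mF n).1) KtF (esym FT) S2oo.
  split; first by apply: dW_poisson_le => h hlip; exact: Hd.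
  apply: leeD2l; apply: double_excess_le; apply: Hr => K' KK'.
  apply: sum_overlap_le_r_t => l lk; exact: overlap_int_le_r_t.
move=> dO Omega P K1 Kt pt KtE bin_pt S ES ES2 c _.
have [e [s [Ee Es Hd Hr]]] := binomial_process_bounds bin_pt asym ma k0 KtE.
have tn : (0 < t <= (ceiln t)%:R)%R by rewrite t0 le_ceiln// ltW.
rewrite /ES2 /ES Ee Es; split.
  apply: dW_poisson_le => h hlip; apply: (le_trans (Hd _ _ lam0 hlip)).
  rewrite -[leRHS]/((`|e - lambda| + 2 * (s - e - _ * (e * e)) + _ * (e * e))%:E).
  rewrite lee_fin addrA lerD2l ler_wpM2r//; last exact: ffact_ratio_le.
  by rewrite -expr2 sqr_ge0.
by apply: leeD2r; apply: leeD2l; exact: double_excess_le.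
Qed.
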